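(* Suppose $-1<\alpha<\infty$ and $0<p<\infty$. Let $f=u+iv$ be a harmonic $K$-quasiregular function in $\mathbb{D}$. If the real part $u$ belongs to the weighted harmonic Bergman space $a^p_\alpha$, then the imaginary part $v$ also belongs to $a^p_\alpha$. Furthermore, there exists a positive constant $C_{p,K,\alpha}$, depending only on $p$, $K$ and $\alpha$, such that $$\|v\|_{a^p_\alpha}\le C_{p,K,\alpha}\,\|u\|_{a^p_\alpha}.$$ In particular, when $p>1$, $C_{p,K,\alpha}$ is independent of $\alpha$.
   Context: $\mathbb{D}=\{z\in\mathbb{C}:|z|<1\}$. $dA(z)=\frac1\pi\,dx\,dy$ is normalized area measure, and for $-1<\alpha<\infty$, $dA_\alpha(z)=(\alpha+1)(1-|z|^2)^\alpha\,dA(z)$. For $0<p<\infty$, the weighted harmonic Bergman space $a^p_\alpha$ consists of all complex-valued harmonic functions $f$ on $\mathbb{D}$ with $\|f\|_{a^p_\alpha}:=\left(\int_{\mathbb{D}}|f(z)|^p\,dA_\alpha(z)\right)^{1/p}<\infty$. Every complex-valued harmonic function on $\mathbb{D}$ has a unique decomposition $f=h+\overline g$ with $h,g$ analytic in $\mathbb{D}$ and $g(0)=0$. It is sense-preserving if its Jacobian $|h'(z)|^2-|g'(z)|^2$ is positive in $\mathbb{D}$, equivalently $|g'(z)|<|h'(z)|$ for all $z\in\mathbb{D}$. A sense-preserving harmonic function $f=h+\overline g$ is $K$-quasiregular, $K\ge1$, if $\frac{|h'(z)|+|g'(z)|}{|h'(z)|-|g'(z)|}\le K$ for all $z\in\mathbb{D}$,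 equivalently $|g'(z)|\le k|h'(z)|$ for all $z\in\mathbb{D}$, where $k=\frac{K-1}{K+1}<1$.
   Formalization: The norm inequality is stated under the added normalization v(0)=0, since it is false otherwise (f(z)=z+ic leaves u fixed while the norm of v grows without bound); membership of v in the Bergman space is still asserted for every f. *)

(* Defs.v *)
From HB Require Import structures.
From mathcomp Require Import all_boot all_order all_algebra.
From mathcomp Require Import complex.
From mathcomp Require Import all_classical all_reals all_analysis.
Import Order.TTheory GRing.Theory Num.Theory.
Import numFieldNormedType.Exports.

Set Implicit Arguments.
Unset Strict Implicit.
Unset Printing Implicit Defensive.

Local Open Scope classical_set_scope.
Local Open Scope ring_scope.
Local Open Scope complex_scope.

(* The R-valued modulus: the library norm `|z| takes its values in R[i]. *)
Definition cabs (R : realType) (z : R[i]) : R := complex.Re `|z|.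

Definition unit_disk (R : realType) : set R[i] := [set z | cabs z < 1].

Definition of_plane (R : realType) (w : R * R) : R[i] := w.1 +i* w.2.

Definition unit_disk_plane (R : realType) : set (R * R) :=
  [set w | unit_disk (of_plane w)].

Definition partial_x (R : realType) (u : R * R -> R) : R * R -> R :=
  fun w => 'D_((1, 0) : R * R) u w.

Definition partial_y (R : realType) (u : R * R -> R) : R * R -> R :=
  fun w => 'D_((0, 1) : R * R) u w.

Definition C1_on (R : realType) (D : set (R * R)) (u : R * R -> R) : Prop :=
  forall w, D w ->
    [/\ derivable u w (1, 0), derivable u w (0, 1),
        {for w, continuous (partial_x u)} &
        {for w, continuous (partial_y u)}].

Definition C2_on (R : realType) (D : set (R * R)) (u : R * R -> R) : Prop :=
  [/\ C1_on D u, C1_on D (partial_x u) & C1_on D (partial_y u)].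

Definition real_harmonic_on (R : realType) (D : set (R * R))
    (u : R * R -> R) : Prop :=
  C2_on D u /\
  forall w, D w ->
    partial_x (partial_x u) w + partial_y (partial_y u) w = 0.

Definition harmonic_disk (R : realType) (f : R[i] -> R[i]) : Prop :=
  real_harmonic_on (@unit_disk_plane R) (fun w => complex.Re (f (of_plane w))) /\
  real_harmonic_on (@unit_disk_plane R) (fun w => complex.Im (f (of_plane w))).

(* Scalars of the domain and codomain are R[i], so derivability in the
   direction 1 is complex differentiability. *)
Definition analytic_disk (R : realType) (h : R[i] -> R[i]) : Prop :=
  forall z, unit_disk z -> derivable (h : R[i]^o -> R[i]^o) z 1.

Definition cderiv (R : realType) (h : R[i] -> R[i]) (z : R[i]) : R[i] :=
  'D_1 (h : R[i]^o -> R[i]^o) z.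

Definition canonical_decomposition (R : realType) (f h g : R[i] -> R[i]) :
    Prop :=
  [/\ analytic_disk h, analytic_disk g, g 0 = 0 &
      forall z, unit_disk z -> f z = h z + conjc (g z)].

Definition sense_preserving (R : realType) (h g : R[i] -> R[i]) : Prop :=
  forall z, unit_disk z -> 0 < cabs (cderiv h z) ^+ 2 - cabs (cderiv g z) ^+ 2.

(* The decomposition is unique on the disk, so quantifying it existentially or
   universally makes no difference. *)
Definition harmonic_quasiregular (R : realType) (K : R) (f : R[i] -> R[i]) :
    Prop :=
  harmonic_disk f /\
  exists h g : R[i] -> R[i],
    [/\ canonical_decomposition f h g, sense_preserving h g &
        forall z, unit_disk z ->
          (cabs (cderiv h z) + cabs (cderiv g z)) /
          (cabs (cderiv h z) - cabs (cderiv g z)) <= K].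

(* Density of dA_alpha with respect to dx dy. *)
Definition dA_density (R : realType) (alpha : R) (z : R[i]) : R :=
  (alpha + 1) * (1 - cabs z ^+ 2) `^ alpha / pi.

Definition bergman_norm (R : realType) (p alpha : R) (f : R[i] -> R[i]) :
    \bar R :=
  poweR (\int[(@lebesgue_measure R \x @lebesgue_measure R)%E]_(w in
          @unit_disk_plane R)
          (cabs (f (of_plane w)) `^ p * dA_density alpha (of_plane w))%:E)
        p^-1.

Definition in_bergman (R : realType) (p alpha : R) (f : R[i] -> R[i]) : Prop :=
  harmonic_disk f /\ (bergman_norm p alpha f < +oo)%E.

Definition re_part (R : realType) (f : R[i] -> R[i]) : R[i] -> R[i] :=
  fun z => (complex.Re (f z))%:C.

Definition im_part (R : realType) (f : R[i] -> R[i]) : R[i] -> R[i] :=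
  fun z => (complex.Im (f z))%:C.

(* Main.v *)
Require Import Defs.
From HB Require Import structures.
From mathcomp Require Import all_boot all_order all_algebra.
From mathcomp Require Import complex.
From mathcomp Require Import all_classical all_reals all_analysis.
From mathcomp Require Import measurable_realfun.
From mathcomp Require Import ring lra.
Import Order.TTheory GRing.Theory Num.Theory.
Import numFieldNormedType.Exports.


(** Write [f = h + conj g], [u = Re f] and [v = Im f]. The gradients of [u] and [v] have lengths
    [|h' + g'|] and [|h' - g'|], and quasiregularity gives
    [|h' - g'| <= |h'| + |g'| <= K (|h'| - |g'|) <= K |h' + g'|]
    ([gradient_decomposition], [quasiregular_gradient]). After replacing [u] by [K u], the claim
    is about two real harmonic functions with [|grad v| <= |grad u|] and [v(0) = 0]: the integral
    of [(1 - |z|^2)^alpha |v|^p] over the disc is at most a constant times that of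
    [(1 - |z|^2)^alpha |u|^p]. If [v(0)] is arbitrary, the norm of [v] is still finite, since the
    weight has finite mass ([disc_energy_finite_shift]).

    For [p > 1] there is a function [Phi] of two real variables ([bell], up to a regularization
    [e] that tends to 0) such that [Phi (u, v)] is subharmonic whenever [|grad v| <= |grad u|], with
    [Phi (x, 0) >= 0] and [Phi (x, y) <= C |x|^p - |y|^p / 2]. A subharmonic function lies below its
    averages against any radial weight [omega] ([submean]), so
    [0 <= Phi (u (0), 0) * int omega <= int omega (C |u|^p - |v|^p / 2)]. The constant comes from
    [Phi] only and not from the weight; this is why it does not depend on [alpha] ([riesz_disc]).

    For [p <= 1] the radius is divided by the points [t_j = 1 - 2^-j]. Because [p <= 1],
    [|v(z)|^p] is at most the sum of the [|v(t_(j+1) z) - v(t_j z)|^p]. Each increment is at most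
    the length of the step times the supremum of [|grad u|] near it, and that supremum is
    controlled by a local integral of [|u|^p]: for harmonic functions the gradient is bounded by
    the supremum ([harmonic_grad]), and [|u|^p] satisfies a sub-mean value inequality up to a
    constant although for [p < 1] it is not subharmonic ([subharmonic_powR]). Integrating over [z] and
    exchanging the order of integration, a position [w] is seen only by points [z] at distance less
    than [6 (1 - |w|)], whose total weight is at most a constant times [(1 - |w|)^(alpha + 2)]
    ([carleson]), and only by steps with [2^-j] at most a multiple of [1 - |w|], which sum to a
    geometric series. What remains is [(1 - |w|^2)^alpha |u(w)|^p] ([small_disc]). *)

Local Open Scope ring_scope.
Set Implicit Arguments.
Unset Strict Implicit.
Unset Printing Implicit Defensive.
Local Open Scope classical_set_scope.

(** * C1 functions of two real variables *)

Section plane_calculus.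
Context {R : realType}.
Implicit Types (f fx fy : R * R -> R) (w : R * R) (D : set (R * R)).

(** The partial derivatives are carried along as explicit functions, and are derivatives of
    the restrictions of [f] to horizontal and vertical lines. *)
Definition C1 D f fx fy := forall w, D w ->
  [/\ is_derive w.1 1 (fun x => f (x, w.2)) (fx w),
      is_derive w.2 1 (fun y => f (w.1, y)) (fy w),
      {for w, continuous fx} & {for w, continuous fy}].

Lemma near_box (w0 : R * R) (P : R * R -> Prop) : (\forall w \near w0, P w) <->
  exists2 r, 0 < r & forall w, `|w.1 - w0.1| < r -> `|w.2 - w0.2| < r -> P w.
Proof.
split.
  move=> /nbhs_ballP[r /= r0 hr]; exists r => // w h1 h2; apply: hr.
  by split; rewrite /ball /= distrC.
move=> [r r0 hr].
apply/(@nbhs_ballP R (R * R)%type) => /=; exists r => //= w [h1 h2].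
by apply: hr; rewrite distrC.
Qed.

Lemma cts_boxP (w0 : R * R) (f : R * R -> R) : {for w0, continuous f} <->
  forall e, 0 < e -> exists2 r, 0 < r &
    forall w, `|w.1 - w0.1| < r -> `|w.2 - w0.2| < r -> `|f w - f w0| < e.
Proof.
split.
  move=> /cvgrPdist_lt cf e /cf /near_box[r r0 hr]; exists r => // w h1 h2.
  by rewrite distrC; exact: hr.
move=> hf; apply/cvgrPdist_lt => e /hf hr; apply/near_box.
by have [r r0 h] := hr; exists r => // w h1 h2; rewrite distrC; exact: h.
Qed.

Lemma mvt_ball (g dg : R -> R) (a b r c : R) : `|a - c| < r -> `|b - c| < r ->
  (forall x, `|x - c| < r -> is_derive x 1 g (dg x)) ->
  exists2 x, `|x - c| < r & g b - g a = dg x * (b - a).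
Proof.
wlog ab : a b / a <= b => [hw|] ac bc gd.
  have [ab|/ltW ba] := leP a b; first exact: hw.
  have [x xc e] := hw b a ba bc ac gd.
  by exists x => //; rewrite -opprB e -mulrN opprB.
have hx x : x \in `[a, b]%R -> `|x - c| < r.
  rewrite in_itv/= => /andP[? ?]; move: ac bc; rewrite !ltr_norml => /andP[? ?] /andP[? ?].
  by apply/andP; split; lra.
have [||x xab e] := @MVT_segment R g dg a b ab.
- by move=> x xab; apply: gd; apply: hx; exact: subset_itv_oo_cc.
- apply: derivable_within_continuous => x xab.
  by have := gd x (hx _ xab) => /@ex_derive.
by exists x => //; exact: hx.
Qed.

(** Moving first vertically and then horizontally, the mean value theorem turns the increment of
    [f] into values of [fx] and [fy] at nearby points. Continuity and the chain rule both follow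
    from this form, which avoids Frechet derivatives. *)
Lemma C1_increments D f fx fy w0 : open D -> C1 D f fx fy -> D w0 ->
  exists X Y : R * R -> R, [/\ {for w0, continuous X}, {for w0, continuous Y},
   X w0 = fx w0, Y w0 = fy w0 &
   forall w, f w - f w0 = X w * (w.1 - w0.1) + Y w * (w.2 - w0.2)].
Proof.
move=> oD hf Dw0.
pose X w := if w.1 == w0.1 then fx w0 else (f w - f (w0.1, w.2)) / (w.1 - w0.1).
pose Y w := if w.2 == w0.2 then fy w0 else (f (w0.1, w.2) - f w0) / (w.2 - w0.2).
have [d d0 dD] := (near_box _ _).1 (open_nbhs_nbhs (conj oD Dw0)).
have mvX r w : r <= d -> `|w.1 - w0.1| < r -> `|w.2 - w0.2| < r ->
    exists w', [/\ `|w'.1 - w0.1| < r, `|w'.2 - w0.2| < r & X w = fx w'].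
  move=> rd h1 h2; rewrite /X; have r0 : 0 < r by apply: le_lt_trans h1.
  case: eqP => [e|/eqP ne]; first by exists w0; rewrite !subrr normr0.
  have [|//||x xr e] := @mvt_ball (fun x => f (x, w.2)) (fun x => fx (x, w.2))
     w0.1 w.1 r w0.1.
  - by rewrite subrr normr0.
  - move=> x xr; have [] // := hf (x, w.2); apply: dD => /=;
    exact: lt_le_trans rd.
  exists (x, w.2); split => //.
  have -> : f w - f (w0.1, w.2) = fx (x, w.2) * (w.1 - w0.1).
    by rewrite -e -surjective_pairing.
  by rewrite mulfK// subr_eq0.
have mvY r w : r <= d -> `|w.1 - w0.1| < r -> `|w.2 - w0.2| < r ->
    exists w', [/\ `|w'.1 - w0.1| < r, `|w'.2 - w0.2| < r & Y w = fy w'].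
  move=> rd h1 h2; rewrite /Y; have r0 : 0 < r by apply: le_lt_trans h1.
  case: eqP => [e|/eqP ne]; first by exists w0; rewrite !subrr normr0.
  have [|//||y yr e] := @mvt_ball (fun y => f (w0.1, y)) (fun y => fy (w0.1, y))
     w0.2 w.2 r w0.2.
  - by rewrite subrr normr0.
  - move=> y yr; have [] // := hf (w0.1, y); apply: dD => /=;
    rewrite ?subrr ?normr0//; exact: lt_le_trans rd.
  exists (w0.1, y); split => //=; rewrite ?subrr ?normr0//.
  have -> : f (w0.1, w.2) - f w0 = fy (w0.1, y) * (w.2 - w0.2).
    by rewrite -e -surjective_pairing.
  by rewrite mulfK// subr_eq0.
have Xw0 : X w0 = fx w0 by rewrite /X eqxx.
have Yw0 : Y w0 = fy w0 by rewrite /Y eqxx.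
have [_ _ cx cy] := hf _ Dw0.
exists X, Y; split => //.
- apply/cts_boxP => e e0; rewrite Xw0.
  have [r r0 hr] := (cts_boxP _ _).1 cx e e0.
  exists (Num.min r d); rewrite ?lt_min ?r0// => w.
  rewrite !lt_min => /andP[h1 h2] /andP[h3 h4].
  have [|||w' [w1 w2 ->]] := mvX (Num.min r d) w; rewrite ?lt_min ?h1 ?h3//.
    by rewrite ge_min lexx orbT.
  by move: w1 w2; rewrite !lt_min => /andP[? _] /andP[? _]; exact: hr.
- apply/cts_boxP => e e0; rewrite Yw0.
  have [r r0 hr] := (cts_boxP _ _).1 cy e e0.
  exists (Num.min r d); rewrite ?lt_min ?r0// => w.
  rewrite !lt_min => /andP[h1 h2] /andP[h3 h4].
  have [|||w' [w1 w2 ->]] := mvY (Num.min r d) w; rewrite ?lt_min ?h1 ?h3//.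
    by rewrite ge_min lexx orbT.
  by move: w1 w2; rewrite !lt_min => /andP[? _] /andP[? _]; exact: hr.
- move=> w; rewrite /X /Y.
  have -> : f w - f w0 = (f w - f (w0.1, w.2)) + (f (w0.1, w.2) - f w0) by ring.
  congr (_ + _).
    case: eqP => [e|/eqP ne]; last by rewrite divfK// subr_eq0.
    by rewrite e subrr mulr0 -e -surjective_pairing subrr.
  case: eqP => [e|/eqP ne]; last by rewrite divfK// subr_eq0.
  by rewrite e subrr mulr0 -surjective_pairing subrr.
Qed.

Lemma C1_continuous D f fx fy w : open D -> C1 D f fx fy -> D w ->
  {for w, continuous f}.
Proof.
move=> oD hf Dw; have [X [Y [cX cY _ _ e]]] := C1_increments oD hf Dw.
have -> : f = fun z => f w + (X z * (z.1 - w.1) + Y z * (z.2 - w.2)).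
  by apply/funext => z; rewrite -e addrC subrK.
apply: cvgD; first exact: cvg_cst.
apply: cvgD; apply: cvgM => //; apply: cvgB; try exact: cvg_cst.
  exact: cvg_fst.
exact: cvg_snd.
Qed.

Lemma is_derive_slope (g : R -> R) (t dg : R) : is_derive t 1 g dg ->
  exists G : R -> R, [/\ {for t, continuous G}, G t = dg &
    forall s, g s - g t = G s * (s - t)].
Proof.
move=> hg; pose G s := if s == t then dg else (g s - g t) / (s - t).
have Gt : G t = dg by rewrite /G eqxx.
exists G; split => //; last first.
  move=> s; rewrite /G; case: eqP => [->|/eqP ne]; first by rewrite !subrr mulr0.
  by rewrite divfK// subr_eq0.
apply/cvgrPdist_lt => e e0; rewrite Gt.
have [dg1 dg2] := hg.
have : h^-1 *: (g (h *: 1 + t) - g t) @[h --> 0^'] --> dg.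
  by rewrite -dg2; exact: dg1.
move=> /cvgrPdist_lt/(_ e e0)/nbhs_ballP[r /= r0 hr].
apply/nbhs_ballP; exists r => // s; rewrite /ball/= => st.
rewrite /G; case: eqP => [_|/eqP ne]; first by rewrite subrr normr0.
have := hr (s - t); rewrite /ball/= sub0r normrN distrC => /(_ st).
by rewrite subr_eq0 => /(_ ne); rewrite !scaler1 !subrK [_ *: _]mulrC.
Qed.

Lemma slope_is_derive (g G : R -> R) (t : R) : {for t, continuous G} ->
  (forall s, g s - g t = G s * (s - t)) -> is_derive t 1 g (G t).
Proof.
move=> cG gG.
have lim : h^-1 *: (g (h *: 1 + t) - g t) @[h --> 0^'] --> G t.
  apply/cvgrPdist_lt => e e0.
  have /cvgrPdist_lt/(_ e e0)/nbhs_ballP[r /= r0 hr] := cG.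
  apply/nbhs_ballP; exists r => //= h; rewrite /ball/= sub0r normrN => hr1 h0; rewrite gG.
  rewrite scaler1 addrK [_ *: _]mulrCA mulVf// mulr1; apply: hr.
  by rewrite /ball/= opprD addrCA subrr addr0 normrN.
apply: DeriveDef; first by apply/cvg_ex; exists (G t).
exact: (cvg_lim _ lim).
Qed.

Lemma is_derive_continuous (g : R -> R) (t dg : R) : is_derive t 1 g dg ->
  {for t, continuous g}.
Proof. by move=> [h _]; apply/differentiable_continuous/derivable1_diffP. Qed.

Lemma continuous_pair2 (T : topologicalType) (f : R * R -> R) (a b : T -> R) (t : T) :
  {for t, continuous a} -> {for t, continuous b} ->
  {for (a t, b t), continuous f} -> {for t, continuous (fun s => f (a s, b s))}.
Proof.
move=> ca cb cf; apply: (@continuous_comp _ _ _ (fun s => (a s, b s)) f) => //.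
exact: (@cvg_pair _ _ _ (nbhs t) (nbhs (a t)) (nbhs (b t)) _ _ _ a b ca cb).
Qed.

Lemma C1_chain D f fx fy (a b : R -> R) (t da db : R) :
  open D -> C1 D f fx fy -> D (a t, b t) ->
  is_derive t 1 a da -> is_derive t 1 b db ->
  is_derive t 1 (fun t => f (a t, b t)) (fx (a t, b t) * da + fy (a t, b t) * db).
Proof.
move=> oD hf Dw ha hb; have [X [Y [cX cY eX eY e]]] := C1_increments oD hf Dw.
have [A [cA eA hA]] := is_derive_slope ha.
have [B [cB eB hB]] := is_derive_slope hb.
have ca := is_derive_continuous ha; have cb := is_derive_continuous hb.
rewrite -eX -eY -eA -eB.
pose G s := X (a s, b s) * A s + Y (a s, b s) * B s.
apply: (@slope_is_derive _ G); last first.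
  move=> s; rewrite e/= hA hB /G mulrDl !mulrA//.
apply: cvgD; apply: cvgM => //; exact: continuous_pair2.
Qed.

End plane_calculus.

(** * Integrals over the plane *)

Section plane_integral.
Context {R : realType}.
Local Notation mR := (measurableTypeR R).
Local Notation plane := (mR * mR)%type.
Local Notation mu := (@lebesgue_measure R).
Local Notation mu2 := (@lebesgue_measure R \x @lebesgue_measure R)%E.

Definition box (b : R) : set plane := `[-b, b]%classic `*` `[-b, b]%classic.

(** An open set is a countable union of squares with rational centres and radii, hence lies in
    the product sigma-algebra. *)
Lemma open_measurable2 (U : set (R * R)) : open U -> measurable (U : set plane).
Proof.
move=> oU.
pose B (i : rat * rat * rat) : set plane :=
  [set x : R | `|x - ratr i.1.1| < ratr i.2] `*` [set y : R | `|y - ratr i.1.2| < ratr i.2].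
have mB i : measurable (B i).
  have oB (c r : R) : measurable ([set x : R | `|x - c| < r] : set mR).
    rewrite (_ : [set _ | _] = `]c - r, c + r[%classic); first exact: measurable_itv.
    by apply/seteqP; split => x; rewrite /= in_itv/= -ltr_distl.
  exact: measurableX.
rewrite (_ : U = \bigcup_i (if `[<B i `<=` U>] then B i else set0)); last first.
  apply/seteqP; split => [w Uw|w [i _]]; last by case: asboolP => // + wi; apply.
  have [r r0 hr] := (near_box _ _).1 (open_nbhs_nbhs (conj oU Uw)).
  have r40 : 0 < r / 4 by rewrite divr_gt0.
  have [|c] := @rat_in_itvoo R (r / 4) (r / 2); first lra.
  rewrite in_itv/= => /andP[c1 c2].
  have [|a] := @rat_in_itvoo R (w.1 - r / 4) (w.1 + r / 4); first lra.
  rewrite in_itv/= => /andP[a1 a2].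
  have [|b] := @rat_in_itvoo R (w.2 - r / 4) (w.2 + r / 4); first lra.
  rewrite in_itv/= => /andP[b1 b2].
  exists (a, b, c) => //; case: asboolP => [_|[]].
    by split => /=; rewrite ltr_norml; apply/andP; split; lra.
  move=> z [/=]; rewrite !ltr_norml => /andP[? ?] /andP[? ?].
  by apply: hr; rewrite !ltr_norml; apply/andP; split; lra.
apply: countable_bigcupT_measurable => [|i]; first exact: countableP.
by case: ifP => _; [exact: mB|exact: measurable0].
Qed.

Lemma continuous_measurable2 (U : set (R * R)) (f : R * R -> R) : open U ->
  (forall w, U w -> {for w, continuous f}) -> measurable_fun (U : set plane) (f : plane -> mR).
Proof.
move=> oU cf; apply: (measurability _ (RGenOpens.measurableE R)).
move=> _ [_ [a [b ->] <-]].
apply: open_measurable2; rewrite openE => w [Uw faw].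
apply/near_box.
have := cf w Uw _ (open_nbhs_nbhs (conj (@interval_open R (BRight a) (BLeft b) isT isT) faw)).
move=> /near_box[r r0 hr].
have [s s0 hs] := (near_box _ _).1 (open_nbhs_nbhs (conj oU Uw)).
exists (Num.min r s); rewrite ?lt_min ?r0// => z.
rewrite !lt_min => /andP[? ?] /andP[? ?]; split; [exact: hs|exact: hr].
Qed.

Lemma continuousT_measurable2 (f : R * R -> R) :
  continuous f -> measurable_fun setT (f : plane -> mR).
Proof. by move=> cf; apply: (@continuous_measurable2 setT f (@openT (R * R)%type)) => w _; exact: cf. Qed.

Lemma measurable_box b : measurable (box b).
Proof. exact: measurableX. Qed.

Lemma box_finite b : (mu2 (box b) < +oo)%E.
Proof.
rewrite product_measure1E//= lebesgue_measure_itv/=.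
by case: ifP; rewrite ?mul0e// -EFinB -EFinM ltry.
Qed.

Lemma compact_box b : compact (box b : set (R * R)).
Proof. by apply: compact_setX; exact: segment_compact. Qed.

Lemma integrable_bounded_box (f : R * R -> R) (b M : R) :
  measurable_fun setT (f : plane -> mR) ->
  (forall w, `|f w| <= M) -> (forall w, ~ box b w -> f w = 0) ->
  mu2.-integrable setT (EFin \o f).
Proof.
move=> mf fM f0.
rewrite (_ : EFin \o f = (EFin \o f) \_ (box b)); last first.
  apply/funext => w; rewrite patchE; case: ifPn => // /negP; rewrite inE => /f0 /= ->.
  by [].
apply/integrable_restrict; rewrite ?setTI//; first exact: measurable_box.
apply: measurable_bounded_integrable => //.
- exact: measurable_box.
- exact: box_finite.
- exact: measurable_funTS.
- exists M; split; first exact: num_real.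
  by move=> x Mx w _ /=; apply: le_trans (fM w) _; exact: ltW.
Qed.

Lemma continuous_bounded_box (f : R * R -> R) (b : R) :
  continuous f -> (forall w, ~ box b w -> f w = 0) -> exists M, forall w, `|f w| <= M.
Proof.
move=> cf f0.
have : compact (f @` box b).
  apply: continuous_compact; last exact: compact_box.
  by apply: continuous_subspaceT => w; exact: cf.
move=> /compact_bounded[M [_ hM]].
exists (`|M| + 1) => w.
have [bw|/f0 ->] := pselect (box b w); last by rewrite normr0 addr_ge0.
by apply: hM; [apply: le_lt_trans (ler_norm _) _; rewrite ltrDl|exists w].
Qed.

Lemma integrable_continuous_box (f : R * R -> R) (b : R) :
  continuous f -> (forall w, ~ box b w -> f w = 0) ->
  mu2.-integrable setT (EFin \o f).
Proof.
move=> cf f0; have [M hM] := continuous_bounded_box cf f0.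
by apply: (integrable_bounded_box (b := b) (M := M)) => //; exact: continuousT_measurable2.
Qed.

Lemma integral_derive_eq0 (H h : R -> R) (b : R) : 0 < b ->
  (forall x : R, is_derive x 1 H (h x)) -> continuous h ->
  (forall x, b <= `|x| -> H x = 0) -> (forall x, b < `|x| -> h x = 0) ->
  (\int[mu]_x (h x)%:E = 0)%E.
Proof.
move=> b0 dH ch H0 h0.
rewrite (_ : (fun x => (h x)%:E) = (EFin \o h) \_ `[-b, b]); last first.
  apply/funext => x; rewrite patchE /= mem_setE in_itv/= -ler_norml.
  by case: ifPn => //; rewrite -ltNge => /h0 ->.
rewrite -integral_mkcond.
rewrite (@continuous_FTC2 _ h H (-b) b); first by rewrite !H0 ?subee ?normrN ?ger0_norm// ltW.
- lra.
- exact: continuous_subspaceT.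
- by split => [x _| |]; [apply: ex_derive|
    apply: cvg_at_right_filter|apply: cvg_at_left_filter]; apply: is_derive_continuous.
- by move=> x _; rewrite derive1E; apply: derive_val.
Qed.

(** Fubini and the fundamental theorem of calculus: the derivative of a compactly supported
    function has integral 0. All integrations by parts below go through this lemma and its
    analogue for [y]. *)
Lemma integral_partial_x_eq0 (H h : R * R -> R) (b : R) : 0 < b ->
  (forall w : R * R, is_derive w.1 1 (fun x => H (x, w.2)) (h w)) -> continuous h ->
  (forall w, b <= `|w.1| -> H w = 0) -> (forall w, ~ box b w -> h w = 0) ->
  \int[mu2]_w h w = 0.
Proof.
move=> b0 dH ch H0 h0.
rewrite /Rintegral -integral21_prod_meas1; last exact: (integrable_continuous_box (b := b)).
rewrite integral0_eq// => y _.
apply: (@integral_derive_eq0 (fun x => H (x, y)) (fun x => h (x, y)) b) => //.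
- by move=> x; exact: (dH (x, y)).
- by move=> x; apply: (continuous_pair2 (a := id) (b := cst y)); [exact: cvg_id|exact: cvg_cst|exact: ch].
- by move=> x bx; exact: H0.
- by move=> x bx; apply: h0; rewrite /box /= => -[]; rewrite /= in_itv/= -ler_norml leNgt bx.
Qed.

Lemma integral_partial_y_eq0 (H h : R * R -> R) (b : R) : 0 < b ->
  (forall w : R * R, is_derive w.2 1 (fun y => H (w.1, y)) (h w)) -> continuous h ->
  (forall w, b <= `|w.2| -> H w = 0) -> (forall w, ~ box b w -> h w = 0) ->
  \int[mu2]_w h w = 0.
Proof.
move=> b0 dH ch H0 h0.
rewrite /Rintegral -integral12_prod_meas1; last exact: (integrable_continuous_box (b := b)).
rewrite integral0_eq// => x _.
apply: (@integral_derive_eq0 (fun y => H (x, y)) (fun y => h (x, y)) b) => //.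
- by move=> y; exact: (dH (x, y)).
- by move=> y; apply: (continuous_pair2 (a := cst x) (b := id)); [exact: cvg_cst|exact: cvg_id|exact: ch].
- by move=> y bx; exact: H0.
- by move=> y bx; apply: h0; rewrite /box /= => -[] _; rewrite /= in_itv/= -ler_norml leNgt bx.
Qed.

End plane_integral.

(** * Radial weights and the sub-mean value property *)

Definition sqn {R : realType} (w : R * R) : R := w.1 ^+ 2 + w.2 ^+ 2.
Definition line {R : realType} (z0 : R * R) (t : R) (z : R * R) : R * R :=
  (z0.1 + t * z.1, z0.2 + t * z.2).
Definition odisc {R : realType} (z0 : R * R) (r : R) : set (R * R) :=
  [set w | sqn (w.1 - z0.1, w.2 - z0.2) < r ^+ 2].

Lemma is_derive_rew {R : realType} (g : R -> R) (x d d' : R) : d = d' ->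
  is_derive x 1 g d -> is_derive x 1 g d'.
Proof. by move=> ->. Qed.

Section mean_value.
Context {R : realType}.
Local Notation mR := (measurableTypeR R).
Local Notation plane := (mR * mR)%type.
Local Notation mu := (@lebesgue_measure R).
Local Notation mu2 := (@lebesgue_measure R \x @lebesgue_measure R)%E.

Lemma sqn_continuous : continuous (@sqn R).
Proof.
move=> w; apply: cvgD; apply: cvgM; by [exact: cvg_fst|exact: cvg_snd].
Qed.

Lemma sqn_ge0 (w : R * R) : 0 <= sqn w.
Proof. by rewrite addr_ge0// sqr_ge0. Qed.

Lemma line_continuous (z0 : R * R) t (f : R * R -> R) (z : R * R) :
  {for line z0 t z, continuous f} -> {for z, continuous (fun z => f (line z0 t z))}.
Proof.
move=> cf; apply: (continuous_pair2 (a := fun z : R * R => z0.1 + t * z.1) (b := fun z => z0.2 + t * z.2)) => //.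
  by apply: cvgD; [exact: cvg_cst|apply: cvgM; [exact: cvg_cst|exact: cvg_fst]].
by apply: cvgD; [exact: cvg_cst|apply: cvgM; [exact: cvg_cst|exact: cvg_snd]].
Qed.

Lemma open_odisc (z0 : R * R) (r : R) : open (odisc z0 r).
Proof.
rewrite /odisc (_ : [set _ | _] = (fun w => sqn (line (- z0.1, - z0.2) 1 w)) @^-1` `]-oo, r ^+ 2[%classic); last first.
  by apply/seteqP; split => w /=; rewrite in_itv/= /line/= !mul1r ![- _ + _]addrC.
apply: open_comp; last exact: interval_open.
by move=> w _; apply: line_continuous; exact: sqn_continuous.
Qed.

Lemma sqn_box (b : R) (w : R * R) : 0 <= b -> ~ box b w -> b ^+ 2 <= sqn w.
Proof.
move=> b0; apply: contra_notP => /negP; rewrite -ltNge => h.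
have l x : x ^+ 2 < b ^+ 2 -> `[-b, b]%classic x.
  by rewrite /= in_itv/= -ler_norml -[x ^+ 2]real_normK ?num_real// ltr_pXn2r ?nnegrE// => /ltW.
split; apply: l; apply: le_lt_trans h.
  by rewrite lerDl sqr_ge0.
by rewrite lerDr sqr_ge0.
Qed.

Lemma cutoff_continuous (phi : R -> R) (g : R * R -> R) (rho r : R) :
  0 < rho -> rho < r ->
  continuous phi -> (forall t, rho ^+ 2 <= t -> phi t = 0) ->
  (forall w, sqn w < r ^+ 2 -> {for w, continuous g}) ->
  continuous (fun w => phi (sqn w) * g w).
Proof.
move=> rho0 rr cphi phi0 cg w.
have [wr|wr] := ltP (sqn w) (r ^+ 2).
  apply: cvgM; last exact: cg.
  by apply: (@continuous_comp _ _ _ (@sqn R) phi); [exact: sqn_continuous|exact: cphi].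
have wrho : rho ^+ 2 < sqn w by apply: lt_le_trans wr; rewrite ltr_pXn2r ?nnegrE ?ltW// (lt_trans rho0).
apply/cts_boxP => e e0.
have : nbhs w ((@sqn R) @^-1` `]rho ^+ 2, +oo[%classic).
  apply: sqn_continuous; apply: open_nbhs_nbhs; split; first exact: interval_open.
  by rewrite /= in_itv/= wrho.
move=> /near_box[d d0 hd]; exists d => // z z1 z2.
rewrite !phi0 ?mul0r ?subrr ?normr0//; first exact: ltW.
by have := hd z z1 z2; rewrite /= in_itv/= andbT => /ltW.
Qed.

Lemma bounded_on_disc (g : R * R -> R) (rho r : R) :
  0 < rho -> rho < r ->
  (forall w, sqn w < r ^+ 2 -> {for w, continuous g}) ->
  exists M, forall w, sqn w <= rho ^+ 2 -> `|g w| <= M.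
Proof.
move=> rho0 rr cg; pose r1 := (rho + r) / 2.
have r10 : 0 < r1 by rewrite /r1; lra.
have r1r : r1 < r by rewrite /r1; lra.
have rr1 : rho ^+ 2 < r1 ^+ 2 by rewrite ltr_pXn2r ?nnegrE ?ltW// /r1; lra.
pose phi (t : R) : R := Num.max 0 (r1 ^+ 2 - t).
have cphi : continuous phi.
  by move=> t; apply: (@continuous_max _ _ (cst 0) (fun t => r1 ^+ 2 - t)); [exact: cvg_cst|apply: cvgB; [exact: cvg_cst|exact: cvg_id]].
have phi0 t : r1 ^+ 2 <= t -> phi t = 0 by move=> ht; rewrite /phi; apply/max_idPl; rewrite subr_le0.
have cc := cutoff_continuous r10 r1r cphi phi0 cg.
have [|M hM] := continuous_bounded_box (b := r1) cc.
  by move=> w /sqn_box; rewrite (ltW r10) => /(_ isT) /phi0 ->; rewrite mul0r.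
exists (M / (r1 ^+ 2 - rho ^+ 2)) => w wrho.
rewrite ler_pdivlMr ?subr_gt0// mulrC; apply: le_trans (hM w).
rewrite normrM ler_wpM2r//; rewrite ger0_norm ?le_max ?lexx//.
by rewrite lerD2l lerN2 wrho orbT.
Qed.

(** The average [A t] of [s] over the disc dilated by [t] is nondecreasing in [t]. Its derivative
    is the integral of [omega (sqn z) (z . grad s)]; as [omega (sqn z) z] is the gradient of
    [W (sqn z)], an integration by parts turns it into [- t] times the integral of
    [W (sqn z)] times the Laplacian of [s], and [W <= 0]. Comparing [A 0] and [A 1] gives the
    sub-mean value inequality. *)
Section submean.
Variables (z0 : R * R) (rho r : R) (W omega : R -> R) (s sx sy sxx sxy syx syy : R * R -> R).
Hypotheses (rho0 : 0 < rho) (rhor : rho < r).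
Hypothesis dW : forall t : R, is_derive t 1 W (omega t / 2).
Hypothesis com : continuous omega.
Hypothesis om0 : forall t, rho ^+ 2 <= t -> omega t = 0.
Hypothesis W0 : forall t, rho ^+ 2 <= t -> W t = 0.
Hypothesis om_ge0 : forall t, 0 <= omega t.
Local Notation D := (odisc z0 r).
Hypothesis hs : C1 D s sx sy.
Hypothesis hsx : C1 D sx sxx sxy.
Hypothesis hsy : C1 D sy syx syy.
Hypothesis subh : forall w, D w -> 0 <= sxx w + syy w.

Let oD : open D. Proof. exact: open_odisc. Qed.

Let lineD t z : (t * r) ^+ 2 * sqn z < r ^+ 4 -> D (line z0 t z).
Proof.
move=> h; rewrite /odisc/= /sqn/= addrAC subrr add0r addrAC subrr add0r.
rewrite !exprMn -mulrDr -/(sqn z).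
have r20 : 0 < r ^+ 2 by rewrite exprn_gt0// (lt_trans rho0).
rewrite -(ltr_pM2l r20) mulrA -exprMn [r * t]mulrC.
by apply: lt_le_trans h _; rewrite -exprD.
Qed.

Let cW : continuous W. Proof. by move=> t; apply: is_derive_continuous. Qed.

Let W_le0 t : W t <= 0.
Proof.
have [/W0 ->//|tr] := leP (rho ^+ 2) t.
have [|x xr e] := @MVT_segment R W (fun t => omega t / 2) t (rho ^+ 2) (ltW tr) (fun x _ => dW x).
  exact: continuous_subspaceT.
have : 0 <= W (rho ^+ 2) - W t.
  by rewrite e mulr_ge0// ?divr_ge0// subr_ge0 ltW.
by rewrite W0// sub0r oppr_ge0.
Qed.

(* For dilation parameters |t| < t1 the rescaled disc of radius r1 stays in D. *)
Variables (t1 r1 : R).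
Hypotheses (t1_gt1 : 1 < t1) (rho_r1 : rho < r1) (t1r1 : t1 * r1 = r).
Let t1_gt0 : 0 < t1. Proof. exact: lt_trans t1_gt1. Qed.
Let t1n0 : t1 != 0. Proof. by rewrite gt_eqF. Qed.
Let good t z : `|t| < t1 -> sqn z < r1 ^+ 2 -> D (line z0 t z).
Proof.
move=> tt1 zr; apply: lineD.
have r0 : 0 < r by apply: lt_trans rho0 _.
rewrite (_ : r ^+ 4 = (t1 * r) ^+ 2 * r1 ^+ 2); last first.
  by rewrite -exprMn mulrAC t1r1 -expr2 -exprM.
apply: le_lt_trans (_ : (t1 * r) ^+ 2 * sqn z < _).
  rewrite ler_wpM2r ?sqn_ge0// !exprMn ler_wpM2r ?sqr_ge0//.
  rewrite -[t ^+ 2]real_normK ?num_real// ler_pXn2r ?nnegrE ?normr_ge0//; [exact: ltW|exact: ltW].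
by rewrite ltr_pM2l// exprn_gt0// mulr_gt0//; lra.
Qed.

Let F t z := omega (sqn z) * s (line z0 t z).
Let dF t z := omega (sqn z) * (z.1 * sx (line z0 t z) + z.2 * sy (line z0 t z)).

Let clineg (g : R * R -> R) t z : (forall w, D w -> {for w, continuous g}) ->
  `|t| < t1 -> sqn z < r1 ^+ 2 -> {for z, continuous (fun z => g (line z0 t z))}.
Proof. by move=> cg tt1 zr; apply: line_continuous; apply: cg; exact: good. Qed.

Let cs w : D w -> {for w, continuous s}. Proof. exact: (C1_continuous oD hs). Qed.
Let csx w : D w -> {for w, continuous sx}. Proof. exact: (C1_continuous oD hsx). Qed.
Let csy w : D w -> {for w, continuous sy}. Proof. exact: (C1_continuous oD hsy). Qed.

Let cF t : `|t| < t1 -> continuous (F t).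
Proof.
by move=> tt1; apply: (cutoff_continuous rho0 rho_r1 com om0) => w wr; exact: clineg.
Qed.

Let supp (phi : R -> R) w : (forall t, rho ^+ 2 <= t -> phi t = 0) ->
  ~ box rho w -> phi (sqn w) = 0.
Proof. by move=> phi0 /sqn_box; rewrite (ltW rho0) => /(_ isT) /phi0. Qed.

Let Fdiff (t : R) (z : R * R) : `|t| < t1 -> is_derive t 1 (fun t : R => F t z) (dF t z).
Proof.
move=> tt1; have [zr|zr] := ltP (sqn z) (rho ^+ 2); last first.
  rewrite /F /dF om0// mul0r (_ : (fun _ => _) = cst 0); first exact: is_derive_cst.
  by apply/funext => ?; rewrite mul0r.
have zr1 : sqn z < r1 ^+ 2.
  by apply: lt_trans zr _; rewrite ltr_pXn2r ?nnegrE ?ltW// (lt_trans rho0).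
rewrite /F /dF.
have dl (c d : R) : is_derive t 1 (fun t => c + t * d) d.
  by apply: is_derive_eq; rewrite /GRing.scale/=; ring.
have h := @C1_chain _ _ _ _ _ (fun t : R => z0.1 + t * z.1) (fun t : R => z0.2 + t * z.2)
  t _ _ oD hs (good tt1 zr1) (dl z0.1 z.1) (dl z0.2 z.2).
 apply: is_derive_eq; rewrite -/(line z0 t z) /GRing.scale/=; ring.
Qed.

Let cdF t : `|t| < t1 -> continuous (dF t).
Proof.
move=> tt1; apply: (cutoff_continuous rho0 rho_r1 com om0) => w wr.
by apply: cvgD; apply: cvgM; [exact: cvg_fst|exact: clineg|exact: cvg_snd|exact: clineg].
Qed.

Let bound1 (g : R * R -> R) : (forall w, D w -> {for w, continuous g}) ->
  exists2 M, 0 <= M & forall t z, `|t| < t1 -> sqn z <= rho ^+ 2 -> `|g (line z0 t z)| <= M.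
Proof.
move=> cg; have r0 : 0 < r by apply: lt_trans rho0 _.
have [|||M hM] := @bounded_on_disc (fun w => g (line z0 1 w)) (t1 * rho) r.
- exact: mulr_gt0.
- by rewrite -t1r1 ltr_pM2l.
- move=> w wr; apply: line_continuous; apply: cg; apply: lineD.
  rewrite mul1r (_ : r ^+ 4 = r ^+ 2 * r ^+ 2); last by rewrite -exprD.
  by rewrite ltr_pM2l// exprn_gt0.
exists `|M| => // t z tt1 zr.
have := hM (t * z.1, t * z.2); rewrite /line/= !mul1r => h.
apply: le_trans (ler_norm _); apply: h.
rewrite /sqn/= !exprMn -mulrDr -/(sqn z) ler_pM ?sqr_ge0 ?sqn_ge0//.
by rewrite -[t ^+ 2]real_normK ?num_real// ler_pXn2r ?nnegrE ?normr_ge0//; exact: ltW.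
Qed.

Let A t := \int[mu2]_z F t z.

Let intF t : `|t| < t1 -> mu2.-integrable setT (EFin \o F t).
Proof.
move=> tt1; apply: (@integrable_continuous_box _ (F t) rho (cF tt1)).
by move=> w bw; rewrite /F (@supp omega w om0 bw) mul0r.
Qed.

Let dA (t : R) : `|t| < t1 -> is_derive t 1 A (\int[mu2]_z dF t z).
Proof.
move=> tt1.
have [M M0 hM] := bound1 csx; have [N N0 hN] := bound1 csy.
pose G z := omega (sqn z) * (rho * M + rho * N).
have It : `]-t1, t1[%classic t by rewrite /= in_itv/= -ltr_norml.
have hI x : `]-t1, t1[%classic x -> `|x| < t1 by rewrite /= in_itv/= -ltr_norml.
have h1 (x : R) : `]-t1, t1[%classic x -> mu2.-integrable setT (EFin \o F x).
  by move=> /hI; exact: intF.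
have h2 (x : R) (y : R * R) : `]-t1, t1[%classic x -> setT y -> derivable (F ^~ y) x 1.
  by move=> /hI xt _; have [] := Fdiff y xt.
have G0 (y : R * R) : 0 <= G y by rewrite mulr_ge0// addr_ge0// mulr_ge0// ltW.
have iG : mu2.-integrable setT (EFin \o G).
  apply: (@integrable_continuous_box _ G rho); last by move=> w bw; rewrite /G (@supp omega w om0 bw) mul0r.
  by apply: (cutoff_continuous rho0 rho_r1 com om0) => w _; exact: cvg_cst.
have dFE (x : R) (y : R * R) : `|x| < t1 -> partial1of2 F x y = dF x y.
  by move=> xt; rewrite partial1of2E; have [_] := Fdiff y xt.
have GM (x : R) (y : R * R) : `]-t1, t1[%classic x -> setT y -> `|partial1of2 F x y| <= G y.
  move=> /hI xt _; rewrite dFE// /dF /G normrM ger0_norm//.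
  have [/om0 ->|yr] := leP (rho ^+ 2) (sqn y); first by rewrite !mul0r.
  have sm (a : R) : a ^+ 2 <= sqn y -> `|a| <= rho.
    move=> h; rewrite -(@ler_pXn2r _ 2) ?nnegrE// ?(ltW rho0)// real_normK ?num_real//.
    exact: le_trans h (ltW yr).
  rewrite ler_wpM2l//; apply: le_trans (ler_normD _ _) _; rewrite !normrM.
  apply: lerD; apply: ler_pM => //.
  - by apply: sm; rewrite lerDl sqr_ge0.
  - by apply: hM => //; exact: ltW.
  - by apply: sm; rewrite lerDr sqr_ge0.
  - by apply: hN => //; exact: ltW.
apply: DeriveDef.
  exact: (@derivable_under_integral _ _ plane mu2 F setT measurableT t (-t1) t1 It h1 h2 G G0 iG GM).
rewrite -derive1E (@differentiation_under_integral _ _ plane mu2 F setT measurableT t (-t1) t1 It h1 h2 G G0 iG GM).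
by apply: eq_Rintegral => z _; rewrite dFE.
Qed.

Let sq_derive (c x : R) : is_derive x 1 (fun x : R => W (x ^+ 2 + c)) (x * omega (x ^+ 2 + c)).
Proof.
have h : is_derive x 1 (fun x : R => x ^+ 2 + c) (2 * x).
  by apply: is_derive_eq; rewrite /GRing.scale/=; ring.
have := @is_derive1_comp _ W (fun x : R => x ^+ 2 + c) x _ _ (dW _) h.
by apply: is_derive_rew; field.
Qed.

(* Outside the support of [W] the function [s] may be undefined, so differentiability of the
   products there comes from local vanishing of [W]. *)
Let far (b : R * R) : r1 ^+ 2 <= sqn b -> exists2 d, 0 < d &
  forall w, `|w.1 - b.1| < d -> `|w.2 - b.2| < d -> W (sqn w) = 0.
Proof.
move=> hb; have rb : rho ^+ 2 < sqn b.
  by apply: lt_le_trans hb; rewrite ltr_pXn2r ?nnegrE ?ltW// (lt_trans rho0).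
have : nbhs b ((@sqn R) @^-1` `]rho ^+ 2, +oo[%classic).
  apply: sqn_continuous; apply: open_nbhs_nbhs; split; first exact: interval_open.
  by rewrite /= in_itv/= rb.
move=> /near_box[d d0 hd]; exists d => // w h1 h2; apply: W0.
by have := hd w h1 h2; rewrite /= in_itv/= andbT => /ltW.
Qed.

Let is_derive0 (g : R -> R) (x d : R) : 0 < d ->
  (forall y, `|y - x| < d -> g y = 0) -> is_derive x 1 g 0.
Proof.
move=> d0 g0; apply: (@near_eq_is_derive R R R (cst 0) g x 1 0 _ (is_derive_cst _ _ _)).
apply/nbhs_ballP; exists d => //= y; rewrite /ball/= distrC => yx.
by rewrite g0.
Qed.

Let intx t : `|t| < t1 -> \int[mu2]_z (omega (sqn z) * (z.1 * sx (line z0 t z))) =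
  - t * \int[mu2]_z (W (sqn z) * sxx (line z0 t z)).
Proof.
move=> tt1.
have s1 (phi : R -> R) (phi0 : forall t, rho ^+ 2 <= t -> phi t = 0) (g : R * R -> R) w :
    ~ box rho w -> phi (sqn w) * g w = 0 by move=> bw; rewrite (supp phi0 bw) mul0r.
have csxx w : D w -> {for w, continuous sxx} by move=> /hsx[].
have c1 : continuous (fun z => omega (sqn z) * (z.1 * sx (line z0 t z))).
  apply: (cutoff_continuous rho0 rho_r1 com om0) => w wr.
  by apply: cvgM; [exact: cvg_fst|exact: clineg].
have c2 : continuous (fun z => W (sqn z) * sxx (line z0 t z)).
  by apply: (cutoff_continuous rho0 rho_r1 cW W0) => w wr; exact: clineg.
have i1 := integrable_continuous_box c1 (s1 _ om0 _).
have i2 := integrable_continuous_box c2 (s1 _ W0 _).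
have c3 : continuous (fun z => t * (W (sqn z) * sxx (line z0 t z))).
  by move=> z; apply: cvgM; [exact: cvg_cst|exact: c2].
have i3 : mu2.-integrable setT (EFin \o (fun z => t * (W (sqn z) * sxx (line z0 t z)))).
  by apply: (@integrable_continuous_box _ _ rho) => // w bw; rewrite (supp W0 bw) mul0r mulr0.
rewrite mulNr -RintegralZl//; apply/eqP; rewrite -addr_eq0 -RintegralD//; apply/eqP.
apply: (@integral_partial_x_eq0 _ (fun z => W (sqn z) * sx (line z0 t z)) _ rho) => //.
- move=> w; have [wr|wr] := ltP (sqn w) (r1 ^+ 2); last first.
    have rr : rho ^+ 2 <= sqn w by apply: le_trans wr; rewrite ler_pXn2r ?nnegrE ?ltW// (lt_trans rho0).
    rewrite om0// W0// !mul0r mulr0 addr0; have [d d0 hd] := far wr.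
    by apply: (is_derive0 d0) => y hy; rewrite hd ?mul0r// subrr normr0.
  have dl (c d : R) : is_derive w.1 1 (fun x => c + d * x) d.
    by apply: is_derive_eq; rewrite /GRing.scale/=; ring.
  have dc (c : R) : is_derive w.1 1 (fun x : R => c) 0 by apply: is_derive_cst.
  have h := @C1_chain _ _ _ _ _ (fun x : R => z0.1 + t * x) (fun x : R => z0.2 + t * w.2)
    w.1 _ _ oD hsx (good tt1 wr) (dl z0.1 t) (dc (z0.2 + t * w.2)).
  have h' := sq_derive (w.2 ^+ 2) w.1.
  have := @is_deriveM _ _ _ _ _ _ _ _ h' h.
  by apply: is_derive_rew; rewrite -/(sqn w) -/(line z0 t w) /GRing.scale/=; ring.
- by move=> z; apply: cvgD; [exact: c1|exact: c3].
- move=> w wr; rewrite W0 ?mul0r//; apply: le_trans (_ : w.1 ^+ 2 <= _).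
    by rewrite -[w.1 ^+ 2]real_normK ?num_real// ler_pXn2r ?nnegrE// ltW.
  by rewrite lerDl sqr_ge0.
- by move=> w bw; rewrite (supp om0 bw) (supp W0 bw) !mul0r mulr0 addr0.
Qed.

Let inty t : `|t| < t1 -> \int[mu2]_z (omega (sqn z) * (z.2 * sy (line z0 t z))) =
  - t * \int[mu2]_z (W (sqn z) * syy (line z0 t z)).
Proof.
move=> tt1.
have s1 (phi : R -> R) (phi0 : forall t, rho ^+ 2 <= t -> phi t = 0) (g : R * R -> R) w :
    ~ box rho w -> phi (sqn w) * g w = 0 by move=> bw; rewrite (supp phi0 bw) mul0r.
have csyy w : D w -> {for w, continuous syy} by move=> /hsy[].
have c1 : continuous (fun z => omega (sqn z) * (z.2 * sy (line z0 t z))).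
  apply: (cutoff_continuous rho0 rho_r1 com om0) => w wr.
  by apply: cvgM; [exact: cvg_snd|exact: clineg].
have c2 : continuous (fun z => W (sqn z) * syy (line z0 t z)).
  by apply: (cutoff_continuous rho0 rho_r1 cW W0) => w wr; exact: clineg.
have i1 := integrable_continuous_box c1 (s1 _ om0 _).
have i2 := integrable_continuous_box c2 (s1 _ W0 _).
have c3 : continuous (fun z => t * (W (sqn z) * syy (line z0 t z))).
  by move=> z; apply: cvgM; [exact: cvg_cst|exact: c2].
have i3 : mu2.-integrable setT (EFin \o (fun z => t * (W (sqn z) * syy (line z0 t z)))).
  by apply: (@integrable_continuous_box _ _ rho) => // w bw; rewrite (supp W0 bw) mul0r mulr0.
rewrite mulNr -RintegralZl//; apply/eqP; rewrite -addr_eq0 -RintegralD//; apply/eqP.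
apply: (@integral_partial_y_eq0 _ (fun z => W (sqn z) * sy (line z0 t z)) _ rho) => //.
- move=> w; have [wr|wr] := ltP (sqn w) (r1 ^+ 2); last first.
    have rr : rho ^+ 2 <= sqn w by apply: le_trans wr; rewrite ler_pXn2r ?nnegrE ?ltW// (lt_trans rho0).
    rewrite om0// W0// !mul0r mulr0 addr0; have [d d0 hd] := far wr.
    by apply: (is_derive0 d0) => y hy; rewrite hd ?mul0r// subrr normr0.
  have dl (c d : R) : is_derive w.2 1 (fun x => c + d * x) d.
    by apply: is_derive_eq; rewrite /GRing.scale/=; ring.
  have dc (c : R) : is_derive w.2 1 (fun x : R => c) 0 by apply: is_derive_cst.
  have h := @C1_chain _ _ _ _ _ (fun y : R => z0.1 + t * w.1) (fun y : R => z0.2 + t * y)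
    w.2 _ _ oD hsy (good tt1 wr) (dc (z0.1 + t * w.1)) (dl z0.2 t).
  have h' := sq_derive (w.1 ^+ 2) w.2.
  rewrite (_ : (fun y => _) = (fun x => W (x ^+ 2 + w.1 ^+ 2)) * (fun y => sy (z0.1 + t * w.1, z0.2 + t * y))); last first.
    by apply/funext => y; rewrite /sqn/= addrC.
  have := @is_deriveM _ _ _ _ _ _ _ _ h' h.
  by apply: is_derive_rew; rewrite [w.2 ^+ 2 + _]addrC -/(sqn w) -/(line z0 t w) /GRing.scale/=; ring.
- by move=> z; apply: cvgD; [exact: c1|exact: c3].
- move=> w wr; rewrite W0 ?mul0r//; apply: le_trans (_ : w.2 ^+ 2 <= _).
    by rewrite -[w.2 ^+ 2]real_normK ?num_real// ler_pXn2r ?nnegrE// ltW.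
  by rewrite lerDr sqr_ge0.
- by move=> w bw; rewrite (supp om0 bw) (supp W0 bw) !mul0r mulr0 addr0.
Qed.

Let int_lap_le0 t : `|t| < t1 -> \int[mu2]_z (W (sqn z) * sxx (line z0 t z)) +
  \int[mu2]_z (W (sqn z) * syy (line z0 t z)) <= 0.
Proof.
move=> tt1.
have cont (g : R * R -> R) : (forall w, D w -> {for w, continuous g}) ->
    mu2.-integrable setT (EFin \o (fun z => W (sqn z) * g (line z0 t z))).
  move=> cg; apply: (@integrable_continuous_box _ _ rho).
    by apply: (cutoff_continuous rho0 rho_r1 cW W0) => w wr; exact: clineg.
  by move=> w bw; rewrite (supp W0 bw) mul0r.
have c1 w : D w -> {for w, continuous sxx} by move=> /hsx[].
have c2 w : D w -> {for w, continuous syy} by move=> /hsy[].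
have c3 w : D w -> {for w, continuous (fun w => sxx w + syy w)}.
  by move=> Dw; apply: cvgD; [exact: c1|exact: c2].
rewrite -RintegralD//; [|exact: cont..].
rewrite -oppr_ge0 -mulN1r -RintegralZl//; last first.
  rewrite (_ : (_ \o _) = EFin \o (fun z => W (sqn z) * (sxx (line z0 t z) + syy (line z0 t z)))).
    exact: (cont _ c3).
  by apply/funext => z /=; rewrite mulrDr.
apply: Rintegral_ge0 => z _; rewrite -mulrDr mulN1r oppr_ge0.
have [zr|zr] := leP (rho ^+ 2) (sqn z); first by rewrite W0// mul0r.
rewrite mulr_le0_ge0//; apply: subh; apply: good => //.
by apply: lt_trans zr _; rewrite ltr_pXn2r ?nnegrE ?ltW// (lt_trans rho0).
Qed.

Lemma submean_aux :
  s z0 * \int[mu2]_z omega (sqn z) <= \int[mu2]_z (omega (sqn z) * s (line z0 1 z)).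
Proof.
have int_om (g : R * R -> R) : continuous (fun z => omega (sqn z) * g z) ->
    mu2.-integrable setT (EFin \o (fun z => omega (sqn z) * g z)).
  move=> cg; apply: (@integrable_continuous_box _ _ rho) => // w bw.
  by rewrite (supp om0 bw) mul0r.
have A0 : A 0 = s z0 * \int[mu2]_z omega (sqn z).
  rewrite -RintegralZl//; last first.
    rewrite (_ : (_ \o _) = EFin \o (fun w => omega (sqn w) * 1)).
      by apply/int_om/(cutoff_continuous rho0 rho_r1 com om0) => w _; exact: cvg_cst.
    by apply/funext => w /=; rewrite mulr1.
  apply: eq_Rintegral => z _; rewrite /F /line !mul0r !addr0 mulrC.
  by rewrite -surjective_pairing.
rewrite -A0; change (A 0 <= A 1).
have in01 (x : R) : x \in `]0, 1[%R -> `|x| < t1.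
  rewrite in_itv/= => /andP[x0 x1]; rewrite gtr0_norm//; exact: lt_trans x1 t1_gt1.
apply: (@ger0_derive1_ndecr R A 0 1) => //.
- by move=> x /in01 /dA[].
- move=> x x01; have xt := in01 _ x01; have [_ h] := dA xt; rewrite derive1E h.
  rewrite (_ : \int[mu2]_z dF x z = \int[mu2]_z (omega (sqn z) * (z.1 * sx (line z0 x z))
      + omega (sqn z) * (z.2 * sy (line z0 x z)))); last first.
    by apply: eq_Rintegral => z _; rewrite -mulrDr.
  rewrite RintegralD//; first last.
  - by apply/int_om/(cutoff_continuous rho0 rho_r1 com om0) => w wr; apply: cvgM;
      [exact: cvg_snd|exact: clineg].
  - by apply/int_om/(cutoff_continuous rho0 rho_r1 com om0) => w wr; apply: cvgM;
      [exact: cvg_fst|exact: clineg].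
  rewrite intx// inty// -mulrDr mulNr oppr_ge0 mulr_ge0_le0//; last exact: int_lap_le0.
  by move: x01; rewrite in_itv/= => /andP[/ltW].
- apply: derivable_within_continuous => x; rewrite in_itv/= => /andP[x0 x1].
  by have [] // := @dA x; rewrite ger0_norm//; apply: le_lt_trans x1 _.
Qed.

End submean.

(** Any [t1] between 1 and [r / rho] leaves room for differentiating at [t = 1]; the midpoint
    is chosen. *)
Lemma submean_primitive (z0 : R * R) (rho r : R) (W omega : R -> R) (s sx sy sxx sxy syx syy : R * R -> R) :
  0 < rho -> rho < r ->
  (forall t : R, is_derive t 1 W (omega t / 2)) -> continuous omega ->
  (forall t, rho ^+ 2 <= t -> omega t = 0) -> (forall t, rho ^+ 2 <= t -> W t = 0) ->
  (forall t, 0 <= omega t) ->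
  C1 (odisc z0 r) s sx sy -> C1 (odisc z0 r) sx sxx sxy -> C1 (odisc z0 r) sy syx syy ->
  (forall w, odisc z0 r w -> 0 <= sxx w + syy w) ->
  s z0 * \int[mu2]_z omega (sqn z) <= \int[mu2]_z (omega (sqn z) * s (line z0 1 z)).
Proof.
move=> rho0 rhor dW com om0 W0 om_ge0 hs hsx hsy subh.
have q1 : 1 < r / rho by rewrite ltr_pdivlMr// mul1r.
have t0 : 0 < (1 + r / rho) / 2 by lra.
apply: (@submean_aux z0 rho r W omega s sx sy sxx sxy syx syy rho0 rhor dW com om0
  W0 om_ge0 hs hsx hsy subh ((1 + r / rho) / 2) (r / ((1 + r / rho) / 2))).
- by lra.
- rewrite ltr_pdivlMr// (_ : rho * _ = (rho + r) / 2); first lra.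
  by field; rewrite gt_eqF.
- by rewrite mulrC divfK// gt_eqF.
Qed.

Lemma exists_primitive (omega : R -> R) (T : R) : 0 <= T -> continuous omega ->
  (forall t, T <= t -> omega t = 0) -> (forall t, t <= -1 -> omega t = 0) ->
  exists W : R -> R, (forall t : R, is_derive t 1 W (omega t / 2)) /\
    (forall t, T <= t -> W t = 0).
Proof.
move=> T0 com om0 om1.
have int u : mu.-integrable [set` Interval (BInfty R true) (BRight u)] (EFin \o omega).
  apply: (@integrableS _ _ _ _ setT) => //.
  rewrite (_ : EFin \o omega = (EFin \o omega) \_ `[-1, T]); last first.
    apply/funext => x; rewrite patchE /= mem_setE in_itv/=.
    case: ifPn => //; rewrite negb_and -!ltNge => /orP[] /ltW h; first by rewrite om1.
    by rewrite om0.
  apply/integrable_restrict; rewrite ?setTI//.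
  apply: continuous_compact_integrable; first exact: segment_compact.
  exact: continuous_subspaceT.
pose F x := \int[mu]_(t in [set` Interval (BInfty R true) (BRight x)]) omega t.
have dF (x : R) : is_derive x 1 F (omega x).
  have x1 : x < x + 1 by rewrite ltrDl.
  have [d e] := @continuous_FTC1 R omega (BInfty R true) x (x + 1) x1 (int _) (ltNyr x) (com x).
  by apply: (DeriveDef d); rewrite -derive1E; exact: e.
exists (fun t => (F t - F T) / 2); split.
  move=> t; have h : is_derive t 1 (fun t : R => (F t - F T) / 2) (omega t / 2).
    apply: is_derive_eq; rewrite /GRing.scale/=; ring.
  exact: h.
move=> t Tt.
have [|c] := @MVT_segment R F omega T t Tt (fun x _ => dF x).
  by apply: continuous_subspaceT => x; exact: is_derive_continuous.
by rewrite in_itv/= => /andP[Tc _] ->; rewrite om0// !mul0r.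
Qed.

(** Only the values of a weight at nonnegative arguments matter, and [kap] cuts the weight off on
    the negative axis so that it has a primitive normalized at [T]. *)
Lemma weight_primitive (omega : R -> R) (T : R) : 0 <= T -> continuous omega ->
  (forall t, T <= t -> omega t = 0) -> (forall t, 0 <= omega t) ->
  exists W om : R -> R, [/\ (forall t : R, is_derive t 1 W (om t / 2)) /\ continuous om,
    forall t, T <= t -> W t = 0, forall t, T <= t -> om t = 0,
    forall t, 0 <= om t & forall t, 0 <= t -> om t = omega t].
Proof.
move=> T0 com om0 omge.
pose kap (t : R) : R := Num.max 0 (1 + (t - `|t|) / 2).
have k0 t : 0 <= kap t by rewrite le_max lexx.
have ck : continuous kap.
  move=> t; have := @continuous_max R R (cst 0) (fun t : R => 1 + (t - `|t|) / 2) t.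
  apply; first exact: cvg_cst.
  apply: cvgD; first exact: cvg_cst.
  apply: cvgM; last exact: cvg_cst.
  by apply: cvgB; [exact: cvg_id|apply: cvg_norm; exact: cvg_id].
have co : continuous (fun t => omega t * kap t) by move=> t; apply: cvgM; [exact: com|exact: ck].
have o0 t : T <= t -> omega t * kap t = 0 by move=> /om0 ->; rewrite mul0r.
have [|W [dW W0]] := exists_primitive T0 co o0.
  move=> t t1; rewrite /kap (_ : Num.max _ _ = 0) ?mulr0//; apply/max_idPl.
  have t0 : t <= 0 by apply: le_trans t1 _; rewrite lerN10.
  by rewrite ler0_norm// opprK; lra.
exists W, (fun t => omega t * kap t); split => //.
  by move=> t; rewrite mulr_ge0.
move=> t t0; rewrite /kap ger0_norm// subrr mul0r addr0.
by rewrite (_ : Num.max _ _ = 1) ?mulr1//; apply/max_idPr.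
Qed.

Lemma eq_weight (om omega : R -> R) (g : R * R -> R) : (forall t, 0 <= t -> om t = omega t) ->
  \int[mu2]_z (om (sqn z) * g z) = \int[mu2]_z (omega (sqn z) * g z).
Proof. by move=> h; apply: eq_Rintegral => z _; rewrite h// sqn_ge0. Qed.

Definition weight (rho : R) (omega : R -> R) := [/\ continuous omega,
  forall t, rho ^+ 2 <= t -> omega t = 0 & forall t, 0 <= omega t].

Lemma weight_integrable rho omega (g : R * R -> R) (r : R) : 0 < rho -> rho < r -> weight rho omega ->
  (forall w, sqn w < r ^+ 2 -> {for w, continuous g}) ->
  mu2.-integrable setT (EFin \o (fun w => omega (sqn w) * g w)).
Proof.
move=> rho0 rhor [com om0 omge] cg; apply: (@integrable_continuous_box _ _ rho).
  exact: (cutoff_continuous rho0 rhor com om0 cg).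
by move=> w /sqn_box; rewrite (ltW rho0) => /(_ isT) /om0 ->; rewrite mul0r.
Qed.

(** [weight_primitive] supplies the primitive that [submean_primitive] asks for; it changes the
    weight at negative arguments only. *)
Lemma submean (z0 : R * R) (rho r : R) (omega : R -> R) (s sx sy sxx sxy syx syy : R * R -> R) :
  0 < rho -> rho < r -> weight rho omega ->
  C1 (odisc z0 r) s sx sy -> C1 (odisc z0 r) sx sxx sxy -> C1 (odisc z0 r) sy syx syy ->
  (forall w, odisc z0 r w -> 0 <= sxx w + syy w) ->
  s z0 * \int[mu2]_z omega (sqn z) <= \int[mu2]_z (omega (sqn z) * s (line z0 1 z)).
Proof.
move=> rho0 rhor [com om0 omge] hs hsx hsy lap.
have [W [om [[dW cm] W0 om0' om_ge0 e]]] := weight_primitive (sqr_ge0 rho) com om0 omge.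
rewrite -(eq_weight _ e); have -> : \int[mu2]_z omega (sqn z) = \int[mu2]_z om (sqn z).
  by apply: eq_Rintegral => z _; rewrite e// sqn_ge0.
exact: (submean_primitive rho0 rhor dW cm om0' W0 om_ge0 hs hsx hsy lap).
Qed.

End mean_value.

(** * The Bellman function *)

Section C1_closure.
Context {R : realType}.
Implicit Types (D : set (R * R)) (f g : R * R -> R).

Lemma C1_cst D (c : R) : C1 D (cst c) (cst 0) (cst 0).
Proof. by move=> w _; split; [exact: is_derive_cst|exact: is_derive_cst|exact: cvg_cst|exact: cvg_cst]. Qed.

Lemma C1_fst D : C1 D fst (cst 1) (cst 0).
Proof. by move=> w _; split; [exact: is_derive_id|exact: is_derive_cst|exact: cvg_cst|exact: cvg_cst]. Qed.

Lemma C1_snd D : C1 D snd (cst 0) (cst 1).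
Proof. by move=> w _; split; [exact: is_derive_cst|exact: is_derive_id|exact: cvg_cst|exact: cvg_cst]. Qed.

Lemma C1_add D f fx fy g gx gy : C1 D f fx fy -> C1 D g gx gy ->
  C1 D (fun w => f w + g w) (fun w => fx w + gx w) (fun w => fy w + gy w).
Proof.
move=> hf hg w Dw; have [a1 a2 a3 a4] := hf w Dw; have [b1 b2 b3 b4] := hg w Dw.
split; [exact: is_deriveD|exact: is_deriveD|exact: cvgD|exact: cvgD].
Qed.

Lemma C1_mul D f fx fy g gx gy : open D -> C1 D f fx fy -> C1 D g gx gy ->
  C1 D (fun w => f w * g w) (fun w => fx w * g w + f w * gx w) (fun w => fy w * g w + f w * gy w).
Proof.
move=> oD hf hg w Dw; have [a1 a2 a3 a4] := hf w Dw; have [b1 b2 b3 b4] := hg w Dw.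
have cf := C1_continuous oD hf Dw; have cg := C1_continuous oD hg Dw.
split.
- have := is_deriveM a1 b1; apply: is_derive_rew.
  by rewrite /GRing.scale/= -surjective_pairing addrC; congr (_ + _); rewrite mulrC.
- have := is_deriveM a2 b2; apply: is_derive_rew.
  by rewrite /GRing.scale/= -surjective_pairing addrC; congr (_ + _); rewrite mulrC.
- by apply: cvgD; exact: cvgM.
- by apply: cvgD; exact: cvgM.
Qed.

Lemma C1_eq D f fx fy f' fx' fy' : f =1 f' -> fx =1 fx' -> fy =1 fy' ->
  C1 D f fx fy -> C1 D f' fx' fy'.
Proof. by move=> /funext -> /funext -> /funext ->. Qed.

Lemma C1_comp D (F F1 F2 : R * R -> R) f fx fy g gx gy : open D ->
  C1 setT F F1 F2 -> C1 D f fx fy -> C1 D g gx gy ->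
  C1 D (fun w => F (f w, g w))
    (fun w => F1 (f w, g w) * fx w + F2 (f w, g w) * gx w)
    (fun w => F1 (f w, g w) * fy w + F2 (f w, g w) * gy w).
Proof.
move=> oD hF hf hg w Dw; have [a1 a2 a3 a4] := hf w Dw; have [b1 b2 b3 b4] := hg w Dw.
have cf := C1_continuous oD hf Dw; have cg := C1_continuous oD hg Dw.
have oT := @openT (R * R)%type.
have [_ _ c1 c2] := hF (f w, g w) I.
have we : (w.1, w.2) = w by case: (w).
split.
- by have := @C1_chain _ _ _ _ _ _ _ _ _ _ oT hF (I : setT (f (w.1, w.2), g (w.1, w.2))) a1 b1; rewrite we.
- by have := @C1_chain _ _ _ _ _ _ _ _ _ _ oT hF (I : setT (f (w.1, w.2), g (w.1, w.2))) a2 b2; rewrite we.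
- by apply: cvgD; apply: cvgM => //; exact: continuous_pair2.
- by apply: cvgD; apply: cvgM => //; exact: continuous_pair2.
Qed.

Lemma C1_comp1 D (phi dphi : R -> R) f fx fy : open D -> C1 D f fx fy ->
  (forall w, D w -> is_derive (f w) 1 phi (dphi (f w)) /\ {for f w, continuous dphi}) ->
  C1 D (fun w => phi (f w)) (fun w => dphi (f w) * fx w) (fun w => dphi (f w) * fy w).
Proof.
move=> oD hf hphi w Dw; have [a1 a2 a3 a4] := hf w Dw; have [b1 b2] := hphi w Dw.
have cf := C1_continuous oD hf Dw.
have we : (w.1, w.2) = w by case: (w).
split.
- apply: (@is_derive1_comp R phi (fun x => f (x, w.2))) => //=; by rewrite we.
- apply: (@is_derive1_comp R phi (fun y => f (w.1, y))) => //=; by rewrite we.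
- by apply: cvgM => //; apply: (@continuous_comp _ _ _ f dphi).
- by apply: cvgM => //; apply: (@continuous_comp _ _ _ f dphi).
Qed.

Lemma C1_powR D (s : R) f fx fy : open D -> C1 D f fx fy -> (forall w, D w -> 0 < f w) ->
  C1 D (fun w => f w `^ s) (fun w => s * f w `^ (s - 1) * fx w) (fun w => s * f w `^ (s - 1) * fy w).
Proof.
move=> oD hf f0; apply: (@C1_comp1 D (fun x => x `^ s) (fun x => s * x `^ (s - 1))) => // w Dw.
have fw0 := f0 w Dw; split; first exact: is_derive1_powR.
apply: cvgM; first exact: cvg_cst.
exact: (@is_derive_continuous R (fun x => x `^ (s - 1)) (f w) _ (is_derive1_powR _ fw0)).
Qed.
End C1_closure.

(** The function [bell = A a^q + B a b^(q-1) - b^q] of [w = (x, y)], with [a = x^2 + e] and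
    [b = x^2 + y^2 + e], where [p = 2 q]. For [q <= 1] the choice is [B = 0]; for [q >= 1] the term
    with [B] compensates the negative second derivatives of [- b^q] in the region where [a] is
    small against [b], and the term with [A] does so elsewhere. The parameter [e > 0] keeps all
    powers smooth. [2 x bE] and [2 y bG] are the first partial derivatives, and [4 x y bM] is the
    mixed second one. *)
Section bellman.
Context {R : realType}.
Variables (q A B e : R).
Hypothesis e0 : 0 < e.
Implicit Types w : R * R.

Definition ba w : R := w.1 ^+ 2 + e.
Definition bb w : R := w.1 ^+ 2 + w.2 ^+ 2 + e.

Lemma ba_gt0 w : 0 < ba w. Proof. by rewrite ltr_wpDl// sqr_ge0. Qed.
Lemma bb_gt0 w : 0 < bb w. Proof. by rewrite ltr_wpDl// addr_ge0// sqr_ge0. Qed.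

Let oT := @openT (R * R)%type.

Lemma C1_ba : C1 setT ba (fun w => 2 * w.1) (cst 0).
Proof.
apply: C1_eq (C1_add (C1_mul oT (@C1_fst R setT) (@C1_fst R setT)) (@C1_cst R setT e)) => w /=.
- by [].
- by ring.
- by ring.
Qed.

Lemma C1_bb : C1 setT bb (fun w => 2 * w.1) (fun w => 2 * w.2).
Proof.
apply: C1_eq (C1_add (C1_add (C1_mul oT (@C1_fst R setT) (@C1_fst R setT))
  (C1_mul oT (@C1_snd R setT) (@C1_snd R setT))) (@C1_cst R setT e)) => w /=.
- by [].
- by ring.
- by ring.
Qed.

Definition bell w : R := A * ba w `^ q + B * (ba w * bb w `^ (q - 1)) - bb w `^ q.
Definition bE w : R := A * q * ba w `^ (q - 1) + (B - q) * bb w `^ (q - 1) +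
  B * (q - 1) * (ba w * bb w `^ (q - 2)).
Definition bG w : R := B * (q - 1) * (ba w * bb w `^ (q - 2)) - q * bb w `^ (q - 1).
Definition bM w : R := (B - q) * (q - 1) * bb w `^ (q - 2) +
  B * (q - 1) * (q - 2) * (ba w * bb w `^ (q - 3)).

Lemma C1_apow s : C1 setT (fun w => ba w `^ s) (fun w => s * ba w `^ (s - 1) * (2 * w.1)) (cst 0).
Proof.
apply: C1_eq (C1_powR s oT C1_ba (fun w _ => ba_gt0 w)) => // w /=.
by rewrite mulr0.
Qed.

Lemma C1_bpow s : C1 setT (fun w => bb w `^ s) (fun w => s * bb w `^ (s - 1) * (2 * w.1))
  (fun w => s * bb w `^ (s - 1) * (2 * w.2)).
Proof. exact: (C1_powR s oT C1_bb (fun w _ => bb_gt0 w)). Qed.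

Definition C1_scal (c : R) f fx fy (hf : C1 setT f fx fy) :=
  C1_mul oT (@C1_cst R setT c) hf.

Let q2 : q - 1 - 1 = q - 2. Proof. by ring. Qed.
Let q3 : q - 2 - 1 = q - 3. Proof. by ring. Qed.

Lemma C1_bell : C1 setT bell (fun w => 2 * w.1 * bE w) (fun w => 2 * w.2 * bG w).
Proof.
apply: C1_eq (C1_add (C1_add (C1_scal A (C1_apow q))
  (C1_scal B (C1_mul oT C1_ba (C1_bpow (q - 1))))) (C1_scal (-1) (C1_bpow q))) => w /=;
  rewrite /bell /bE /bG ?q2; ring.
Qed.

Lemma C1_bE : C1 setT bE (fun w => 2 * w.1 * (A * q * (q - 1) * ba w `^ (q - 2) +
     B * (q - 1) * bb w `^ (q - 2) + bM w)) (fun w => 2 * w.2 * bM w).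
Proof.
apply: C1_eq (C1_add (C1_add (C1_scal (A * q) (C1_apow (q - 1)))
  (C1_scal (B - q) (C1_bpow (q - 1))))
  (C1_scal (B * (q - 1)) (C1_mul oT C1_ba (C1_bpow (q - 2))))) => w /=;
  rewrite /bE /bM ?q2 ?q3; ring.
Qed.

Lemma C1_bG : C1 setT bG (fun w => 2 * w.1 * bM w) (fun w => 2 * w.2 * (bM w - B * (q - 1) * bb w `^ (q - 2))).
Proof.
apply: C1_eq (C1_add (C1_scal (B * (q - 1)) (C1_mul oT C1_ba (C1_bpow (q - 2))))
   (C1_scal (- q) (C1_bpow (q - 1)))) => w /=;
  rewrite /bG /bM ?q2 ?q3; ring.
Qed.

End bellman.

Ltac nonneg := do 8? rewrite ?sqr_ge0 ?exprn_ge0 1?mulr_ge0 ?invr_ge0 ?ler0n //.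

Section algebra.
Context {R : realType}.

Lemma quad_bounds (x y b H K P : R) : x ^+ 2 + y ^+ 2 <= b -> K <= H -> `|P| <= H ->
  x ^+ 2 * H + 2 * (x * y) * P + y ^+ 2 * K <= 2 * b * H.
Proof.
move=> xyb KH PH; have H0 : 0 <= H by apply: le_trans PH.
have h1 : 2 * (x * y) * P <= (x ^+ 2 + y ^+ 2) * H.
  apply: le_trans (ler_norm _) _; rewrite normrM.
  apply: ler_pM => //; rewrite ler_norml.
  have := sqr_ge0 (x - y); have := sqr_ge0 (x + y); rewrite sqrrD sqrrB => ? ?.
  by apply/andP; split; lra.
have h2 : y ^+ 2 * K <= y ^+ 2 * H by rewrite ler_wpM2l// sqr_ge0.
have h3 : (x ^+ 2 + y ^+ 2) * H <= b * H by rewrite ler_wpM2r.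
lra.
Qed.

(** The Laplacian of [bell (u, v)] for [q <= 1], written with [H = |grad u|^2],
    [K = |grad v|^2], [S = |u grad u + v grad v|^2], [al = a^(q-1)] and [be = b^(q-1)]. The
    terms with [A] leave at least [2 A (2 q - 1) q al H = 4 q al H], which dominates the negative
    terms [2 q be (H + K)] because [be <= al] and [K <= H]. *)
Lemma bellman_small (q A al be x a b H K S : R) :
  1 / 2 < q -> q <= 1 -> A * (2 * q - 1) = 2 -> 0 < a -> x ^+ 2 <= a ->
  0 <= K -> K <= H -> 0 <= S -> 0 < b -> 0 < be -> be <= al ->
  0 <= 2 * (A * q * al - q * be) * H + 4 * (A * q * (q - 1)) * (x ^+ 2 * (al / a)) * H
     + 4 * (- q * (q - 1) * (be / b)) * S - 2 * (q * be) * K.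
Proof.
move=> q2 q1 eA a0 xa K0 KH S0 b0 be0 beal.
have A0 : 0 < A.
  by rewrite -(@pmulr_lgt0 _ (2 * q - 1)) ?eA//; lra.
have H0 : 0 <= H by apply: le_trans KH.
have t1 : 0 <= - q * (q - 1) * (be / b) * S.
  have h : 0 <= - q * (q - 1) by rewrite mulNr -mulrN mulr_ge0//; lra.
  by rewrite mulr_ge0// mulr_ge0// divr_ge0// ltW.
have t2 : x ^+ 2 * (al / a) <= al.
  by rewrite mulrA ler_pdivrMr// mulrC ler_wpM2l//; lra.
have t3 : A * q * (q - 1) * al * H <= A * q * (q - 1) * (x ^+ 2 * (al / a)) * H.
  rewrite ler_wpM2r// ler_wnM2l//; rewrite mulr_ge0_le0// ?subr_le0// mulr_ge0 ?ltW//; lra.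
have t4 : q * be * K <= q * be * H by rewrite ler_wpM2l// mulr_ge0 ?ltW//; lra.
have t5 : q * be * H <= q * al * H by rewrite ler_wpM2r// ler_wpM2l//; lra.
have t6 : A * (2 * q - 1) * (q * al * H) = 2 * (q * al * H) by rewrite eA.
lra.
Qed.

(** The same Laplacian for [q >= 1], with [P = grad u . grad v]. The alternative in the hypotheses
    separates the region where [a] is much smaller than [b] from the one where [al] and [be] are
    comparable; there the large constant [A] decides. *)
Lemma bellman_large (q A B al be x y a b H K P S : R) :
  B = 8 * q ^+ 2 -> S = x ^+ 2 * H + 2 * (x * y) * P + y ^+ 2 * K ->
  1 <= q -> 0 <= A -> 0 < a -> a <= b -> x ^+ 2 <= a -> x ^+ 2 + y ^+ 2 <= b ->
  0 <= K -> K <= H -> `|P| <= H -> 0 <= S -> 0 < al -> 0 < be ->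
  96 * q ^+ 2 * a <= b \/ 288 * q ^+ 3 * be <= A * al ->
  0 <= 2 * (A * q * al + (B - q) * be + B * (q - 1) * (a * (be / b))) * H
     + 2 * (B * (q - 1) * (a * (be / b)) - q * be) * K
     + 4 * (A * q * (q - 1)) * (x ^+ 2 * (al / a)) * H
     + 4 * ((B - q) * (q - 1) * (be / b) + B * (q - 1) * (q - 2) * (a / b * (be / b))) * S
     + 4 * (B * (q - 1)) * (be / b) * (x ^+ 2 * H - y ^+ 2 * K).
Proof.
move=> eB eS q1 A0 a0 ab xa xyb K0 KH PH S0 al0 be0 cond.
have b0 : 0 < b by apply: lt_le_trans ab.
have b0' := ltW b0.
have H0 : 0 <= H by apply: le_trans KH.
have [a0' al0' be0'] : [/\ 0 <= a, 0 <= al & 0 <= be] by rewrite !ltW.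
have S2 : S <= 2 * b * H by rewrite eS; exact: quad_bounds.
set r := be / b; have r0 : 0 < r by rewrite divr_gt0.
have r0' := ltW r0.
have ber : be = r * b by rewrite divfK// gt_eqF.
set rho := a / b; have rho0 : 0 < rho by rewrite divr_gt0.
have rho0' := ltW rho0.
have rhob : rho * b = a by rewrite divfK// gt_eqF.
have q20 : 0 < q ^+ 2 by rewrite exprn_gt0// (lt_le_trans _ q1).
have B0 : 0 < B by rewrite eB mulr_gt0.
have B0' := ltW B0.
have q10 : 0 <= q - 1 by rewrite subr_ge0.
have q0 : 0 <= q by apply: le_trans q1.
have t1 : 0 <= A * q * (q - 1) * (x ^+ 2 * (al / a)) * H.
  by nonneg.
have t2 : 0 <= B * (q - 1) * (a * r) * H by nonneg.
have t3 : 0 <= B * (q - 1) * (a * r) * K by nonneg.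
have t4 : q * be * K <= q * be * H by rewrite ler_wpM2l//; nonneg.
have hm : - (y ^+ 2 + 256 * q ^+ 2 * x ^+ 2) * H <= 32 * q * (x * y) * P.
  have : `|32 * q * (x * y) * P| <= (y ^+ 2 + 256 * q ^+ 2 * x ^+ 2) * H.
    rewrite normrM ler_pM// ler_norml.
    have := sqr_ge0 (y - 16 * q * x); have := sqr_ge0 (y + 16 * q * x).
    by rewrite sqrrD sqrrB => ? ?; apply/andP; split; lra.
  by rewrite ler_norml mulNr => /andP[].
have k256 : 0 <= 256 * q ^+ 2 := mulr_ge0 (ler0n _ _) (sqr_ge0 q).
have k576 : 0 <= 576 * q ^+ 4 := mulr_ge0 (ler0n _ _) (exprn_ge0 4 q0).
have k6 : 0 <= 6 * q ^+ 2 := mulr_ge0 (ler0n _ _) (sqr_ge0 q).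
have rH0 : 0 <= r * H by rewrite mulr_ge0.
have qm : (q - 1) * (- (b + 256 * q ^+ 2 * a) * H) <= 32 * q * ((q - 1) * ((x * y) * P)).
  have -> : 32 * q * ((q - 1) * ((x * y) * P)) = (q - 1) * (32 * q * (x * y) * P) by ring.
  rewrite ler_wpM2l//; apply: le_trans hm; rewrite ler_wpM2r// lerN2 lerD//.
    by move: xyb; have := sqr_ge0 x; clear; lra.
  exact: (ler_wpM2l k256 xa).
have qS : (q - 1) * q * S <= (q - 1) * q * (2 * b * H).
  by rewrite ler_wpM2l//; nonneg.
have rS : - ((q - 1) * rho * (2 * b * H)) <= (q - 1) * (q - 2) * rho * S.
  apply: le_trans (_ : - ((q - 1) * rho * S) <= _).
    by rewrite lerN2 ler_wpM2l//; nonneg.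
  have : 0 <= (q - 1) * (q - 1) * rho * S by nonneg.
  by clear; lra.
have x2 : 0 <= (q - 1) * (x ^+ 2 * H) by nonneg.
(* Adding [B S] to [B (x^2 H - y^2 K)] removes [y^2 K] and leaves [2 x^2 H + 2 x y P], whose
   mixed part is controlled by [hm]. *)
pose T := (q - 1) * (B * (2 * (x ^+ 2 * H) + 2 * ((x * y) * P)) - q * S + B * (q - 2) * rho * S).
have eT : 4 * ((B - q) * (q - 1) * r + B * (q - 1) * (q - 2) * (rho * r)) * S
     + 4 * (B * (q - 1)) * r * (x ^+ 2 * H - y ^+ 2 * K) = 4 * r * T.
  by rewrite /T eS; ring.
have hT : - ((q - 1) * H * (5 / 2 * q * b + (128 * q ^+ 3 + 16 * q ^+ 2) * a)) <= T.
  have e1 : 2 * B * ((q - 1) * ((x * y) * P)) = q / 2 * (32 * q * ((q - 1) * ((x * y) * P))).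
    by rewrite eB; field.
  have h1 : q / 2 * ((q - 1) * (- (b + 256 * q ^+ 2 * a) * H)) <= q / 2 * (32 * q * ((q - 1) * ((x * y) * P))).
    by rewrite ler_wpM2l// divr_ge0.
  have h2 : B * (- ((q - 1) * rho * (2 * b * H))) <= B * ((q - 1) * (q - 2) * rho * S).
    by rewrite ler_wpM2l// ltW.
  have h3 : 0 <= B * ((q - 1) * (x ^+ 2 * H)) by rewrite mulr_ge0// ltW.
  have e2 : B * (- ((q - 1) * rho * (2 * b * H))) = - (16 * q ^+ 2 * (q - 1) * a * H).
    by rewrite -rhob eB; ring.
  have -> : T = 2 * (B * ((q - 1) * (x ^+ 2 * H))) + 2 * B * ((q - 1) * (x * y * P)) - (q - 1) * q * S
      + B * ((q - 1) * (q - 2) * rho * S) by rewrite /T; ring.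
  move: h1 h2 h3; rewrite e1 e2 eB; move: qS; clear; lra.
have hrT : - (r * H * ((10 * q ^+ 2 - 10 * q) * b + 576 * q ^+ 4 * a)) <= 4 * r * T.
  have h1 : (q - 1) * (512 * q ^+ 3 + 64 * q ^+ 2) <= 576 * q ^+ 4.
    have c1 : 0 <= q ^+ 4 by nonneg.
    have c2 : 0 <= q ^+ 3 by nonneg.
    have -> : (q - 1) * (512 * q ^+ 3 + 64 * q ^+ 2) = 512 * q ^+ 4 - 448 * q ^+ 3 - 64 * q ^+ 2 by ring.
    by move: c1 c2 q20; clear; lra.
  have h2 : (q - 1) * (512 * q ^+ 3 + 64 * q ^+ 2) * (r * H * a) <= 576 * q ^+ 4 * (r * H * a).
    by rewrite ler_wpM2r//; nonneg.
  have h3 : 4 * r * - ((q - 1) * H * (5 / 2 * q * b + (128 * q ^+ 3 + 16 * q ^+ 2) * a)) <= 4 * r * T.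
    by rewrite ler_wpM2l//; nonneg.
  apply: le_trans h3.
  have -> : 4 * r * - ((q - 1) * H * (5 / 2 * q * b + (128 * q ^+ 3 + 16 * q ^+ 2) * a)) =
     - (r * H * ((10 * q ^+ 2 - 10 * q) * b)) - (q - 1) * (512 * q ^+ 3 + 64 * q ^+ 2) * (r * H * a).
    by field.
  by move: h2; clear; lra.
have hc : 576 * q ^+ 4 * (r * H * a) <= 2 * A * q * al * H + 6 * q ^+ 2 * (r * H * b).
  have g1 : 0 <= 2 * A * q * al * H by nonneg.
  have g2 : 0 <= 6 * q ^+ 2 * (r * H * b) := mulr_ge0 k6 (mulr_ge0 rH0 b0').
  case: cond => hc.
    have : 6 * q ^+ 2 * (r * H) * (96 * q ^+ 2 * a) <= 6 * q ^+ 2 * (r * H) * b.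
      exact: (ler_wpM2l (mulr_ge0 k6 rH0) hc).
    have -> : 6 * q ^+ 2 * (r * H) * (96 * q ^+ 2 * a) = 576 * q ^+ 4 * (r * H * a) by ring.
    by move: g1; clear; lra.
  have h1 : 2 * q * H * (288 * q ^+ 3 * be) <= 2 * q * H * (A * al).
    by rewrite ler_wpM2l//; nonneg.
  have h2 : 576 * q ^+ 4 * (r * H) * a <= 576 * q ^+ 4 * (r * H) * b.
    exact: (ler_wpM2l (mulr_ge0 k576 rH0) ab).
  have e1 : 2 * q * H * (288 * q ^+ 3 * be) = 576 * q ^+ 4 * (r * H) * b by rewrite ber; ring.
  by move: h1 h2 g2; rewrite e1; clear; lra.
have t5 : 0 <= q * (r * H * b) by nonneg.
rewrite -addrA eT.
have -> : 2 * (A * q * al + (B - q) * be + B * (q - 1) * (a * r)) * H =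
   2 * A * q * al * H + (16 * q ^+ 2 - 2 * q) * (r * H * b) + 2 * (B * (q - 1) * (a * r) * H).
  by rewrite ber eB; ring.
have t4' : q * be * K <= q * (r * H * b).
  by apply: le_trans t4 _; rewrite ber le_eqVlt; apply/orP; left; apply/eqP; ring.
have -> : 2 * (B * (q - 1) * (a * r) - q * be) * K =
  2 * (B * (q - 1) * (a * r) * K) - 2 * (q * be * K) by ring.
have -> : 4 * (A * q * (q - 1)) * (x ^+ 2 * (al / a)) * H =
  4 * (A * q * (q - 1) * (x ^+ 2 * (al / a)) * H) by ring.
by move: hrT hc t1 t2 t3 t4' t5; clear; lra.
Qed.
End algebra.

Section bellman_hessian.
Context {R : realType}.
Local Notation mR := (measurableTypeR R).
Local Notation plane := (mR * mR)%type.
Local Notation mu2 := (@lebesgue_measure R \x @lebesgue_measure R)%E.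

Definition hess_xx (q A B e : R) w := 2 * bE q A B e w + 4 * w.1 ^+ 2 * (A * q * (q - 1) * ba e w `^ (q - 2) +
     B * (q - 1) * bb e w `^ (q - 2) + bM q B e w).
Definition hess_xy (q B e : R) w := 4 * (w.1 * w.2) * bM q B e w.
Definition hess_yy (q B e : R) w := 2 * bG q B e w + 4 * w.2 ^+ 2 * (bM q B e w - B * (q - 1) * bb e w `^ (q - 2)).

(** The quadratic form is the Laplacian of [bell (u, v)] at a point where [(u, v) = w],
    [grad u = (a, b)] and [grad v = (c, d)]; the first derivatives of [bell] drop out because [u]
    and [v] are harmonic. *)
Definition hess_nonneg (q A B e : R) := forall w (a b c d : R), c ^+ 2 + d ^+ 2 <= a ^+ 2 + b ^+ 2 ->
  0 <= hess_xx q A B e w * (a ^+ 2 + b ^+ 2) + 2 * hess_xy q B e w * (a * c + b * d)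
     + hess_yy q B e w * (c ^+ 2 + d ^+ 2).

Lemma powR_sub1 (a s : R) : 0 < a -> a `^ (s - 1) = a `^ s / a.
Proof. by move=> a0; rewrite powRB ?powRr1 ?ltW// (gt_eqF a0) implybT. Qed.

Lemma norm_dot_le (a b c d : R) : c ^+ 2 + d ^+ 2 <= a ^+ 2 + b ^+ 2 ->
  `|a * c + b * d| <= a ^+ 2 + b ^+ 2.
Proof.
move=> h; rewrite ler_norml.
have := sqr_ge0 (a - c); have := sqr_ge0 (a + c); have := sqr_ge0 (b - d); have := sqr_ge0 (b + d).
by rewrite !sqrrD !sqrrN => *; apply/andP; split; lra.
Qed.

Lemma hess_nonneg_small (q A e : R) : 0 < e -> 1 / 2 < q -> q <= 1 -> A * (2 * q - 1) = 2 ->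
  hess_nonneg q A 0 e.
Proof.
move=> e0 q2 q1 eA w a b c d h.
have a0 := ba_gt0 e0 w; have b0 := bb_gt0 e0 w.
have ab : ba e w <= bb e w by rewrite /ba /bb lerD2r lerDl sqr_ge0.
have xa : w.1 ^+ 2 <= ba e w by rewrite lerDl ltW.
have beal : bb e w `^ (q - 1) <= ba e w `^ (q - 1).
  rewrite -[q - 1]opprB !powRN lef_pV2 ?posrE ?powR_gt0//.
  by apply: ge0_ler_powR; rewrite ?nnegrE ?subr_ge0//; exact: ltW.
have S0 := addr_ge0 (sqr_ge0 (w.1 * a + w.2 * c)) (sqr_ge0 (w.1 * b + w.2 * d)).
have K0 := addr_ge0 (sqr_ge0 c) (sqr_ge0 d).
have := bellman_small q2 q1 eA a0 xa K0 h S0 b0 (powR_gt0 (q - 1) b0) beal.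
rewrite /hess_xx /hess_xy /hess_yy /bE /bG /bM.
have -> : q - 2 = q - 1 - 1 by ring.
rewrite !(powR_sub1 (q - 1))// => h1; apply: le_trans h1 _.
by rewrite le_eqVlt; apply/orP; left; apply/eqP; field; rewrite !gt_eqF.
Qed.

Lemma hess_nonneg_large (q e : R) (A := 288 * q ^+ 3 * (96 * q ^+ 2) `^ (q - 1)) : 0 < e -> 1 <= q ->
  hess_nonneg q A (8 * q ^+ 2) e.
Proof.
move=> e0 q1 w a b c d h.
have a0 := ba_gt0 e0 w; have b0 := bb_gt0 e0 w.
have ab : ba e w <= bb e w by rewrite /ba /bb lerD2r lerDl sqr_ge0.
have xa : w.1 ^+ 2 <= ba e w by rewrite lerDl ltW.
have xyb : w.1 ^+ 2 + w.2 ^+ 2 <= bb e w by rewrite lerDl ltW.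
have q20 : 0 < q ^+ 2 by rewrite exprn_gt0//; lra.
have q30 : 0 < q ^+ 3 by rewrite exprn_gt0//; lra.
have A0 : 0 <= A by exact: (mulr_ge0 (mulr_ge0 (ler0n _ _) (ltW q30)) (powR_ge0 _ _)).
have cond : 96 * q ^+ 2 * ba e w <= bb e w \/
    288 * q ^+ 3 * bb e w `^ (q - 1) <= A * ba e w `^ (q - 1).
  have [|hab] := leP (96 * q ^+ 2 * ba e w) (bb e w); first by left.
  right; rewrite /A -[leRHS]mulrA; apply: ler_wpM2l; first exact: (mulr_ge0 (ler0n _ _) (ltW q30)).
  rewrite -powRM; [|exact: (mulr_ge0 (ler0n _ _) (ltW q20))|exact: ltW].
  have h0 : 0 <= 96 * q ^+ 2 * ba e w := mulr_ge0 (mulr_ge0 (ler0n _ _) (ltW q20)) (ltW a0).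
  by apply: ge0_ler_powR; rewrite ?nnegrE ?subr_ge0//; exact: ltW.
have S0 := addr_ge0 (sqr_ge0 (w.1 * a + w.2 * c)) (sqr_ge0 (w.1 * b + w.2 * d)).
have K0 := addr_ge0 (sqr_ge0 c) (sqr_ge0 d).
have eS : (w.1 * a + w.2 * c) ^+ 2 + (w.1 * b + w.2 * d) ^+ 2 = w.1 ^+ 2 * (a ^+ 2 + b ^+ 2)
   + 2 * (w.1 * w.2) * (a * c + b * d) + w.2 ^+ 2 * (c ^+ 2 + d ^+ 2) by ring.
have := bellman_large erefl eS q1 A0 a0 ab xa xyb K0 h (norm_dot_le h) S0
   (powR_gt0 (q - 1) a0) (powR_gt0 (q - 1) b0) cond.
rewrite /hess_xx /hess_xy /hess_yy /bE /bG /bM.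
have -> : q - 3 = q - 1 - 1 - 1 by ring.
have -> : q - 2 = q - 1 - 1 by ring.
rewrite !(powR_sub1 (q - 1 - 1))// !(powR_sub1 (q - 1))// => h1; apply: le_trans h1 _.
by rewrite le_eqVlt; apply/orP; left; apply/eqP; field; rewrite !gt_eqF.
Qed.

Lemma bell_ge0 (q A B e x : R) : 0 < e -> 1 <= A + B -> 0 <= bell q A B e (x, 0).
Proof.
move=> e0 AB; have b0 := bb_gt0 e0 (x, 0).
have -> : bell q A B e (x, 0) = (A + B - 1) * bb e (x, 0) `^ q.
  rewrite /bell (_ : ba e (x, 0) = bb e (x, 0)); last by rewrite /ba /bb/= expr0n/= addr0.
  have -> : bb e (x, 0) * bb e (x, 0) `^ (q - 1) = bb e (x, 0) `^ q.
    by rewrite powR_sub1// mulrC divfK// gt_eqF.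
  by ring.
by rewrite mulr_ge0 ?powR_ge0// subr_ge0.
Qed.

(** Splitting at [b = 2 B a]: beyond it the mixed term is at most half of [b^q], before it at most
    a multiple of [a^q]. *)
Lemma bell_le (q A B e : R) w : 0 < e -> 0 <= B -> B = 0 \/ 1 <= q ->
  bell q A B e w <= (A + B * (2 * B) `^ (q - 1)) * ba e w `^ q - 2^-1 * bb e w `^ q.
Proof.
move=> e0 B0 Bq; have a0 := ba_gt0 e0 w; have b0 := bb_gt0 e0 w; rewrite /bell.
have bq : bb e w `^ q = bb e w * bb e w `^ (q - 1).
  by rewrite powR_sub1// mulrC divfK// gt_eqF.
have aq : ba e w `^ q = ba e w * ba e w `^ (q - 1).
  by rewrite powR_sub1// mulrC divfK// gt_eqF.
suff : B * (ba e w * bb e w `^ (q - 1)) <= B * (2 * B) `^ (q - 1) * ba e w `^ q + 2^-1 * bb e w `^ q by lra.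
have p0 : 0 <= B * (2 * B) `^ (q - 1) * ba e w `^ q by rewrite !mulr_ge0 ?powR_ge0.
have [hab|hab] := leP (2 * B * ba e w) (bb e w).
  apply: le_trans (_ : 2^-1 * bb e w `^ q <= _); last by rewrite lerDr.
  rewrite bq !mulrA ler_wpM2r ?powR_ge0//; lra.
case: Bq => [->|q1]; first by rewrite !mul0r add0r mulr_ge0// powR_ge0.
apply: le_trans (_ : B * (2 * B) `^ (q - 1) * ba e w `^ q <= _); last first.
  by rewrite lerDl mulr_ge0// powR_ge0.
rewrite -mulrA ler_wpM2l// aq mulrCA.
apply: ler_wpM2l; first exact: ltW.
rewrite -powRM; [|by rewrite mulr_ge0|exact: ltW].
apply: ge0_ler_powR; rewrite ?nnegrE ?subr_ge0//; [exact: ltW|exact: ltW (lt_trans b0 hab)|exact: ltW].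
Qed.

(** For [q <= 1] the constant [A = 2 / (2 q - 1)] blows up as [q] tends to 1/2, that is, as [p]
    tends to 1. For [q > 1] the constants are those of the quadratic form estimates. *)
Lemma bellman_exists (q : R) : 1 / 2 < q -> exists A B C : R, [/\ 0 <= C, 1 <= A + B,
  forall e, 0 < e -> hess_nonneg q A B e &
  forall e w, 0 < e -> bell q A B e w <= C * ba e w `^ q - 2^-1 * bb e w `^ q].
Proof.
move=> q2; have [q1|q1] := leP q 1.
  have q0 : 0 < 2 * q - 1 by lra.
  exists (2 / (2 * q - 1)), 0, (2 / (2 * q - 1) + 0 * (2 * 0) `^ (q - 1)); split.
  - by rewrite mul0r addr0 divr_ge0// ltW.
  - by rewrite addr0 ler_pdivlMr// mul1r; lra.
  - by move=> e e0; apply: hess_nonneg_small => //; rewrite divfK// gt_eqF.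
  - by move=> e w e0; apply: bell_le => //; left.
have q20 : 0 < q ^+ 2 by rewrite exprn_gt0//; lra.
have q30 : 0 < q ^+ 3 by rewrite exprn_gt0//; lra.
have q21 : 1 <= q ^+ 2 by rewrite exprn_ege1// ltW.
have A0 : 0 <= 288 * q ^+ 3 * (96 * q ^+ 2) `^ (q - 1).
  exact: (mulr_ge0 (mulr_ge0 (ler0n _ _) (ltW q30)) (powR_ge0 _ _)).
exists (288 * q ^+ 3 * (96 * q ^+ 2) `^ (q - 1)), (8 * q ^+ 2),
  (288 * q ^+ 3 * (96 * q ^+ 2) `^ (q - 1) + 8 * q ^+ 2 * (2 * (8 * q ^+ 2)) `^ (q - 1)); split.
- by rewrite addr_ge0// mulr_ge0 ?powR_ge0// mulr_ge0// ltW.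
- lra.
- by move=> e e0; apply: hess_nonneg_large => //; exact: ltW.
- move=> e w e0; apply: bell_le => //; first lra.
  by right; exact: ltW.
Qed.

(** The gradient is part of the data because the estimates compare gradients. *)
Definition harmonic_with (D : set (R * R)) (u ux uy : R * R -> R) :=
  exists uxx uxy uyx uyy, [/\ C1 D u ux uy, C1 D ux uxx uxy, C1 D uy uyx uyy &
    forall w, D w -> uxx w + uyy w = 0].

Lemma bell_submean (q A B e : R) (omega : R -> R) (rho : R) (u ux uy v vx vy : R * R -> R) :
  0 < e -> hess_nonneg q A B e ->
  0 < rho -> rho < 1 -> weight rho omega ->
  harmonic_with (odisc (0, 0) 1) u ux uy -> harmonic_with (odisc (0, 0) 1) v vx vy ->
  (forall w, odisc (0, 0) 1 w -> vx w ^+ 2 + vy w ^+ 2 <= ux w ^+ 2 + uy w ^+ 2) ->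
  bell q A B e (u (0, 0), v (0, 0)) * \int[mu2]_z omega (sqn z) <=
  \int[mu2]_z (omega (sqn z) * bell q A B e (u z, v z)).
Proof.
move=> e0 hess rho0 rho1 hw.
move=> [uxx [uxy [uyx [uyy [hu hux huy lapu]]]]] [vxx [vxy [vyx [vyy [hv hvx hvy lapv]]]]] sub.
have oD := @open_odisc R (0, 0) 1.
have oT := @openT (R * R)%type.
have Dx := C1_scal 2 (@C1_fst R setT); have Dy := C1_scal 2 (@C1_snd R setT).
have b1 := C1_mul oT Dx (C1_bE q A B e0).
have b2 := C1_mul oT Dy (C1_bG q B e0).
have h0 := C1_comp oD (C1_bell q A B e0) hu hv.
have h1 := C1_comp oD b1 hu hv.
have h2 := C1_comp oD b2 hu hv.
have hx := C1_add (C1_mul oD h1 hux) (C1_mul oD h2 hvx).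
have hy := C1_add (C1_mul oD h1 huy) (C1_mul oD h2 hvy).
have := @submean R (0, 0) rho 1 omega _ _ _ _ _ _ _ rho0 rho1 hw h0 hx hy.
rewrite (_ : \int[mu2]_z (omega (sqn z) * bell q A B e (u (line (0, 0) 1 z), v (line (0, 0) 1 z)))
  = \int[mu2]_z (omega (sqn z) * bell q A B e (u z, v z))); last first.
  by apply: eq_Rintegral => z _; rewrite /line/= !mul1r !add0r -surjective_pairing.
apply => w Dw.
have := hess (u w, v w) _ _ _ _ (sub w Dw).
rewrite /hess_xx /hess_xy /hess_yy/=.
have -> : uyy w = - uxx w by apply/eqP; rewrite -addr_eq0 addrC lapu.
have -> : vyy w = - vxx w by apply/eqP; rewrite -addr_eq0 addrC lapv.
move=> h; apply: le_trans h _.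
rewrite le_eqVlt; apply/orP; left; apply/eqP.
ring.
Qed.

End bellman_hessian.

(** * Exponents above 1 *)

Section riesz.
Context {R : realType}.
Local Notation mR := (measurableTypeR R).
Local Notation plane := (mR * mR)%type.
Local Notation mu2 := (@lebesgue_measure R \x @lebesgue_measure R)%E.
Local Notation D := (odisc (0, 0) 1 : set (R * R)).

Lemma odisc0 (r : R) (w : R * R) : odisc (0, 0) r w = (sqn w < r ^+ 2) :> Prop.
Proof. by rewrite /odisc/= !subr0 -surjective_pairing. Qed.

Lemma measurable_weight (rho p : R) (omega : R -> R) (v : R * R -> R) : 0 < rho -> rho < 1 ->
  weight rho omega -> (forall w, D w -> {for w, continuous v}) ->
  measurable_fun setT (fun w : plane => omega (sqn w) * `|v w| `^ p).
Proof.
move=> rho0 rho1 [com om0 omge] cv.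
rewrite (_ : (fun w => _) = (fun w => omega (sqn w) * `|v w| `^ p) \_ D); last first.
  apply/funext => w; rewrite patchE; case: ifPn => // /negP; rewrite inE odisc0 => /negP.
  rewrite -leNgt => h; rewrite om0 ?mul0r//; apply: le_trans h.
  by rewrite ler_pXn2r ?nnegrE ?ltW.
have mD : measurable (D : set plane) by apply: open_measurable2; exact: open_odisc.
apply/(measurable_restrictT _ mD); apply: measurable_funM.
  apply: measurable_funTS; apply: continuousT_measurable2 => w.
  by apply: (@continuous_comp _ _ _ (@sqn R) omega); [exact: sqn_continuous|exact: com].
apply: (measurableT_comp (measurable_powR p)); apply: measurableT_comp => //.
by apply: continuous_measurable2 => //; exact: open_odisc.
Qed.

Lemma powR_norm2 (q x : R) : (x ^+ 2) `^ q = `|x| `^ (2 * q).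
Proof. by rewrite powRrM powR_mulrn// real_normK// num_real. Qed.

Lemma powR_add_le (a b q : R) : 0 <= q -> 0 <= a -> 0 <= b ->
  (a + b) `^ q <= 2 `^ q * (a `^ q + b `^ q).
Proof.
move=> q0; wlog ab : a b / a <= b.
  move=> hw a0 b0; have [ab|/ltW ba] := leP a b; first exact: hw.
  by rewrite addrC [a `^ _ + _]addrC; exact: hw.
move=> a0 b0; apply: le_trans (_ : (2 * b) `^ q <= _).
  apply: ge0_ler_powR; rewrite ?nnegrE ?addr_ge0 ?mulr_ge0//; lra.
by rewrite powRM// ler_wpM2l ?powR_ge0// lerDr powR_ge0.
Qed.

Let one_lt_half (q : R) : 1 / 2 < q -> 0 < q. Proof. by move=> h; lra. Qed.

Lemma EFin_Rintegral (g : plane -> R) : mu2.-integrable setT (EFin \o g) ->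
  (\int[mu2]_z g z)%:E = (\int[mu2]_z (g z)%:E)%E.
Proof. by move=> ig; rewrite /Rintegral fineK//; exact: integrable_fin_num ig. Qed.

(** Integrating [bell_submean] at [v (0, 0) = 0] and using [bell_le] gives the inequality for the
    regularized powers; the regularization [e] then tends to 0 inside a fixed weight of finite
    mass. The constant depends on [q] only. *)
Lemma riesz_weight (q : R) : 1 / 2 < q -> exists2 C : R, 0 < C &
  forall rho omega u ux uy v vx vy, 0 < rho -> rho < 1 -> weight rho omega ->
  harmonic_with D u ux uy -> harmonic_with D v vx vy ->
  (forall w, D w -> vx w ^+ 2 + vy w ^+ 2 <= ux w ^+ 2 + uy w ^+ 2) -> v (0, 0) = 0 ->
  (\int[mu2]_z (omega (sqn z) * `|v z| `^ (2 * q))%:E <=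
   C%:E * \int[mu2]_z (omega (sqn z) * `|u z| `^ (2 * q))%:E)%E.
Proof.
move=> q2; have q0 := one_lt_half q2.
have [A [B [C [C0 AB hess bellC]]]] := bellman_exists q2.
exists (2 * C * 2 `^ q + 1); first by rewrite ltr_wpDl// !mulr_ge0// powR_ge0.
move=> rho omega u ux uy v vx vy rho0 rho1 hw hu hv sub v0.
have [com om0 omge] := hw.
have oD : open D by exact: open_odisc.
have [cu cv] : (forall w, D w -> {for w, continuous u}) /\ (forall w, D w -> {for w, continuous v}).
  move: hu hv => [? [? [? [? [hu _ _ _]]]]] [? [? [? [? [hv _ _ _]]]]].
  by split => w; [exact: (C1_continuous oD hu)|exact: (C1_continuous oD hv)].
have oT := @openT (R * R)%type.
have cp (g : R * R -> R) : (forall w, D w -> {for w, continuous g}) ->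
    mu2.-integrable setT (EFin \o (fun w => omega (sqn w) * g w)).
  by move=> cg; apply: (weight_integrable rho0 rho1 hw) => w wr; apply: cg; rewrite odisc0.
have cbb e (e0 : 0 < e) w : D w -> {for w, continuous (fun w => bb e (u w, v w) `^ q)}.
  move=> Dw; apply: (continuous_pair2 (f := fun w => bb e w `^ q) (cu _ Dw) (cv _ Dw)).
  exact: (@C1_continuous _ _ _ _ _ (u w, v w) oT (C1_bpow e0 q) I).
have cba e (e0 : 0 < e) w : D w -> {for w, continuous (fun w => ba e (u w, v w) `^ q)}.
  move=> Dw; apply: (continuous_pair2 (f := fun w => ba e w `^ q) (cu _ Dw) (cv _ Dw)).
  exact: (@C1_continuous _ _ _ _ _ (u w, v w) oT (C1_apow e0 q) I).
have cbe e (e0 : 0 < e) w : D w -> {for w, continuous (fun w => bell q A B e (u w, v w))}.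
  move=> Dw; apply: (continuous_pair2 (f := bell q A B e) (cu _ Dw) (cv _ Dw)).
  exact: (@C1_continuous _ _ _ _ _ (u w, v w) oT (C1_bell q A B e0) I).
pose Jb e := \int[mu2]_z (omega (sqn z) * bb e (u z, v z) `^ q).
pose Ja e := \int[mu2]_z (omega (sqn z) * ba e (u z, v z) `^ q).
have JJ e : 0 < e -> Jb e <= 2 * C * Ja e.
  move=> e0.
  have := bell_submean e0 (hess e e0) rho0 rho1 hw hu hv sub.
  have h0 : 0 <= bell q A B e (u (0, 0), v (0, 0)) * \int[mu2]_z omega (sqn z).
    by rewrite v0 mulr_ge0 ?bell_ge0//; apply: Rintegral_ge0 => z _.
  move=> /(le_trans h0) h1.
  have : \int[mu2]_z (omega (sqn z) * bell q A B e (u z, v z)) <=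
    \int[mu2]_z (C * (omega (sqn z) * ba e (u z, v z) `^ q) + - 2^-1 * (omega (sqn z) * bb e (u z, v z) `^ q)).
    apply: le_Rintegral => //; first exact: cp (cbe e e0).
      rewrite (_ : (_ \o _) = EFin \o (fun z => omega (sqn z) * (C * ba e (u z, v z) `^ q - 2^-1 * bb e (u z, v z) `^ q))).
        apply: cp => w Dw; apply: cvgB; apply: cvgM; try exact: cvg_cst; [exact: cba|exact: cbb].
      by apply/funext => z /=; congr (_%:E); ring.
    move=> z _; apply: le_trans (_ : omega (sqn z) * (C * ba e (u z, v z) `^ q - 2^-1 * bb e (u z, v z) `^ q) <= _).
      by apply: ler_wpM2l => //; exact: bellC.
    by rewrite le_eqVlt; apply/orP; left; apply/eqP; ring.
  have ia := cp _ (cba e e0); have ib := cp _ (cbb e e0).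
  have iz (c : R) (g : plane -> R) : mu2.-integrable setT (EFin \o g) -> mu2.-integrable setT (EFin \o (fun z => c * g z)).
    by move=> ig; apply: (@integrableZl _ _ _ mu2 setT measurableT c) ig.
  rewrite RintegralD//; [|exact: iz|exact: iz].
  rewrite !RintegralZl// -/(Ja e) -/(Jb e) => h2.
  by have := le_trans h1 h2; lra.
have mom (g : R * R -> R) p : (forall w, D w -> {for w, continuous g}) ->
    measurable_fun setT (fun z : plane => (omega (sqn z) * `|g z| `^ p)%:E).
  by move=> cg; apply/measurable_EFinP; exact: (measurable_weight p rho0 rho1 hw cg).
have mb e : 0 < e -> measurable_fun setT (fun z : plane => (omega (sqn z) * bb e (u z, v z) `^ q)%:E).
  by move=> e0; have /measurable_int := cp _ (cbb e e0).
have ma e : 0 < e -> measurable_fun setT (fun z : plane => (omega (sqn z) * ba e (u z, v z) `^ q)%:E).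
  by move=> e0; have /measurable_int := cp _ (cba e e0).
have iom : mu2.-integrable setT (fun z => (omega (sqn z) * 1)%:E).
  by apply: cp => w _; exact: cvg_cst.
pose I0 := \int[mu2]_z (omega (sqn z) * 1).
have I00 : 0 <= I0 by apply: Rintegral_ge0 => z _; rewrite mulr1.
set X := (\int[mu2]_z (omega (sqn z) * `|u z| `^ (2 * q))%:E)%E.
have X0 : (0 <= X)%E by apply: integral_ge0 => z _; rewrite lee_fin mulr_ge0// powR_ge0.
have step e : 0 < e -> (\int[mu2]_z (omega (sqn z) * `|v z| `^ (2 * q))%:E <=
   (2 * C * 2 `^ q)%:E * X + (2 * C * 2 `^ q * (e `^ q * I0))%:E)%E.
  move=> e0; apply: (@le_trans _ _ (Jb e)%:E).
    rewrite EFin_Rintegral; last exact: cp (cbb e e0).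
    apply: ge0_le_integral => //.
    - by move=> z _; rewrite lee_fin mulr_ge0// powR_ge0.
    - exact: mom.
    - exact: mb.
    move=> z _; rewrite lee_fin ler_wpM2l// -powR_norm2.
    apply: ge0_ler_powR; rewrite ?nnegrE ?sqr_ge0 ?(ltW q0) ?(ltW (bb_gt0 _ _))//.
    by rewrite /bb/= addrAC lerDr addr_ge0 ?sqr_ge0// ltW.
  apply: (@le_trans _ _ (2 * C * Ja e)%:E); first by rewrite lee_fin JJ.
  rewrite EFinM [in X in (_ <= _ + X)%E]EFinM -ge0_muleDr//; last first.
    by rewrite lee_fin mulr_ge0// powR_ge0.
  rewrite [in leRHS]EFinM -muleA; apply: lee_wpmul2l; first by rewrite lee_fin mulr_ge0.
  rewrite EFin_Rintegral; last exact: cp (cba e e0).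
  apply: (@le_trans _ _ (\int[mu2]_z ((2 `^ q)%:E * ((omega (sqn z) * `|u z| `^ (2 * q))%:E +
      (e `^ q)%:E * (omega (sqn z) * 1)%:E)))%E).
    apply: ge0_le_integral => //.
    - by move=> z _; rewrite lee_fin mulr_ge0// powR_ge0.
    - exact: ma.
    - apply: emeasurable_funM => //; apply: emeasurable_funD; first exact: mom.
      by apply: emeasurable_funM => //; exact: measurable_int iom.
    move=> z _; rewrite -[leRHS]/((2 `^ q * (omega (sqn z) * `|u z| `^ (2 * q) + e `^ q * (omega (sqn z) * 1)))%:E).
    rewrite lee_fin -powR_norm2.
    rewrite mulr1 [e `^ q * _]mulrC -mulrDr mulrCA ler_wpM2l//.
    by apply: powR_add_le; rewrite ?sqr_ge0// ltW.
  rewrite ge0_integralZl_EFin ?powR_ge0//; last 2 first.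
  - by move=> z _; rewrite adde_ge0 ?lee_fin ?mulr_ge0 ?powR_ge0.
  - apply: emeasurable_funD; first exact: mom.
    by apply: emeasurable_funM => //; exact: measurable_int iom.
  rewrite ge0_integralD//; last 4 first.
  - by move=> z _; rewrite lee_fin mulr_ge0// powR_ge0.
  - exact: mom.
  - by move=> z _; rewrite -EFinM lee_fin !mulr_ge0// powR_ge0.
  - by apply: emeasurable_funM => //; exact: measurable_int iom.
  rewrite ge0_integralZl_EFin ?powR_ge0//; last 2 first.
  - by move=> z _; rewrite lee_fin mulr_ge0.
  - exact: measurable_int iom.
  by rewrite EFinM EFin_Rintegral.
apply: (@le_trans _ _ ((2 * C * 2 `^ q)%:E * X)%E); last first.
  by apply: lee_wpmul2r => //; rewrite lee_fin lerDl.
apply/lee_addgt0Pr => eta eta0.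
pose K0 := 2 * C * 2 `^ q * I0 + 1.
have K00 : 0 < K0 by rewrite ltr_wpDl// mulr_ge0// mulr_ge0 ?powR_ge0// mulr_ge0.
(* with this [e] the error term [2 C 2^q e^q I0] is less than [eta] *)
have e0 : 0 < (eta / K0) `^ q^-1 by rewrite powR_gt0// divr_gt0.
apply: (le_trans (step _ e0)); apply: leeD2l; rewrite lee_fin.
rewrite -powRrM mulVf ?gt_eqF// powRr1; last by rewrite divr_ge0// ltW.
rewrite (_ : 2 * C * 2 `^ q * (eta / K0 * I0) = eta * ((2 * C * 2 `^ q * I0) / K0)); last by field; rewrite gt_eqF.
by rewrite ler_piMr ?(ltW eta0)// ler_pdivrMr// mul1r /K0 lerDl.
Qed.

End riesz.

Section disc_weights.
Context {R : realType}.
Local Notation mR := (measurableTypeR R).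
Local Notation plane := (mR * mR)%type.
Local Notation mu2 := (@lebesgue_measure R \x @lebesgue_measure R)%E.
Local Notation D := (odisc (0, 0) 1 : set (R * R)).

(** Compactly supported weights that increase to [(1 - t)^alpha]: the second factor vanishes where
    [1 - t] is at most the gap, and the maximum keeps the formula continuous beyond. The gap is
    [1 / (2 (n + 1))], half of the [n]-th term of the harmonic sequence. *)
Definition wgap (n : nat) : R := harmonic n / 2.
Definition dweight (alpha : R) (n : nat) (t : R) : R :=
  Num.max (1 - t) (wgap n) `^ alpha * (1 - wgap n / Num.max (1 - t) (wgap n)).

Lemma wgap_gt0 n : 0 < wgap n.
Proof. by rewrite /wgap divr_gt0// harmonic_gt0. Qed.

Lemma wgap_lt1 n : wgap n < 1.
Proof.
have : harmonic n <= (1 : R) by rewrite /harmonic/= invf_le1// ler1n.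
by rewrite /wgap; lra.
Qed.

Lemma wgap_ndecr n m : (n <= m)%N -> wgap m <= wgap n.
Proof. by move=> nm; rewrite /wgap ler_pM2r// /harmonic/= lef_pV2 ?posrE// ler_nat ltnS. Qed.

Lemma wgap_cvg : wgap n @[n --> \oo] --> (0 : R).
Proof. by rewrite -(mul0r (2^-1)); apply: cvgM; [exact: cvg_harmonic|exact: cvg_cst]. Qed.

Definition wrho n : R := Num.sqrt (1 - wgap n).
Lemma wrho_gt0 n : 0 < wrho n.
Proof. by rewrite sqrtr_gt0 subr_gt0 wgap_lt1. Qed.
Lemma wrho_sqr n : wrho n ^+ 2 = 1 - wgap n.
Proof. by rewrite sqr_sqrtr// subr_ge0 ltW// wgap_lt1. Qed.
Lemma wrho_lt1 n : wrho n < 1.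
Proof.
by rewrite -(@ltr_pXn2r _ 2) ?nnegrE ?(ltW (wrho_gt0 n))// wrho_sqr expr1n ltrBlDr ltrDl wgap_gt0.
Qed.

Lemma max_gap_gt0 n (t : R) : 0 < Num.max (1 - t) (wgap n).
Proof. by rewrite lt_max wgap_gt0 orbT. Qed.

Lemma dweight_weight alpha n : weight (wrho n) (dweight alpha n).
Proof.
have cm : continuous (fun t : R => Num.max (1 - t) (wgap n)).
  move=> t; have := @continuous_max R R (fun t : R => 1 - t) (cst (wgap n)) t.
  by apply; [apply: cvgB; [exact: cvg_cst|exact: cvg_id]|exact: cvg_cst].
split.
- move=> t; apply: cvgM.
    apply: (@continuous_comp _ _ _ (fun t : R => Num.max (1 - t) (wgap n)) (fun x => x `^ alpha)).
      exact: cm.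
    exact: (@is_derive_continuous R (fun x => x `^ alpha) _ _ (is_derive1_powR _ (max_gap_gt0 n t))).
  apply: cvgB; first exact: cvg_cst.
  apply: cvgM; first exact: cvg_cst.
  by apply: cvgV; [rewrite gt_eqF// max_gap_gt0|exact: cm].
- move=> t; rewrite wrho_sqr => ht; rewrite /dweight.
  rewrite (_ : Num.max _ _ = wgap n); last by apply/max_idPr; lra.
  by rewrite divff ?subrr ?mulr0// gt_eqF// wgap_gt0.
- move=> t; rewrite mulr_ge0 ?powR_ge0// subr_ge0 ler_pdivrMr ?max_gap_gt0// mul1r.
  by rewrite le_max lexx orbT.
Qed.

Lemma dweight_ge0 alpha n t : 0 <= dweight alpha n t.
Proof. by have [] := dweight_weight alpha n. Qed.

Lemma dweightE alpha n t : wgap n <= 1 - t ->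
  dweight alpha n t = (1 - t) `^ alpha * (1 - wgap n / (1 - t)).
Proof. by move=> h; rewrite /dweight (_ : Num.max _ _ = 1 - t)//; apply/max_idPl. Qed.

Lemma dweight0 alpha n t : 1 - t <= wgap n -> dweight alpha n t = 0.
Proof. by move=> h; have [_ h0 _] := dweight_weight alpha n; apply: h0; rewrite wrho_sqr; lra. Qed.

Lemma dweight_le alpha n t : t < 1 -> dweight alpha n t <= (1 - t) `^ alpha.
Proof.
move=> t1; have [h|/ltW h] := leP (wgap n) (1 - t); last by rewrite dweight0// powR_ge0.
rewrite dweightE// ler_piMr ?powR_ge0// gerBl divr_ge0//; first exact: ltW (wgap_gt0 n).
by rewrite subr_ge0 ltW.
Qed.

Lemma dweight_ndecr alpha t n m : t < 1 -> (n <= m)%N -> dweight alpha n t <= dweight alpha m t.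
Proof.
move=> t1 nm; have [h|/ltW h] := leP (wgap n) (1 - t); last by rewrite dweight0// dweight_ge0.
have h' := le_trans (wgap_ndecr nm) h.
rewrite !dweightE// ler_wpM2l ?powR_ge0// lerD2l lerN2 ler_pM2r ?wgap_ndecr//.
by rewrite invr_gt0 subr_gt0.
Qed.

Lemma dweight_cvg alpha t : t < 1 -> dweight alpha n t @[n --> \oo] --> (1 - t) `^ alpha.
Proof.
move=> t1; have x0 : 0 < 1 - t by rewrite subr_gt0.
have : (1 - t) `^ alpha * (1 - wgap n / (1 - t)) @[n --> \oo] --> (1 - t) `^ alpha * (1 - 0 / (1 - t)).
  apply: cvgM; first exact: cvg_cst.
  apply: cvgB; first exact: cvg_cst.
  by apply: cvgM; [exact: wgap_cvg|exact: cvg_cst].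
rewrite mul0r subr0 mulr1; apply: cvg_trans; apply: near_eq_cvg.
have /cvgrPdist_le/(_ _ x0) := wgap_cvg.
apply: filterS => n; rewrite sub0r normrN gtr0_norm ?wgap_gt0// => h.
by rewrite dweightE.
Qed.

Lemma measurable_disc (r : R) : measurable (odisc (0, 0) r : set plane).
Proof. by apply: open_measurable2; exact: open_odisc. Qed.

Lemma disc_sqn_lt1 (z : R * R) : D z -> sqn z < 1.
Proof. by rewrite odisc0 expr1n. Qed.

Lemma measurable_sqn (phi : R -> R) : continuous phi ->
  measurable_fun setT (fun z : plane => phi (sqn z)).
Proof.
move=> cphi; apply: continuousT_measurable2 => w.
by apply: (@continuous_comp _ _ _ (@sqn R) phi); [exact: sqn_continuous|exact: cphi].
Qed.

Lemma integral_weight_disc (rho : R) (omega : R -> R) (g : R * R -> R) : 0 < rho -> rho < 1 ->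
  weight rho omega ->
  (\int[mu2]_z (omega (sqn z) * g z)%:E = \int[mu2]_(z in D) (omega (sqn z) * g z)%:E)%E.
Proof.
move=> rho0 rho1 [_ om0 _]; rewrite [RHS]integral_mkcond; apply: eq_integral => z _.
rewrite patchE; case: ifPn => // /negP; rewrite inE odisc0 => /negP; rewrite -leNgt => h.
rewrite om0 ?mul0r//; apply: le_trans h; rewrite ler_pXn2r ?nnegrE//; exact: ltW.
Qed.

(** The weights [dweight alpha n] increase to [(1 - t) `^ alpha], so an estimate that is
    uniform in [n] passes to the full weight. *)
Lemma exhaust_le (alpha : R) (g : R * R -> R) (B : \bar R) :
  measurable_fun D (g : plane -> R) -> (forall z, 0 <= g z) ->
  (forall n, (\int[mu2]_(z in D) (dweight alpha n (sqn z) * g z)%:E <= B)%E) ->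
  (\int[mu2]_(z in D) ((1 - sqn z) `^ alpha * g z)%:E <= B)%E.
Proof.
move=> mg g0 hB.
have mf n : measurable_fun D (fun z : plane => (dweight alpha n (sqn z) * g z)%:E).
  apply/measurable_EFinP; apply: measurable_funM => //.
  apply: measurable_funTS; apply: measurable_sqn.
  by have [] := dweight_weight alpha n.
have f0 n (z : plane) : D z -> (0 <= (dweight alpha n (sqn z) * g z)%:E)%E.
  by move=> _; rewrite lee_fin mulr_ge0// dweight_ge0.
have fn (z : plane) : D z -> {homo (fun n => (dweight alpha n (sqn z) * g z)%:E) : n m / (n <= m)%N >-> (n <= m)%E}.
  by move=> /disc_sqn_lt1 z1 n m nm; rewrite lee_fin ler_wpM2r// dweight_ndecr.
have := @cvg_monotone_convergence _ _ _ mu2 _ (measurable_disc 1) _ mf f0 fn.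
have -> : (\int[mu2]_(z in D) limn (fun n => (dweight alpha n (sqn z) * g z)%:E) =
   \int[mu2]_(z in D) ((1 - sqn z) `^ alpha * g z)%:E)%E.
  apply: eq_integral => z; rewrite inE => /disc_sqn_lt1 z1; apply: cvg_lim => //.
  apply: cvg_EFin; first exact: nearW.
  by apply: cvgM; [exact: dweight_cvg|exact: cvg_cst].
move=> h; rewrite -(cvg_lim _ h)//; apply: lime_le; first by apply/cvg_ex; eexists; exact: h.
exact: nearW.
Qed.

Lemma continuous_disc_measurable (v : R * R -> R) : (forall w, D w -> {for w, continuous v}) ->
  measurable_fun D (v : plane -> R).
Proof. by move=> cv; apply: continuous_measurable2 => //; exact: open_odisc. Qed.

Lemma measurable_norm_powR (v : R * R -> R) (p : R) : (forall w, D w -> {for w, continuous v}) ->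
  measurable_fun D (fun z : plane => `|v z| `^ p).
Proof.
move=> cv; apply: (measurableT_comp (measurable_powR p)); apply: measurableT_comp => //.
exact: continuous_disc_measurable.
Qed.

Lemma measurable_full_weight (alpha : R) : measurable_fun D (fun z : plane => (1 - sqn z) `^ alpha).
Proof.
apply: (measurableT_comp (measurable_powR alpha)); apply: measurable_funTS.
by apply: (measurable_sqn (phi := fun t => 1 - t)) => t; apply: cvgB; [exact: cvg_cst|exact: cvg_id].
Qed.

(** The weights are exhausted from inside with the constant of [riesz_weight], which does not see
    the weight; hence its independence of [alpha]. *)
Lemma riesz_disc (p : R) : 1 < p -> exists2 C : R, 0 < C &
  forall alpha u ux uy v vx vy,
  harmonic_with D u ux uy -> harmonic_with D v vx vy ->
  (forall w, D w -> vx w ^+ 2 + vy w ^+ 2 <= ux w ^+ 2 + uy w ^+ 2) -> v (0, 0) = 0 ->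
  (\int[mu2]_(z in D) ((1 - sqn z) `^ alpha * `|v z| `^ p)%:E <=
   C%:E * \int[mu2]_(z in D) ((1 - sqn z) `^ alpha * `|u z| `^ p)%:E)%E.
Proof.
move=> p1; have q2 : 1 / 2 < p / 2 by lra.
have [C C0 hC] := riesz_weight q2; exists C => // alpha u ux uy v vx vy hu hv sub v0.
have p2 : 2 * (p / 2) = p by field.
have [cu cv] : (forall w, D w -> {for w, continuous u}) /\ (forall w, D w -> {for w, continuous v}).
  move: hu hv => [? [? [? [? [hu _ _ _]]]]] [? [? [? [? [hv _ _ _]]]]].
  by split => w; [exact: (C1_continuous (@open_odisc _ _ _) hu)|exact: (C1_continuous (@open_odisc _ _ _) hv)].
apply: exhaust_le; first exact: measurable_norm_powR.
  by move=> z; exact: powR_ge0.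
move=> n; have hw := dweight_weight alpha n.
rewrite -(integral_weight_disc _ (wrho_gt0 n) (wrho_lt1 n) hw).
have := hC _ _ _ _ _ _ _ _ (wrho_gt0 n) (wrho_lt1 n) hw hu hv sub v0.
rewrite p2 => h; apply: le_trans h _; apply: lee_wpmul2l; first by rewrite lee_fin ltW.
rewrite (integral_weight_disc _ (wrho_gt0 n) (wrho_lt1 n) hw).
apply: ge0_le_integral; first exact: measurable_disc.
- by move=> z _; rewrite lee_fin mulr_ge0 ?powR_ge0// dweight_ge0.
- apply/measurable_EFinP; apply: measurable_funM; last exact: measurable_norm_powR.
  by apply: measurable_funTS; apply: measurable_sqn; have [] := hw.
- apply/measurable_EFinP; apply: measurable_funM; last exact: measurable_norm_powR.
  exact: measurable_full_weight.
- by move=> z /disc_sqn_lt1 z1; rewrite lee_fin ler_wpM2r ?powR_ge0// dweight_le.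
Qed.

End disc_weights.

(** * Translation invariance of the planar Lebesgue integral *)

Section translation.
Context {R : realType}.
Local Notation mR := (measurableTypeR R).
Local Notation plane := (mR * mR)%type.
Local Notation mu := (@lebesgue_measure R).
Local Notation mu2 := (@lebesgue_measure R \x @lebesgue_measure R)%E.

Lemma measurable_shift1 (a : R) : measurable_fun setT (fun x : mR => a + x : mR).
Proof. exact: measurable_funD. Qed.

Lemma lebesgue_shift (a : R) (A : set mR) : measurable A ->
  mu [set x | A (a + x)] = mu A.
Proof.
move=> mA; apply/esym.
pose m' := measure_function_pushforward__canonical__measure_function_Measure mu (measurable_shift1 a).
apply: (@lebesgue_measure_unique R m') => // X [[b c] _ <-] /=.
rewrite /pushforward (_ : _ @^-1` _ = `]b - a, c - a]%classic); last first.
  by apply/seteqP; split => x /=; rewrite !in_itv/= ltrBlDl lerBrDl.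
rewrite !lebesgue_measure_itv/= !lte_fin ltrD2r; case: ifP => // _.
by rewrite -!EFinD; congr (_%:E); ring.
Qed.

Definition shift2 (a : R * R) (z : plane) : plane := (a.1 + z.1, a.2 + z.2).

Lemma measurable_shift2 a : measurable_fun setT (shift2 a).
Proof.
apply/measurable_fun_pairP; split.
  by apply: (measurableT_comp (measurable_shift1 a.1)); exact: measurable_fst.
by apply: (measurableT_comp (measurable_shift1 a.2)); exact: measurable_snd.
Qed.

(** Both measures agree on rectangles, and product measures are determined there. *)
Lemma plane_shift a (X : set plane) : measurable X -> mu2 (shift2 a @^-1` X) = mu2 X.
Proof.
move=> mX; apply/esym.
pose m' := measure_function_pushforward__canonical__measure_function_Measure mu2 (measurable_shift2 a).
apply: (product_measure_unique (m' := m')) => // A B mA mB /=; rewrite /pushforward.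
rewrite (_ : _ @^-1` _ = [set x | A (a.1 + x)] `*` [set y | B (a.2 + y)]); last by [].
have mm (c : R) (E : set mR) : measurable E -> measurable ([set x | E (c + x)] : set mR).
  by move=> mE; have := measurable_shift1 c measurableT mE; rewrite setTI.
rewrite product_measure1E; [|exact: (mm _ A)|exact: (mm _ B)].
by congr (_ * _)%E; exact: lebesgue_shift.
Qed.

Lemma ge0_integral_shift (a : R * R) (f : plane -> \bar R) : measurable_fun setT f ->
  (forall z, 0 <= f z)%E -> (\int[mu2]_z f (shift2 a z) = \int[mu2]_z f z)%E.
Proof.
move=> mf f0.
have := @ge0_integral_pushforward _ _ _ _ _ _ (measurable_shift2 a) mu2 setT f measurableT mf (fun y _ => f0 y).
rewrite preimage_setT /comp => <-.
apply: eq_measure_integral; first exact: measurable_shift2.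
by move=> mf' A mA _; exact: (plane_shift a mA).
Qed.

Lemma integrable_shift (a : R * R) (f : R * R -> R) : mu2.-integrable setT (EFin \o f) ->
  mu2.-integrable setT (EFin \o (fun z => f (shift2 a z))).
Proof.
move=> fi; have /integrableP[mf fb] := fi; apply/integrableP; split.
  exact: (measurableT_comp mf (measurable_shift2 a)).
have ma : measurable_fun setT (fun z : plane => `|(EFin \o f) z|)%E.
  by apply: measurableT_comp mf.
have h := @ge0_integral_shift a (fun z => `|(EFin \o f) z|)%E ma (fun _ => abse_ge0 _).
exact: (eq_ind_r (fun x => (x < +oo)%E) fb h).
Qed.

Lemma Rintegral_shift (a : R * R) (f : R * R -> R) : mu2.-integrable setT (EFin \o f) ->
  \int[mu2]_z f (shift2 a z) = \int[mu2]_z f z.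
Proof.
move=> fi; have /measurable_int mf := fi.
have := @integral_pushforward _ _ _ _ _ _ (measurable_shift2 a) mu2 setT (EFin \o f) mf.
rewrite preimage_setT => /(_ (integrable_shift a fi) measurableT) h.
have e : (\int[pushforward mu2 (shift2 a)]_y (EFin \o f) y = \int[mu2]_y (EFin \o f) y)%E.
  apply: eq_measure_integral; first exact: measurable_shift2.
  by move=> mf' A mA _; exact: (plane_shift a mA).
exact: (congr1 fine (etrans (esym h) e)).
Qed.

End translation.

(** * Local estimates for harmonic functions *)

Section euclidean.
Context {R : realType}.
Implicit Types w z : R * R.

Definition nrm w : R := Num.sqrt (sqn w).
Definition pdist w z : R := nrm (w.1 - z.1, w.2 - z.2).

Lemma nrm_ge0 w : 0 <= nrm w. Proof. exact: sqrtr_ge0. Qed.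
Lemma nrm_sqr w : nrm w ^+ 2 = sqn w. Proof. by rewrite sqr_sqrtr// sqn_ge0. Qed.

Lemma nrm_lt w r : 0 <= r -> (nrm w < r) = (sqn w < r ^+ 2).
Proof. by move=> r0; rewrite -nrm_sqr ltr_pXn2r ?nnegrE ?nrm_ge0. Qed.

Lemma nrm_le w r : 0 <= r -> (nrm w <= r) = (sqn w <= r ^+ 2).
Proof. by move=> r0; rewrite -nrm_sqr ler_pXn2r ?nnegrE ?nrm_ge0. Qed.

Lemma nrm_triangle (a b c d : R) : nrm (a + c, b + d) <= nrm (a, b) + nrm (c, d).
Proof.
rewrite nrm_le ?addr_ge0 ?nrm_ge0// sqrrD !nrm_sqr /sqn/=.
suff : a * c + b * d <= nrm (a, b) * nrm (c, d) by rewrite mulr2n; lra.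
apply: le_trans (ler_norm _) _.
rewrite -(@ler_pXn2r _ 2) ?nnegrE ?mulr_ge0 ?nrm_ge0// real_normK ?num_real//.
rewrite exprMn !nrm_sqr /sqn/=; have := sqr_ge0 (a * d - b * c).
by rewrite sqrrB !sqrrD !exprMn; lra.
Qed.

Lemma pdist_triangle w z x : pdist w x <= pdist w z + pdist z x.
Proof.
apply: le_trans (nrm_triangle _ _ _ _).
by rewrite /pdist !addrA !subrK.
Qed.

Lemma pdist_sym w z : pdist w z = pdist z w.
Proof. by rewrite /pdist /nrm /sqn/= -sqrrN opprB -[(w.2 - _) ^+ 2]sqrrN opprB. Qed.

Lemma pdist_ge0 w z : 0 <= pdist w z. Proof. exact: nrm_ge0. Qed.

Lemma pdistxx w : pdist w w = 0.
Proof. by rewrite /pdist !subrr /nrm /sqn/= expr0n/= addr0 sqrtr0. Qed.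

Lemma pdist0 w : pdist w (0, 0) = nrm w.
Proof. by rewrite /pdist !subr0 -surjective_pairing. Qed.

Lemma odiscE z r w : 0 <= r -> odisc z r w = (pdist w z < r) :> Prop.
Proof. by move=> r0; rewrite /odisc/= /pdist nrm_lt. Qed.

Lemma nrm_fst w : `|w.1| <= nrm w.
Proof.
by rewrite -(@ler_pXn2r _ 2) ?nnegrE ?nrm_ge0// real_normK ?num_real// nrm_sqr lerDl sqr_ge0.
Qed.

Lemma nrm_snd w : `|w.2| <= nrm w.
Proof.
by rewrite -(@ler_pXn2r _ 2) ?nnegrE ?nrm_ge0// real_normK ?num_real// nrm_sqr lerDr sqr_ge0.
Qed.

Lemma pdist_fst w z : `|w.1 - z.1| <= pdist w z. Proof. exact: (nrm_fst (_, _)). Qed.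
Lemma pdist_snd w z : `|w.2 - z.2| <= pdist w z. Proof. exact: (nrm_snd (_, _)). Qed.

Lemma pdist_shift (a z : R * R) : pdist (line a 1 z) a = nrm z.
Proof. by rewrite /pdist /line/= !mul1r ![_ + _ - _]addrAC !subrr !add0r -surjective_pairing. Qed.

End euclidean.

Section local_estimates.
Context {R : realType}.
Local Notation mR := (measurableTypeR R).
Local Notation plane := (mR * mR)%type.
Local Notation mu2 := (@lebesgue_measure R \x @lebesgue_measure R)%E.

Lemma C1_sub (A B : set (R * R)) f fx fy : B `<=` A -> C1 A f fx fy -> C1 B f fx fy.
Proof. by move=> BA h w /BA; exact: h. Qed.

Lemma harmonic_sub (A B : set (R * R)) u ux uy : B `<=` A -> harmonic_with A u ux uy -> harmonic_with B u ux uy.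
Proof.
move=> BA [uxx [uxy [uyx [uyy [h1 h2 h3 h4]]]]]; exists uxx, uxy, uyx, uyy; split.
- exact: C1_sub h1.
- exact: C1_sub h2.
- exact: C1_sub h3.
- by move=> w /BA; exact: h4.
Qed.

Lemma harmonic_continuous (z w : R * R) (r : R) (u ux uy : R * R -> R) : harmonic_with (odisc z r) u ux uy -> odisc z r w ->
  {for w, continuous u}.
Proof. by move=> [? [? [? [? [h _ _ _]]]]]; exact: (C1_continuous (@open_odisc _ _ _) h). Qed.

(** A radial weight which, as a function of [sqn], is Lipschitz; that makes averages of a bounded
    function depend on the centre in a Lipschitz way. *)
Definition cone (s t : R) : R := Num.max 0 (s ^+ 2 - t).

Lemma cone_weight s : weight s (cone s).
Proof.
split.
- move=> t; have := @continuous_max R R (cst 0) (fun t : R => s ^+ 2 - t) t.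
  by apply; [exact: cvg_cst|apply: cvgB; [exact: cvg_cst|exact: cvg_id]].
- by move=> t h; apply/max_idPl; rewrite subr_le0.
- by move=> t; rewrite le_max lexx.
Qed.

Lemma cone_lip s a b : `|cone s a - cone s b| <= `|a - b|.
Proof.
have n1 := ler_norm (a - b); have n2 := ler_norm (b - a); rewrite distrC in n2.
have [h1|h1] := leP 0 (s ^+ 2 - a); have [h2|h2] := leP 0 (s ^+ 2 - b);
  rewrite /cone ?(max_idPr h1) ?(max_idPl (ltW h1)) ?(max_idPr h2) ?(max_idPl (ltW h2));
  rewrite ler_norml; apply/andP; split; lra.
Qed.

Lemma cone_le s t : 0 <= t -> cone s t <= s ^+ 2.
Proof. by move=> t0; rewrite ge_max sqr_ge0 gerBl. Qed.

Definition cmass (s : R) : R := \int[mu2]_z cone s (sqn z).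

Lemma box_measure b : 0 <= b -> fine (mu2 (box b)) = (2 * b) ^+ 2.
Proof.
move=> b0; rewrite product_measure1E//= lebesgue_measure_itv/= lte_fin.
case: ltP => h; first by rewrite -EFinB -EFinM/=; ring.
have -> : b = 0 by lra.
by rewrite mule0/= mulr0 expr0n.
Qed.

Lemma integrable_box_cst (b M : R) : mu2.-integrable setT (EFin \o (fun z : R * R => M * \1_(box b) z)).
Proof.
apply: (@integrable_bounded_box _ _ b `|M|).
- apply: measurable_funM => //; exact: measurable_indic (measurable_box b).
- move=> w; rewrite normrM indicE; case: (_ \in _) => /=; rewrite ?normr1 ?mulr1//.
  by rewrite normr0 mulr0.
- by move=> w bw; rewrite indicE memNset// mulr0.
Qed.

Lemma Rintegral_box_cst (b M : R) : 0 <= b ->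
  \int[mu2]_z (M * \1_(box b) z) = M * (2 * b) ^+ 2.
Proof.
move=> b0; rewrite -box_measure// -Rintegral_cst; last exact: measurable_box.
rewrite [RHS]Rintegral_mkcond; apply: eq_Rintegral => z _.
by rewrite patchE indicE; case: (_ \in _); rewrite ?mulr1 ?mulr0.
Qed.

Lemma le_Rintegral_box (f : R * R -> R) (b M : R) : 0 <= b -> mu2.-integrable setT (EFin \o f) ->
  (forall w, `|f w| <= M) -> (forall w, ~ box b w -> f w = 0) ->
  `|\int[mu2]_z f z| <= M * (2 * b) ^+ 2.
Proof.
move=> b0 fi fM f0; rewrite -Rintegral_box_cst//.
apply: le_trans (le_normr_Rintegral _ fi) _ => //.
apply: le_Rintegral => //; [exact: integrable_norm|exact: integrable_box_cst|].
move=> w _; rewrite indicE; have [bw|bw] := pselect (box b w).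
  by rewrite mem_set// mulr1.
by rewrite f0// normr0 memNset// mulr0.
Qed.

Lemma cone_integrable (s r : R) (g : R * R -> R) : 0 < s -> s < r ->
  (forall w, sqn w < r ^+ 2 -> {for w, continuous g}) ->
  mu2.-integrable setT (EFin \o (fun w => cone s (sqn w) * g w)).
Proof. by move=> s0 sr cg; apply: (weight_integrable s0 sr (cone_weight s)). Qed.

Lemma cone1_integrable (s : R) : 0 < s -> mu2.-integrable setT (EFin \o (fun w => cone s (sqn w))).
Proof.
move=> s0; rewrite (_ : (fun w => _) = (fun w => cone s (sqn w) * 1)); last first.
  by apply/funext => w; rewrite mulr1.
by apply: (cone_integrable (r := s + 1)) => //; [rewrite ltrDl|move=> w _; exact: cvg_cst].
Qed.

Lemma cmass_ge (s : R) : 0 < s -> s ^+ 4 / 2 <= cmass s.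
Proof.
move=> s0; have s2 : 0 <= s / 2 by rewrite divr_ge0// ltW.
have -> : s ^+ 4 / 2 = s ^+ 2 / 2 * (2 * (s / 2)) ^+ 2 by field.
rewrite -(Rintegral_box_cst _ s2); apply: le_Rintegral => //.
- exact: integrable_box_cst.
- exact: cone1_integrable.
move=> z _; rewrite indicE; have [bz|bz] := pselect (box (s / 2) z); last first.
  by rewrite memNset// mulr0 le_max lexx.
rewrite mem_set// mulr1 le_max; apply/orP; right.
have h x : `[- (s / 2), s / 2]%classic x -> x ^+ 2 <= s ^+ 2 / 4.
  rewrite /= in_itv/= -ler_norml -[x ^+ 2]real_normK ?num_real// => hx.
  by rewrite (_ : s ^+ 2 / 4 = (s / 2) ^+ 2) ?ler_pXn2r ?nnegrE//; field.
by case: bz => /h h1 /h h2; rewrite /sqn; lra.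
Qed.

Lemma cmass_gt0 (s : R) : 0 < s -> 0 < cmass s.
Proof. by move=> s0; apply: lt_le_trans (cmass_ge s0); rewrite divr_gt0// exprn_gt0. Qed.

Lemma C1_opp (D : set (R * R)) (f fx fy : R * R -> R) : C1 D f fx fy ->
  C1 D (fun w => - f w) (fun w => - fx w) (fun w => - fy w).
Proof.
move=> hf w Dw; have [a1 a2 a3 a4] := hf w Dw.
by split; [exact: is_deriveN|exact: is_deriveN|exact: cvgN|exact: cvgN].
Qed.

(** Both [u] and [- u] satisfy the sub-mean value inequality. *)
Lemma harmonic_mean (z0 : R * R) (s r : R) (u ux uy : R * R -> R) : 0 < s -> s < r ->
  harmonic_with (odisc z0 r) u ux uy ->
  u z0 * cmass s = \int[mu2]_z (cone s (sqn z) * u (line z0 1 z)).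
Proof.
move=> s0 sr [uxx [uxy [uyx [uyy [h1 h2 h3 h4]]]]]; apply/le_anti/andP; split.
  by apply: (submean s0 sr (cone_weight s) h1 h2 h3) => w Dw; rewrite h4.
have := submean s0 sr (cone_weight s) (C1_opp h1) (C1_opp h2) (C1_opp h3).
rewrite (_ : \int[mu2]_z (cone s (sqn z) * - u (line z0 1 z)) =
  - \int[mu2]_z (cone s (sqn z) * u (line z0 1 z))).
  rewrite mulNr lerN2; apply => w Dw.
  by rewrite -opprD h4// oppr0.
rewrite -[RHS]mulN1r -RintegralZl//; first by apply: eq_Rintegral => z _; ring.
apply: (cone_integrable s0 sr) => w wr; apply: line_continuous.
apply: (C1_continuous (@open_odisc R z0 r) h1).
by rewrite /odisc/= /line/= !mul1r ![_ + _ - _]addrAC !subrr !add0r -surjective_pairing.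
Qed.

Lemma derive_lip (g : R -> R) (t dg d L : R) : 0 < d -> is_derive t 1 g dg ->
  (forall s, `|s - t| < d -> `|g s - g t| <= L * `|s - t|) -> `|dg| <= L.
Proof.
move=> d0 /is_derive_slope[G [cG <- hG]] lip; rewrite leNgt; apply/negP => LG.
have LG0 : 0 < `|G t| - L by rewrite subr_gt0.
have /cvgrPdist_lt/(_ _ LG0)/nbhs_ballP[e /= e0 he] := cG.
pose m := Num.min d e / 2; have me0 : 0 < Num.min d e by rewrite lt_min d0.
have m0 : 0 < m by rewrite divr_gt0.
have [md me] : m < d /\ m < e.
  have : m < Num.min d e by rewrite /m; lra.
  by rewrite lt_min => /andP.
have tm : `|t + m - t| = m by rewrite addrAC subrr add0r gtr0_norm.
have h1 : `|G (t + m)| <= L.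
  have := lip (t + m); rewrite tm hG normrM tm => /(_ md).
  by rewrite ler_pM2r.
have := he (t + m); rewrite /ball/= distrC tm => /(_ me) h2.
have : `|G t| <= `|G t - G (t + m)| + `|G (t + m)|.
  by apply: le_trans (ler_normD _ _); rewrite subrK.
lra.
Qed.

(** By the mean value property and translation invariance, the difference of the two values of
    [u] is an integral of [u] against a difference of two cones, which is small because the cone
    is Lipschitz. *)
Lemma harmonic_lip (z0 c : R * R) (r S : R) (u ux uy : R * R -> R) : 0 < r ->
  harmonic_with (odisc z0 r) u ux uy -> (forall w, odisc z0 r w -> `|u w| <= S) ->
  nrm c < r / 4 -> `|u (shift2 z0 c) - u z0| <= 144 * S / r * nrm c.
Proof.
move=> r0 hu uS cr; pose s := r / 2.
have s0 : 0 < s by rewrite divr_gt0.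
have s34 : s < 3 / 4 * r by rewrite /s; lra.
have r34 : 3 / 4 * r < r by lra.
have c0 := nrm_ge0 c.
have S0 : 0 <= S.
  by apply: le_trans (uS z0 _); rewrite ?normr_ge0// odiscE ?(ltW r0)// pdistxx.
have dc : pdist (shift2 z0 c) z0 = nrm c.
  by rewrite /pdist /shift2/= ![_ + _ - _]addrAC !subrr !add0r -surjective_pairing.
have sub1 : odisc (shift2 z0 c) (3 / 4 * r) `<=` odisc z0 r.
  move=> w; rewrite !odiscE//; [|lra|lra] => h.
  by apply: le_lt_trans (pdist_triangle w (shift2 z0 c) z0) _; rewrite dc; lra.
have sub2 : odisc z0 (3 / 4 * r) `<=` odisc z0 r.
  by move=> w; rewrite !odiscE//; [|lra|lra] => h; apply: lt_trans r34.
have m1 := harmonic_mean s0 s34 (harmonic_sub sub1 hu).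
have m2 := harmonic_mean s0 s34 (harmonic_sub sub2 hu).
pose G z := cone s (sqn z) * u (line (shift2 z0 c) 1 z).
pose G0 z := cone s (sqn z) * u (line z0 1 z).
have li (a : R * R) : odisc a (3 / 4 * r) `<=` odisc z0 r ->
    mu2.-integrable setT (EFin \o (fun z => cone s (sqn z) * u (line a 1 z))).
  move=> sa; apply: (cone_integrable s0 s34) => w wr; apply: line_continuous.
  apply: (harmonic_continuous hu); apply: sa.
  by rewrite odiscE ?pdist_shift ?nrm_lt//; lra.
have iG : mu2.-integrable setT (EFin \o G) by exact: li sub1.
have iG0 : mu2.-integrable setT (EFin \o G0) by exact: li sub2.
pose nc : R * R := (- c.1, - c.2).
have m1' := Rintegral_shift nc iG.
have is1 := integrable_shift nc iG.
have GE z : G (shift2 nc z) = cone s (sqn (z.1 - c.1, z.2 - c.2)) * u (line z0 1 z).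
  rewrite /G /shift2/= [- c.1 + _]addrC [- c.2 + _]addrC; congr (_ * u _).
  by rewrite /line/=; congr (_, _); ring.
have fb w : `|G (shift2 nc w) - G0 w| <= 2 * r * nrm c * S.
  rewrite GE /G0 -mulrBl.
  have tri1 := pdist_triangle w c (0, 0); have tri2 := pdist_triangle w (0, 0) c.
  rewrite [pdist (0, 0) c]pdist_sym !pdist0 in tri1 tri2.
  have n0 := nrm_ge0 w; have p0 := pdist_ge0 w c.
  have Z0 : 0 <= 2 * r * nrm c * S by rewrite !mulr_ge0// ltW.
  have [big|small] := leP (3 / 4 * r) (nrm w).
    have z1 : cone s (sqn w) = 0.
      have [_ h _] := cone_weight s; apply: h.
      by rewrite -nrm_sqr ler_pXn2r ?nnegrE ?(ltW s0)//; lra.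
    have z2 : cone s (sqn (w.1 - c.1, w.2 - c.2)) = 0.
      have [_ h _] := cone_weight s; apply: h.
      by rewrite -nrm_sqr -/(pdist w c) ler_pXn2r ?nnegrE ?(ltW s0)// /s; lra.
    by rewrite z1 z2 subrr mul0r normr0.
  rewrite normrM; apply: ler_pM => //.
    apply: le_trans (cone_lip _ _ _) _; rewrite -!nrm_sqr -/(pdist w c) subr_sqr normrM.
    have -> : 2 * r * nrm c = nrm c * (2 * r) by ring.
    apply: ler_pM => //; first by rewrite ler_norml; apply/andP; split; lra.
    by rewrite ger0_norm; lra.
  by apply: uS; rewrite odiscE ?pdist_shift//; lra.
have f0 w : ~ box (3 / 4 * r) w -> G (shift2 nc w) - G0 w = 0.
  move=> /sqn_box h; have {}h : 3 / 4 * r <= nrm w.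
    by rewrite leNgt nrm_lt -?leNgt ?h//; lra.
  have tri2 := pdist_triangle w c (0, 0); rewrite !pdist0 in tri2.
  have [_ hc _] := cone_weight s.
  rewrite GE /G0 !hc ?mul0r ?subrr//.
    by rewrite -nrm_sqr ler_pXn2r ?nnegrE ?(ltW s0) ?nrm_ge0//; lra.
  by rewrite -nrm_sqr -/(pdist w c) ler_pXn2r ?nnegrE ?(ltW s0) ?pdist_ge0// /s; lra.
have iD : mu2.-integrable setT (EFin \o (fun z => G (shift2 nc z) - G0 z)).
  by rewrite (_ : _ \o _ = (EFin \o (fun z => G (shift2 nc z))) \- (EFin \o G0))%E//; exact: integrableB.
have r34' : 0 <= 3 / 4 * r by lra.
have := le_Rintegral_box r34' iD fb f0.
rewrite RintegralB// m1' -/(G) -m1 -m2 -mulrBl normrM (gtr0_norm (cmass_gt0 s0)) => h.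
have cm := cmass_ge s0.
have : `|u (shift2 z0 c) - u z0| * (s ^+ 4 / 2) <= 2 * r * nrm c * S * (2 * (3 / 4 * r)) ^+ 2.
  by apply: le_trans h; rewrite ler_wpM2l.
have -> : s ^+ 4 / 2 = r ^+ 4 / 32 by rewrite /s; field.
rewrite -ler_pdivlMr ?divr_gt0 ?exprn_gt0// => h'; apply: le_trans h' _.
by rewrite le_eqVlt; apply/orP; left; apply/eqP; field; rewrite gt_eqF.
Qed.

Lemma harmonic_grad (z0 : R * R) (r S : R) (u ux uy : R * R -> R) : 0 < r ->
  harmonic_with (odisc z0 r) u ux uy -> (forall w, odisc z0 r w -> `|u w| <= S) ->
  `|ux z0| <= 144 * S / r /\ `|uy z0| <= 144 * S / r.
Proof.
move=> r0 hu uS; have r4 : 0 < r / 4 by rewrite divr_gt0.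
have [uxx [uxy [uyx [uyy [h1 _ _ _]]]]] := hu.
have Dz : odisc z0 r z0 by rewrite odiscE ?(ltW r0)// pdistxx.
have [dx dy _ _] := h1 z0 Dz.
have nx (x : R) : nrm (x, 0) = `|x| by rewrite /nrm /sqn/= expr0n/= addr0 sqrtr_sqr.
have ny (x : R) : nrm (0, x) = `|x| by rewrite /nrm /sqn/= expr0n/= add0r sqrtr_sqr.
split.
  apply: (derive_lip r4 dx) => x hx; rewrite -surjective_pairing.
  have := @harmonic_lip z0 (x - z0.1, 0) r S u ux uy r0 hu uS; rewrite nx => /(_ hx).
  by rewrite /shift2/= addr0 [z0.1 + _]addrC subrK.
apply: (derive_lip r4 dy) => x hx; rewrite -surjective_pairing.
have := @harmonic_lip z0 (0, x - z0.2) r S u ux uy r0 hu uS; rewrite ny => /(_ hx).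
by rewrite /shift2/= addr0 [z0.2 + _]addrC subrK.
Qed.

End local_estimates.

Section local_subharmonic.
Context {R : realType}.
Local Notation mR := (measurableTypeR R).
Local Notation plane := (mR * mR)%type.
Local Notation mu2 := (@lebesgue_measure R \x @lebesgue_measure R)%E.

Lemma norm_powR_interp (x c p : R) : 0 < p -> p <= 1 -> 0 <= x -> x <= c -> x <= x `^ p * c `^ (1 - p).
Proof.
move=> p0 p1; rewrite le_eqVlt => /orP[/eqP <- _|x0 xc].
  by rewrite mulr_ge0 ?powR_ge0.
rewrite -{1}(@powRr1 _ x) ?(ltW x0)//.
rewrite (_ : x `^ 1 = x `^ p * x `^ (1 - p)); last first.
  by rewrite -powRD ?subrKC// (gt_eqF x0) implybT.
rewrite ler_wpM2l ?powR_ge0//; apply: ge0_ler_powR; rewrite ?nnegrE ?subr_ge0 ?(ltW x0)//.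
exact: ltW (lt_le_trans x0 xc).
Qed.

Lemma open_odisc_measurable (z : R * R) r : measurable (odisc z r : set plane).
Proof. by apply: open_measurable2; exact: open_odisc. Qed.

(** For [p < 1] the function [|u|^p] is not subharmonic, and the inequality rests on a maximum
    argument: choose [w0] almost maximizing [(r - |w - z0|)^(2/p) |u(w)|]. On the disc of half
    the remaining radius around [w0], [|u|] is at most a constant [c] times its value [U] at
    [w0]. The mean value property there, with [|u| <= |u|^p (c U)^(1-p)], bounds
    [U^p] by the integral of [|u|^p], and the choice of [w0] transfers the bound to [z0]. *)
Lemma subharmonic_powR (p : R) : 0 < p -> p <= 1 -> exists2 C : R, 0 < C &
  forall (z0 : R * R) (r r' : R) (u ux uy : R * R -> R), 0 < r -> r < r' ->
    harmonic_with (odisc z0 r') u ux uy ->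
    ((r ^+ 2 * `|u z0| `^ p)%:E <= C%:E * \int[mu2]_(w in odisc z0 r) (`|u w| `^ p)%:E)%E.
Proof.
move=> p0 p1; pose c : R := 2 * 2 `^ (2 / p).
have c0 : 0 < c by rewrite mulr_gt0// powR_gt0.
have C0 : 0 < 2 `^ p * (32 * c `^ (1 - p)) by rewrite !mulr_gt0// powR_gt0.
exists (2 `^ p * (32 * c `^ (1 - p))) => // z0 r r' u ux uy r0 rr' hu.
have pn0 : p != 0 by rewrite gt_eqF.
have r'0 : 0 < r' by apply: lt_trans rr'.
set I := (\int[mu2]_(w in _) _)%E.
have I0 : (0 <= I)%E by apply: integral_ge0 => w _; rewrite lee_fin powR_ge0.
have [uz|uz] := eqVneq (u z0) 0.
  by rewrite uz normr0 powR0// mulr0 mule_ge0// lee_fin ltW.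
have cu w : odisc z0 r' w -> {for w, continuous u} by exact: (harmonic_continuous hu).
have [N hN] : exists N, forall w, odisc z0 r w -> `|u w| <= N.
  have [|N hN] := @bounded_on_disc R (fun w => u (line z0 1 w)) r r' r0 rr'.
    move=> w wr; apply: line_continuous; apply: cu.
    by rewrite odiscE ?pdist_shift ?nrm_lt// ltW.
  exists N => w; rewrite odiscE ?(ltW r0)// => wr.
  have := hN (w.1 - z0.1, w.2 - z0.2); rewrite /line/= !mul1r !subrKC -surjective_pairing.
  by apply; rewrite -nrm_le ?(ltW r0)// ltW.
pose m w := (r - pdist w z0) `^ (2 / p) * `|u w|.
pose E := [set m w | w in odisc z0 r].
have z0r : odisc z0 r z0 by rewrite odiscE ?(ltW r0)// pdistxx.
have mz0 : m z0 = r `^ (2 / p) * `|u z0| by rewrite /m pdistxx subr0.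
have mz0_gt0 : 0 < m z0 by rewrite mz0 mulr_gt0 ?powR_gt0// normr_gt0.
have hE : has_sup E.
  split; first by exists (m z0); exists z0.
  exists (r `^ (2 / p) * N) => _ [w wr <-]; apply: ler_pM; rewrite ?powR_ge0//; last exact: hN.
  apply: ge0_ler_powR; rewrite ?nnegrE ?divr_ge0 ?(ltW p0) ?(ltW r0)//.
    by move: wr; rewrite odiscE ?(ltW r0)// subr_ge0 => /ltW.
  by rewrite gerBl pdist_ge0.
have mle w : odisc z0 r w -> m w <= sup E.
  by move=> wr; apply: sup_upper_bound => //; exists w.
have S0 : 0 < sup E by apply: lt_le_trans (mle _ z0r).
have [|_ [w0 w0r <-] mw0] := @sup_adherent _ E (sup E / 2) _ hE; first by rewrite divr_gt0.
have {}mw0 : sup E < 2 * m w0 by lra.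
pose d := r - pdist w0 z0.
have d0 : 0 < d by rewrite subr_gt0; move: w0r; rewrite odiscE ?(ltW r0).
have U0 : 0 < `|u w0|.
  rewrite normr_gt0; apply/eqP => u0; move: mw0; rewrite /m u0 normr0 !mulr0.
  by move/(lt_trans S0); rewrite ltxx.
set U := `|u w0| in U0.
have dr w : pdist w w0 < d / 2 -> d / 2 <= r - pdist w z0.
  by move=> h; have := pdist_triangle w w0 z0; rewrite /d in h *; lra.
have inr w : pdist w w0 < d / 2 -> odisc z0 r w.
  by move=> /dr h; rewrite odiscE ?(ltW r0)//; lra.
have uU w : pdist w w0 < d / 2 -> `|u w| <= c * U.
  move=> h; have := le_lt_trans (mle _ (inr _ h)) mw0; rewrite /m -/d -/U => {}mw0.
  have dp : 0 < (d / 2) `^ (2 / p) by rewrite powR_gt0// divr_gt0.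
  have : (d / 2) `^ (2 / p) * `|u w| <= (d / 2) `^ (2 / p) * (c * U).
    apply: le_trans (_ : (r - pdist w z0) `^ (2 / p) * `|u w| <= _).
      rewrite ler_wpM2r//; apply: ge0_ler_powR; rewrite ?nnegrE ?divr_ge0 ?(ltW p0) ?(ltW d0)//.
        by apply: le_trans (dr _ h); rewrite divr_ge0// ltW.
      exact: dr.
    apply: ltW; apply: lt_le_trans mw0 _; rewrite le_eqVlt; apply/orP; left; apply/eqP.
    have -> : (d / 2) `^ (2 / p) * (c * U) = 2 * ((d / 2) `^ (2 / p) * 2 `^ (2 / p) * U) by rewrite /c; ring.
    by rewrite -powRM ?divr_ge0 ?(ltW d0)// divfK.
  by rewrite ler_pM2l.
pose s := d / 4; have s0 : 0 < s by rewrite divr_gt0.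
have sd : s < d / 2 by rewrite /s; lra.
have d20 : 0 <= d / 2 by rewrite divr_ge0// ltW.
have hu0 : harmonic_with (odisc w0 (d / 2)) u ux uy.
  apply: harmonic_sub hu => w; rewrite odiscE// => /inr.
  by rewrite !odiscE ?(ltW r0) ?(ltW r'0)// => /lt_trans; apply.
have hm := harmonic_mean s0 sd hu0.
have iu : mu2.-integrable setT (EFin \o (fun z => cone s (sqn z) * u (line w0 1 z))).
  apply: (cone_integrable s0 sd) => w wr; apply: line_continuous.
  by apply: (harmonic_continuous hu0); rewrite odiscE ?pdist_shift ?nrm_lt.
pose Psi : plane -> \bar R := (fun w => (`|u w| `^ p)%:E) \_ (odisc z0 r).
have mPsi : measurable_fun setT Psi.
  apply/(measurable_restrictT _ (open_odisc_measurable z0 r)); apply/measurable_EFinP.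
  apply: (measurableT_comp (measurable_powR p)); apply: measurableT_comp => //.
  apply: continuous_measurable2; first exact: open_odisc.
  move=> w; rewrite odiscE ?(ltW r0)// => wr; apply: cu.
  by rewrite odiscE ?(ltW r'0)// (lt_trans wr).
have Psi0 z : (0 <= Psi z)%E.
  by rewrite /Psi patchE; case: ifP => // _; rewrite lee_fin powR_ge0.
have key : ((U * cmass s)%:E <= (s ^+ 2 * (c * U) `^ (1 - p))%:E * I)%E.
  have -> : U * cmass s = `|\int[mu2]_z (cone s (sqn z) * u (line w0 1 z))|.
    by rewrite -hm normrM (gtr0_norm (cmass_gt0 s0)).
  apply: (@le_trans _ _ (\int[mu2]_z `|cone s (sqn z) * u (line w0 1 z)|)%:E).
    by rewrite lee_fin; apply: le_normr_Rintegral.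
  rewrite EFin_Rintegral; last exact: integrable_norm.
  have -> : I = (\int[mu2]_z Psi (shift2 w0 z))%E.
    by rewrite (ge0_integral_shift w0 mPsi Psi0) /I integral_mkcond.
  have k0 : 0 <= s ^+ 2 * (c * U) `^ (1 - p) by rewrite mulr_ge0 ?sqr_ge0 ?powR_ge0.
  have mPs : measurable_fun setT (fun z : plane => Psi (shift2 w0 z)).
    exact: (measurableT_comp mPsi (measurable_shift2 w0)).
  rewrite -ge0_integralZl_EFin//.
  apply: ge0_le_integral => //.
  - by apply/measurable_EFinP; apply: measurableT_comp => //; apply/measurable_EFinP; exact: measurable_int iu.
  - by apply: emeasurable_funM.
  move=> z _; have [_ cs0 cs1] := cone_weight s.
  have [big|small] := leP (s ^+ 2) (sqn z).
    by rewrite cs0// mul0r normr0 mule_ge0.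
  have zs : pdist (shift2 w0 z) w0 < d / 2.
    apply: lt_trans sd; have -> : shift2 w0 z = line w0 1 z by rewrite /line !mul1r.
    by rewrite pdist_shift nrm_lt// ltW.
  rewrite /Psi patchE mem_set; last exact: inr.
  have -> : line w0 1 z = shift2 w0 z by rewrite /line !mul1r.
  rewrite -EFinM lee_fin normrM ger0_norm// -mulrA.
  apply: ler_pM => //; first by apply: cone_le; exact: sqn_ge0.
  by rewrite mulrC; apply: norm_powR_interp => //; exact: uU.
have main : r ^+ 2 * `|u z0| `^ p <= 2 `^ p * (d ^+ 2 * U `^ p).
  have sq (x : R) : 0 <= x -> (x `^ (2 / p)) `^ p = x ^+ 2.
    by move=> x0; rewrite -powRrM divfK// powR_mulrn.
  have -> : r ^+ 2 * `|u z0| `^ p = (m z0) `^ p.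
    by rewrite mz0 powRM ?powR_ge0// sq// ltW.
  have -> : 2 `^ p * (d ^+ 2 * U `^ p) = (2 * m w0) `^ p.
    rewrite /m -/d -/U [in RHS]powRM ?mulr_ge0 ?powR_ge0 ?(ltW U0)//.
    by rewrite [in RHS]powRM ?powR_ge0 ?(ltW U0)// sq// ltW.
  apply: ge0_ler_powR; rewrite ?nnegrE ?(ltW p0) ?(ltW mz0_gt0)//.
    by rewrite ltW// (lt_trans S0).
  by apply: ltW; apply: le_lt_trans mw0; exact: mle.
move: key I0; case: I => [J| |] //; last first.
  by move=> _ _; rewrite gt0_muley ?lte_fin// leey.
rewrite !lee_fin => key J0; apply: le_trans main _.
rewrite -!mulrA ler_wpM2l ?powR_ge0//.
have Up : U = U `^ p * U `^ (1 - p).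
  by rewrite -powRD ?subrKC ?powRr1 ?(ltW U0)// (gt_eqF U0) implybT.
have cU : (c * U) `^ (1 - p) = c `^ (1 - p) * U `^ (1 - p) by rewrite powRM// ltW.
have V0 : 0 < U `^ (1 - p) by rewrite powR_gt0.
have h1 : U * (s ^+ 4 / 2) <= s ^+ 2 * (c * U) `^ (1 - p) * J.
  by apply: le_trans key; rewrite ler_pM2l// cmass_ge.
have : U `^ (1 - p) * s ^+ 2 * (s ^+ 2 / 2 * U `^ p) <= U `^ (1 - p) * s ^+ 2 * (c `^ (1 - p) * J).
  rewrite [leRHS](_ : _ = s ^+ 2 * (c * U) `^ (1 - p) * J); last by rewrite cU; ring.
  apply: le_trans h1; rewrite {3}Up le_eqVlt; apply/orP; left; apply/eqP; ring.
rewrite ler_pM2l; last by rewrite mulr_gt0// exprn_gt0.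
by rewrite /s; lra.
Qed.

End local_subharmonic.

(** * One radial step *)

Section radial_step.
Context {R : realType}.
Local Notation mR := (measurableTypeR R).
Local Notation plane := (mR * mR)%type.
Local Notation mu2 := (@lebesgue_measure R \x @lebesgue_measure R)%E.
Local Notation D := (odisc (0, 0) 1 : set (R * R)).

Lemma powR_subadd (a b p : R) : 0 < p -> p <= 1 -> 0 <= a -> 0 <= b ->
  (a + b) `^ p <= a `^ p + b `^ p.
Proof.
move=> p0 p1 a0 b0; have [ab|ab] := eqVneq (a + b) 0.
  by rewrite ab powR0 ?gt_eqF// addr_ge0 ?powR_ge0.
have s0 : 0 < a + b by rewrite lt_neqAle eq_sym ab addr_ge0.
have h x : 0 <= x -> x <= a + b -> x * (a + b) `^ (p - 1) <= x `^ p.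
  rewrite le_eqVlt => /orP[/eqP <- _|x0 xs]; first by rewrite mul0r powR_ge0.
  rewrite -(@mulr_powRB1 _ x)// ?(ltW x0)// ler_wpM2l ?(ltW x0)//.
  rewrite -opprB !powRN lef_pV2 ?posrE ?powR_gt0//.
  by apply: ge0_ler_powR; rewrite ?nnegrE ?subr_ge0// ltW.
rewrite -(@mulr_powRB1 _ (a + b))// ?(ltW s0)// mulrDl.
by apply: lerD; apply: h; rewrite ?lerDl ?lerDr.
Qed.

Lemma nrm_scale (t : R) (z : R * R) : 0 <= t -> nrm (t * z.1, t * z.2) = t * nrm z.
Proof.
move=> t0; rewrite /nrm (_ : sqn _ = t ^+ 2 * sqn z); last by rewrite /sqn/=; ring.
by rewrite sqrtrM ?sqr_ge0// sqrtr_sqr ger0_norm.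
Qed.

Lemma nrm_mono (a b c d : R) : `|a| <= `|c| -> `|b| <= `|d| -> nrm (a, b) <= nrm (c, d).
Proof.
move=> ac bd; rewrite nrm_le ?nrm_ge0// nrm_sqr /sqn/=.
by apply: lerD; rewrite -[leLHS]real_normK ?num_real// -[leRHS]real_normK ?num_real//
  ler_pXn2r ?nnegrE.
Qed.

Lemma mvt_segment_bound (g dg : R -> R) (a b L : R) :
  (forall x, Num.min a b <= x -> x <= Num.max a b -> is_derive x 1 g (dg x) /\ `|dg x| <= L) ->
  `|g b - g a| <= L * `|b - a|.
Proof.
wlog ab : a b / a <= b => [hw|].
  case/orP: (le_total a b) => [ab|ba]; first exact: hw.
  move=> h; rewrite (distrC (g b)) (distrC b); apply: hw => // x.
  by rewrite minC maxC; exact: h.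
rewrite (min_idPl ab) (max_idPr ab) => h.
have hx x : x \in `[a, b]%R -> is_derive x 1 g (dg x) /\ `|dg x| <= L.
  by rewrite in_itv/= => /andP[]; exact: h.
have [||x /hx[_ xL] ->] := @MVT_segment R g dg a b ab.
- by move=> x xab; have [] := hx x (subset_itv_oo_cc xab).
- by apply: derivable_within_continuous => x /hx[[]].
by rewrite normrM ler_wpM2r.
Qed.

(** A neighbourhood of the path of the step, of size comparable to the distance [1 - t |z|] of its
    endpoint [t z] from the circle, and itself at a comparable distance from the circle. *)
Definition step_region (t : R) (z : R * R) : set (R * R) :=
  [set w | nrm w <= 1 - (1 - t * nrm z) / 2 /\
           pdist w (t * z.1, t * z.2) < 2 * (1 - t * nrm z)].

Lemma nrm_continuous : continuous (@nrm R).
Proof.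
move=> w; apply: (@continuous_comp _ _ _ (@sqn R) Num.sqrt); first exact: sqn_continuous.
exact: sqrt_continuous.
Qed.

Lemma measurable_nrm : measurable_fun setT (@nrm R : plane -> mR).
Proof. by apply: continuousT_measurable2; exact: nrm_continuous. Qed.

Lemma measurable_step_region t z : t * nrm z <= 1 -> measurable (step_region t z : set plane).
Proof.
move=> tz.
rewrite (_ : step_region t z = (nrm @^-1` `]-oo, 1 - (1 - t * nrm z) / 2]%classic) `&`
    odisc (t * z.1, t * z.2) (2 * (1 - t * nrm z))); last first.
  by apply/seteqP; split => w /=; rewrite in_itv/= odiscE// mulr_ge0// subr_ge0.
apply: measurableI; last exact: open_odisc_measurable.
by rewrite -[X in measurable X]setTI; apply: measurable_nrm => //; exact: measurable_itv.
Qed.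

Lemma path_bound (s t z x : R) : 0 <= s -> s <= t -> Num.min (s * z) (t * z) <= x ->
  x <= Num.max (s * z) (t * z) -> `|x| <= `|t * z| /\ `|x - t * z| <= (t - s) * `|z|.
Proof.
move=> s0 st; have t0 := le_trans s0 st.
rewrite normrM (ger0_norm t0).
have [z0|/ltW z0] := leP 0 z.
  have h : s * z <= t * z by rewrite ler_wpM2r.
  have h' : 0 <= s * z by rewrite mulr_ge0.
  rewrite (min_idPl h) (max_idPr h) ger0_norm// => h1 h2.
  by rewrite !ler_norml; split; apply/andP; split; lra.
have h : t * z <= s * z by rewrite ler_wnM2r.
have h' : s * z <= 0 by rewrite mulr_ge0_le0.
rewrite (min_idPr h) (max_idPl h) ler0_norm// => h1 h2.
by rewrite !ler_norml; split; apply/andP; split; lra.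
Qed.

(** The path from [s z] to [t z] keeps a distance of at least [e = 1 - t |z|] from the circle.
    [subharmonic_powR] bounds [|u|] on discs of radius [e / 8] around it, then [harmonic_grad] bounds
    [grad u], hence [grad v], and integrating along the path bounds the increment. The path is a
    horizontal segment followed by a vertical one, so that only partial derivatives occur. *)
Lemma radial_step (p : R) : 0 < p -> p <= 1 -> exists2 C : R, 0 < C &
  forall (u ux uy v vx vy : R * R -> R) (s t : R) (z : R * R),
    harmonic_with D u ux uy -> harmonic_with D v vx vy ->
    (forall w, D w -> vx w ^+ 2 + vy w ^+ 2 <= ux w ^+ 2 + uy w ^+ 2) ->
    nrm z < 1 -> 0 <= s -> s <= t -> t < 1 -> t - s <= 1 - t ->
    ((`|v (t * z.1, t * z.2) - v (s * z.1, s * z.2)| `^ p)%:E <=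
     (C * (t - s) `^ p / (1 - t * nrm z) `^ (2 + p))%:E *
     \int[mu2]_(w in step_region t z) (`|u w| `^ p)%:E)%E.
Proof.
move=> p0 p1; have [C C0 hC] := subharmonic_powR p0 p1.
have [k k0 ek] : exists2 k : R, 0 < k & k = 2 * 288 * 8.
  by exists (2 * 288 * 8); [lra|].
have [k' k'0 ek'] : exists2 k' : R, 0 < k' & k' = 288 by exists 288; [lra|].
have [c c0 ec] : exists2 c : R, 0 < c & c = 64 * C by exists (64 * C); [lra|].
exists (k `^ p * c); first by rewrite mulr_gt0 ?powR_gt0.
move=> u ux uy v vx vy s t z hu hv sub z1 s0 st t1 ts.
have t0 := le_trans s0 st; have nz := nrm_ge0 z.
set e := 1 - t * nrm z; pose tau := t - s; rewrite -/tau.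
have tz1 : t * nrm z <= t by rewrite ler_piMr// ltW.
have e0 : 0 < e by rewrite /e; lra.
have taue : tau <= e by rewrite /tau /e; lra.
have tau0 : 0 <= tau by rewrite subr_ge0.
set J := (\int[mu2]_(w in _) _)%E.
have J0 : (0 <= J)%E by apply: integral_ge0 => w _; rewrite lee_fin powR_ge0.
have [tau_eq|taun0] := eqVneq tau 0.
  have -> : t = s by apply/eqP; rewrite -subr_eq0 -/tau tau_eq.
  rewrite subrr normr0 powR0 ?gt_eqF// mule_ge0// lee_fin.
  by rewrite divr_ge0 ?powR_ge0// !mulr_ge0 ?powR_ge0// ltW.
have taugt0 : 0 < tau by rewrite lt_neqAle eq_sym taun0.
have coef0 : 0 < k `^ p * c * tau `^ p / e `^ (2 + p).
  by rewrite divr_gt0 ?powR_gt0// !mulr_gt0// powR_gt0.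
case eJ : J J0 => [J'| |] // J'0; last by rewrite gt0_muley ?lte_fin// leey.
rewrite lee_fin in J'0.
pose r := e / 8; have r0 : 0 < r by rewrite divr_gt0.
pose b : R * R := (t * z.1, t * z.2).
have inD w : nrm w < 1 -> D w by rewrite odiscE// pdist0.
(* the disc of radius [r] around [y] stays in the step region, so [J'] bounds its integral *)
have uS x y : nrm x <= 1 - e -> pdist x b <= e -> pdist y x < r -> `|u y| <= (c * J' / e ^+ 2) `^ p^-1.
  move=> x1 xb yx.
  have y1 := pdist_triangle y x (0, 0); rewrite !pdist0 in y1.
  have hy : harmonic_with (odisc y (2 * r)) u ux uy.
    have r20 : 0 <= 2 * r by rewrite mulr_ge0// ltW.
    apply: harmonic_sub hu => w; rewrite odiscE// => wy; apply: inD.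
    have h := pdist_triangle w y (0, 0); rewrite !pdist0 in h.
    by rewrite /r in yx wy; lra.
  have r2 : r < 2 * r by lra.
  have h := hC y r (2 * r) u ux uy r0 r2 hy.
  have : ((r ^+ 2 * `|u y| `^ p)%:E <= C%:E * J'%:E)%E.
    apply: le_trans h _; apply: lee_wpmul2l; first by rewrite lee_fin ltW.
    rewrite -eJ /J; apply: ge0_subset_integral.
    - exact: open_odisc_measurable.
    - by apply: measurable_step_region; lra.
    - apply/measurable_EFinP; apply: measurable_funS (measurable_norm_powR p _).
      + exact: measurable_disc.
      + move=> w [h1 _] /=; apply: inD; apply: le_lt_trans h1 _; lra.
      + by move=> w; exact: (harmonic_continuous hu).
    - by move=> w _; rewrite lee_fin powR_ge0.
    - move=> w; rewrite odiscE ?(ltW r0)// => wy.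
      have h1 := pdist_triangle w y (0, 0); rewrite !pdist0 in h1.
      have h2 := pdist_triangle w y b; have h3 := pdist_triangle y x b.
      by rewrite /step_region/= -/b -/e; rewrite /r in wy yx; split; lra.
  rewrite lee_fin => h'.
  have up : `|u y| `^ p <= c * J' / e ^+ 2.
    rewrite ler_pdivlMr ?exprn_gt0//.
    have -> : e ^+ 2 = 64 * r ^+ 2 by rewrite /r; field.
    by move: h'; rewrite ec; lra.
  have -> : `|u y| = (`|u y| `^ p) `^ p^-1 by rewrite -powRrM divff ?gt_eqF// powRr1.
  by apply: ge0_ler_powR; rewrite ?nnegrE ?invr_ge0 ?powR_ge0 ?(ltW p0)// (le_trans _ up)// powR_ge0.
set S := (_ `^ p^-1) in uS.
have S0 : 0 <= S by exact: powR_ge0.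
have gradu x : nrm x <= 1 - e -> pdist x b <= e -> `|ux x| <= 144 * S / r /\ `|uy x| <= 144 * S / r.
  move=> x1 xb; apply: (harmonic_grad r0 (u := u)).
    apply: harmonic_sub hu => w; rewrite odiscE ?(ltW r0)// => wx; apply: inD.
    have h := pdist_triangle w x (0, 0); rewrite !pdist0 in h.
    by rewrite /r in wx; lra.
  by move=> y; rewrite odiscE ?(ltW r0)// => yx; exact: uS x1 xb yx.
have gradv x : nrm x <= 1 - e -> pdist x b <= e -> `|vx x| <= k' * S / r /\ `|vy x| <= k' * S / r.
  move=> x1 xb; have [g1 g2] := gradu x x1 xb.
  have Dx : D x by apply: inD; lra.
  have L0 : 0 <= 144 * S / r by apply: le_trans g1.
  have L2 : k' * S / r = 2 * (144 * S / r) by rewrite ek'; field; rewrite gt_eqF.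
  move: (144 * S / r) L0 L2 g1 g2 => L L0 L2 g1 g2.
  have sq (a : R) : `|a| <= L -> a ^+ 2 <= L ^+ 2.
    by move=> h; rewrite -[a ^+ 2]real_normK ?num_real// ler_pXn2r ?nnegrE.
  have := sub x Dx; have := sq _ g1; have := sq _ g2 => q1 q2 q3.
  have f (a : R) : a ^+ 2 <= 2 * L ^+ 2 -> `|a| <= k' * S / r.
    move=> h; rewrite L2 -(@ler_pXn2r _ 2) ?nnegrE ?mulr_ge0// real_normK ?num_real//.
    by apply: le_trans h _; rewrite exprMn ler_wpM2r ?sqr_ge0//; lra.
  by split; apply: f; have := sqr_ge0 (vx x); have := sqr_ge0 (vy x); lra.
have L0 : 0 <= k' * S / r.
  by apply: divr_ge0; [apply: mulr_ge0; [exact: ltW|exact: S0]|exact: ltW].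
have e1 : 1 - e < 1 by lra.
have [vxx [vxy [vyx [vyy [hv1 _ _ _]]]]] := hv.
(* one horizontal and one vertical move, both inside the closed disc of radius t * nrm z *)
have leg1 : `|v (t * z.1, s * z.2) - v (s * z.1, s * z.2)| <= k' * S / r * tau.
  apply: le_trans (_ : k' * S / r * `|t * z.1 - s * z.1| <= _); last first.
    rewrite ler_wpM2l// -mulrBl normrM (ger0_norm tau0) ler_piMr//.
    by apply: le_trans (nrm_fst z) (ltW z1).
  apply: (@mvt_segment_bound (fun x => v (x, s * z.2)) (fun x => vx (x, s * z.2))) => x x1 x2.
  have [p1' p2'] := path_bound s0 st x1 x2.
  have n1 : nrm (x, s * z.2) <= 1 - e.
    apply: le_trans (_ : nrm (t * z.1, t * z.2) <= _); last by rewrite nrm_scale// /e; lra.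
    by apply: nrm_mono => //; rewrite !normrM (ger0_norm s0) (ger0_norm t0) ler_wpM2r.
  have n2 : pdist (x, s * z.2) b <= e.
    apply: le_trans (_ : tau * nrm z <= _); last by apply: le_trans taue; rewrite ler_piMr// ltW.
    rewrite -nrm_scale//; apply: nrm_mono; rewrite /b/=.
      by rewrite [leRHS]normrM (ger0_norm tau0).
    by rewrite -mulrBl !normrM distrC.
  have [d1 _ _ _] := hv1 (x, s * z.2) (inD _ (le_lt_trans n1 e1)).
  by split; [exact: d1|have [] := gradv _ n1 n2].
have leg2 : `|v (t * z.1, t * z.2) - v (t * z.1, s * z.2)| <= k' * S / r * tau.
  apply: le_trans (_ : k' * S / r * `|t * z.2 - s * z.2| <= _); last first.
    rewrite ler_wpM2l// -mulrBl normrM (ger0_norm tau0) ler_piMr//.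
    by apply: le_trans (nrm_snd z) (ltW z1).
  apply: (@mvt_segment_bound (fun y => v (t * z.1, y)) (fun y => vy (t * z.1, y))) => y y1 y2.
  have [p1' p2'] := path_bound s0 st y1 y2.
  have n1 : nrm (t * z.1, y) <= 1 - e.
    apply: le_trans (_ : nrm (t * z.1, t * z.2) <= _); last by rewrite nrm_scale// /e; lra.
    exact: nrm_mono.
  have n2 : pdist (t * z.1, y) b <= e.
    apply: le_trans (_ : tau * nrm z <= _); last by apply: le_trans taue; rewrite ler_piMr// ltW.
    rewrite -nrm_scale//; apply: nrm_mono; rewrite /b/=; first by rewrite subrr normr0.
    by rewrite [leRHS]normrM (ger0_norm tau0).
  have [_ d2 _ _] := hv1 (t * z.1, y) (inD _ (le_lt_trans n1 e1)).
  by split; [exact: d2|have [] := gradv _ n1 n2].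
have tot : `|v (t * z.1, t * z.2) - v (s * z.1, s * z.2)| <= k * (tau / e) * S.
  have -> : k * (tau / e) * S = k' * S / r * tau + k' * S / r * tau.
    by rewrite ek ek' /r; field; rewrite gt_eqF.
  rewrite (_ : _ - _ = (v (t * z.1, t * z.2) - v (t * z.1, s * z.2)) +
     (v (t * z.1, s * z.2) - v (s * z.1, s * z.2))); last by ring.
  exact: le_trans (ler_normD _ _) (lerD leg2 leg1).
rewrite -EFinM lee_fin.
apply: le_trans (_ : (k * (tau / e) * S) `^ p <= _).
  apply: ge0_ler_powR; rewrite ?nnegrE ?(ltW p0)//.
  by rewrite (le_trans _ tot).
have ie0 : 0 <= e^-1 by rewrite invr_ge0 ltW.
have te0 : 0 <= tau / e := mulr_ge0 tau0 ie0.
have eS : S `^ p = c * J' / e ^+ 2.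
  rewrite /S -powRrM mulVf ?gt_eqF// powRr1//.
  exact: (divr_ge0 (mulr_ge0 (ltW c0) J'0) (sqr_ge0 e)).
have ee : e^-1 `^ p = (e `^ p)^-1 by rewrite -powR_inv1 ?(ltW e0)// -powRrM mulN1r powRN.
rewrite (powRM _ (mulr_ge0 (ltW k0) te0) S0) (powRM _ (ltW k0) te0) (powRM _ tau0 ie0) eS ee.
rewrite powRD; last by rewrite (gt_eqF e0) implybT.
rewrite (_ : e `^ 2 = e ^+ 2); last by rewrite -powR_mulrn ?(ltW e0).
rewrite le_eqVlt; apply/orP; left; apply/eqP; field.
by rewrite !gt_eqF ?powR_gt0.
Qed.

End radial_step.

(** * Weighted mass of a boundary disc *)

Section carleson.
Context {R : realType}.
Local Notation mR := (measurableTypeR R).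
Local Notation plane := (mR * mR)%type.
Local Notation mu2 := (@lebesgue_measure R \x @lebesgue_measure R)%E.
Local Notation D := (odisc (0, 0) 1 : set (R * R)).

Definition pos_sqr (s : R) : R := Num.max 0 s ^+ 2.

Lemma max0_continuous : continuous (fun s : R => Num.max 0 s).
Proof.
move=> t; have := @continuous_max R R (cst 0) (fun s : R => s) t.
by apply; [exact: cvg_cst|exact: cvg_id].
Qed.

Lemma is_derive_pos_sqr (t : R) : is_derive t 1 pos_sqr (2 * Num.max 0 t).
Proof.
have sq (x : R) : is_derive x 1 (fun x : R => x ^+ 2) (2 * x).
  by apply: is_derive_eq; rewrite /GRing.scale/=; ring.
case: (boolP (0 < t)) => [t0|]; last (rewrite -leNgt le_eqVlt => /orP[/eqP ->|t0]).
- rewrite (max_idPr (ltW t0)).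
  apply: (@near_eq_is_derive R R R (fun x => x ^+ 2) pos_sqr t 1 (2 * t) _ (sq t)).
  apply/nbhs_ballP; exists t => //= y; rewrite /ball/= => yt.
  have y0 : 0 <= y by have := ler_norm (t - y); lra.
  by rewrite /pos_sqr (max_idPr y0).
- have := @slope_is_derive R pos_sqr (fun s => Num.max 0 s) 0 (@max0_continuous 0).
  rewrite maxxx mulr0; apply => s; rewrite /pos_sqr maxxx expr0n/= !subr0.
  have [s0|/ltW s0] := leP 0 s; first by rewrite expr2.
  by rewrite expr0n mul0r.
- rewrite (max_idPl (ltW t0)) mulr0.
  apply: (@near_eq_is_derive R R R (cst 0) pos_sqr t 1 0 _ (is_derive_cst _ _ _)).
  apply/nbhs_ballP; exists (- t); rewrite /= ?oppr_gt0// => y; rewrite /ball/= => yt.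
  have y0 : y <= 0 by have := ler_norm (y - t); rewrite distrC; lra.
  by rewrite /pos_sqr (max_idPl y0) expr0n.
Qed.

(** [W] vanishes at the end of the support and its derivative is at most half of [(1 - t)^alpha],
    so it is dominated by the primitive of that power; here [-1 < alpha] enters. *)
Lemma primitive_bound (alpha : R) (n : nat) (W om : R -> R) : -1 < alpha ->
  (forall t : R, is_derive t 1 W (om t / 2)) ->
  (forall t, wrho n ^+ 2 <= t -> W t = 0) -> (forall t, 0 <= om t) ->
  (forall t, 0 <= t -> om t = dweight alpha n t) ->
  forall t, 0 <= t -> t < 1 -> `|W t| <= (1 - t) `^ (alpha + 1) / (2 * (alpha + 1)).
Proof.
move=> a1 dW W0 om0 omE t t0 t1.
have a10 : 0 < alpha + 1 by lra.
have b0 x : 0 <= (1 - x) `^ (alpha + 1) / (2 * (alpha + 1)).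
  by rewrite divr_ge0 ?powR_ge0// mulr_ge0// ltW.
have [/W0 ->|tr] := leP (wrho n ^+ 2) t; first by rewrite normr0.
have r1 : (wrho n : R) ^+ 2 < 1 by rewrite (wrho_sqr n) gtrBl wgap_gt0.
have Wt : W t <= 0.
  have [|x xr e] := @MVT_segment R W (fun t => om t / 2) t (wrho n ^+ 2) (ltW tr) (fun x _ => dW x).
    by apply: continuous_subspaceT => x; exact: (is_derive_continuous (dW x)).
  have : 0 <= W (wrho n ^+ 2) - W t by rewrite e mulr_ge0// ?divr_ge0// subr_ge0 ltW.
  by rewrite W0// sub0r oppr_ge0.
rewrite ler0_norm//.
pose V x := W x + (1 - x) `^ (alpha + 1) / (2 * (alpha + 1)).
have dV (x : R) : x < 1 -> is_derive x 1 V (om x / 2 - (1 - x) `^ alpha / 2).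
  move=> x1; have x10 : 0 < 1 - x by rewrite subr_gt0.
  have d1 : is_derive x 1 (fun x : R => 1 - x) (-1).
    have := is_deriveB (is_derive_cst (1 : R) x 1) (is_derive_id x 1).
    by apply: is_derive_rew; rewrite sub0r.
  have d2 := @is_derive1_comp _ (fun y => y `^ (alpha + 1)) (fun x : R => 1 - x) x _ _
     (is_derive1_powR (alpha + 1) x10) d1.
  have d3 := is_deriveM d2 (is_derive_cst (2 * (alpha + 1))^-1 x 1).
  have := is_deriveD (dW x) d3; apply: is_derive_rew.
  by rewrite /GRing.scale/= addrK; field; rewrite gt_eqF.
have [||x] := @MVT_segment R V (fun x => om x / 2 - (1 - x) `^ alpha / 2) t (wrho n ^+ 2) (ltW tr).
- by move=> x; rewrite in_itv/= => /andP[_ xr]; apply: dV; exact: lt_trans r1.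
- apply: derivable_within_continuous => x; rewrite in_itv/= => /andP[_ xr].
  by have [] := dV x (le_lt_trans xr r1).
rewrite in_itv/= => /andP[tx xr] e.
have x0 := le_trans t0 tx; have x1 := le_lt_trans xr r1.
have dle : om x <= (1 - x) `^ alpha by rewrite omE//; exact: dweight_le.
have : V (wrho n ^+ 2) - V t <= 0.
  by rewrite e mulr_le0_ge0 ?subr_ge0 ?(ltW tr)//; lra.
by rewrite /V W0//; have := b0 (wrho n ^+ 2); lra.
Qed.

(** Integrating by parts against the primitive of a radial weight bounds the mass that the
    weight puts on a region by the size of the primitive there. *)
Lemma radial_by_parts (rho : R) (W om : R -> R) (chi chix chiy : R * R -> R) : 0 < rho ->
  (forall t : R, is_derive t 1 W (om t / 2)) -> continuous om ->
  (forall t, rho ^+ 2 <= t -> W t = 0) -> (forall t, rho ^+ 2 <= t -> om t = 0) ->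
  C1 setT chi chix chiy ->
  \int[mu2]_z (om (sqn z) * (sqn z * chi z)) =
  - \int[mu2]_z (W (sqn z) * (2 * chi z + z.1 * chix z + z.2 * chiy z)).
Proof.
move=> rho0 dW com W0 om0 hchi.
have oT := @openT (R * R)%type.
have cW : continuous W by move=> t; exact: (is_derive_continuous (dW t)).
have cchi : continuous chi by move=> w; exact: (C1_continuous oT hchi I).
have [cx cy] : continuous chix /\ continuous chiy by split => w; have [] := hchi w I.
have sqb w : ~ box rho w -> rho ^+ 2 <= sqn w by apply: sqn_box; exact: ltW.
have int (phi : R -> R) (g : R * R -> R) : continuous phi -> (forall t, rho ^+ 2 <= t -> phi t = 0) ->
    continuous g -> continuous (fun z => phi (sqn z) * g z) /\
    mu2.-integrable setT (EFin \o (fun z => phi (sqn z) * g z)).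
  move=> cphi phi0 cg.
  have cc : continuous (fun z => phi (sqn z) * g z).
    apply: (@cutoff_continuous R phi g rho (rho + 1)) => //; first by rewrite ltrDl.
    by move=> w _; exact: cg.
  split => //; apply: (integrable_continuous_box (b := rho)) => // w /sqb/phi0 ->.
  by rewrite mul0r.
have cf : continuous (@fst R R) by move=> w; exact: cvg_fst.
have cs : continuous (@snd R R) by move=> w; exact: cvg_snd.
have cM (g h : R * R -> R) : continuous g -> continuous h -> continuous (fun z => g z * h z).
  by move=> cg ch w; apply: cvgM; [exact: cg|exact: ch].
have cD (g h : R * R -> R) : continuous g -> continuous h -> continuous (fun z => g z + h z).
  by move=> cg ch w; apply: cvgD; [exact: cg|exact: ch].
have dsq (c x : R) : is_derive x 1 (fun x : R => W (x ^+ 2 + c)) (x * om (x ^+ 2 + c)).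
  have h : is_derive x 1 (fun x : R => x ^+ 2 + c) (2 * x).
    by apply: is_derive_eq; rewrite /GRing.scale/=; ring.
  have := @is_derive1_comp _ W (fun x : R => x ^+ 2 + c) x _ _ (dW _) h.
  by apply: is_derive_rew; field.
have Wb (x : R) w : rho <= `|x| -> x ^+ 2 <= sqn w -> W (sqn w) = 0.
  move=> rx xw; apply: W0; apply: le_trans xw.
  by rewrite -[x ^+ 2]real_normK ?num_real// ler_pXn2r ?nnegrE// ltW.
have cgx : continuous (fun z : R * R => chi z + z.1 * chix z) by apply: (cD) => //; exact: (cM).
have cgy : continuous (fun z : R * R => chi z + z.2 * chiy z) by apply: (cD) => //; exact: (cM).
have cox : continuous (fun z : R * R => z.1 * z.1 * chi z) by apply: (cM) => //; exact: (cM).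
have coy : continuous (fun z : R * R => z.2 * z.2 * chi z) by apply: (cM) => //; exact: (cM).
have [c1 i1] := int _ _ com om0 cox; have [c2 i2] := int _ _ cW W0 cgx.
have [c3 i3] := int _ _ com om0 coy; have [c4 i4] := int _ _ cW W0 cgy.
have ex : \int[mu2]_z (om (sqn z) * (z.1 * z.1 * chi z)) +
    \int[mu2]_z (W (sqn z) * (chi z + z.1 * chix z)) = 0.
  rewrite -RintegralD//.
  apply: (@integral_partial_x_eq0 _ (fun z => W (sqn z) * (z.1 * chi z)) _ rho) => //.
  - move=> w; have [d1 _ _ _] := hchi w I.
    have := is_deriveM (dsq (w.2 ^+ 2) w.1) (is_deriveM (is_derive_id w.1 1) d1).
    apply: is_derive_rew; rewrite /GRing.scale/= -/(sqn w).
    rewrite -[(id * _) w.1]/(w.1 * chi (w.1, w.2)) -surjective_pairing; ring.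
  - by apply: (cD).
  - move=> w wr; rewrite (Wb w.1)// ?mul0r//; by rewrite lerDl sqr_ge0.
  - by move=> w /sqb h; rewrite om0// W0// !mul0r addr0.
have ey : \int[mu2]_z (om (sqn z) * (z.2 * z.2 * chi z)) +
    \int[mu2]_z (W (sqn z) * (chi z + z.2 * chiy z)) = 0.
  rewrite -RintegralD//.
  apply: (@integral_partial_y_eq0 _ (fun z => W (sqn z) * (z.2 * chi z)) _ rho) => //.
  - move=> w; have [_ d2 _ _] := hchi w I.
    rewrite (_ : (fun y => _) = (fun y => W (y ^+ 2 + w.1 ^+ 2)) * (fun y => y * chi (w.1, y))); last first.
      by apply/funext => y; rewrite /sqn/= addrC.
    have := is_deriveM (dsq (w.1 ^+ 2) w.2) (is_deriveM (is_derive_id w.2 1) d2).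
    apply: is_derive_rew; rewrite /GRing.scale/= [w.2 ^+ 2 + _]addrC -/(sqn w).
    rewrite -[(id * _) w.2]/(w.2 * chi (w.1, w.2)) -surjective_pairing; ring.
  - by apply: (cD).
  - move=> w wr; rewrite (Wb w.2)// ?mul0r//; by rewrite lerDr sqr_ge0.
  - by move=> w /sqb h; rewrite om0// W0// !mul0r addr0.
have -> : \int[mu2]_z (om (sqn z) * (sqn z * chi z)) =
    \int[mu2]_z (om (sqn z) * (z.1 * z.1 * chi z)) + \int[mu2]_z (om (sqn z) * (z.2 * z.2 * chi z)).
  by rewrite -RintegralD//; apply: eq_Rintegral => z _; rewrite /sqn; ring.
have -> : \int[mu2]_z (W (sqn z) * (2 * chi z + z.1 * chix z + z.2 * chiy z)) =
    \int[mu2]_z (W (sqn z) * (chi z + z.1 * chix z)) + \int[mu2]_z (W (sqn z) * (chi z + z.2 * chiy z)).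
  by rewrite -RintegralD//; apply: eq_Rintegral => z _; ring.
by move: ex ey; lra.
Qed.

(** A bump supported in the disc of radius [S] around [w], squared so as to be C1. *)
Definition tent (w : R * R) (S : R) (z : R * R) : R :=
  pos_sqr (S ^+ 2 - sqn (z.1 - w.1, z.2 - w.2)).
Definition dtent (w : R * R) (S : R) (z : R * R) : R :=
  2 * Num.max 0 (S ^+ 2 - sqn (z.1 - w.1, z.2 - w.2)).

Lemma C1_tent w S : C1 setT (tent w S) (fun z => dtent w S z * - (2 * (z.1 - w.1)))
  (fun z => dtent w S z * - (2 * (z.2 - w.2))).
Proof.
have oT := @openT (R * R)%type.
have h : C1 setT (fun z => S ^+ 2 - sqn (z.1 - w.1, z.2 - w.2))
    (fun z => - (2 * (z.1 - w.1))) (fun z => - (2 * (z.2 - w.2))).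
  have x := C1_add (@C1_fst R setT) (@C1_cst R setT (- w.1)).
  have y := C1_add (@C1_snd R setT) (@C1_cst R setT (- w.2)).
  apply: C1_eq (C1_add (@C1_cst R setT (S ^+ 2)) (C1_opp (C1_add (C1_mul oT x x) (C1_mul oT y y)))) => z.
  - by rewrite /sqn/=.
  - by rewrite /cst/=; ring.
  - by rewrite /cst/=; ring.
apply: (@C1_comp1 R setT pos_sqr (fun s => 2 * Num.max 0 s) _ _ _ oT h) => z _.
split; first exact: is_derive_pos_sqr.
by apply: cvgM; [exact: cvg_cst|exact: max0_continuous].
Qed.

Lemma tent_out w S z : 0 <= S -> S <= pdist z w -> tent w S z = 0 /\ dtent w S z = 0.
Proof.
move=> S0 h; have : S ^+ 2 <= sqn (z.1 - w.1, z.2 - w.2).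
  by rewrite -nrm_sqr ler_pXn2r ?nnegrE ?nrm_ge0.
rewrite /tent /dtent /pos_sqr -subr_le0 => /max_idPl ->.
by rewrite expr0n mulr0.
Qed.

Lemma tent_bounds w S z : 0 <= S -> pdist z w <= S ->
  [/\ 0 <= tent w S z, tent w S z <= S ^+ 4,
      `|dtent w S z * - (2 * (z.1 - w.1))| <= 4 * S ^+ 3 &
      `|dtent w S z * - (2 * (z.2 - w.2))| <= 4 * S ^+ 3].
Proof.
move=> S0 h; have q0 := sqn_ge0 (z.1 - w.1, z.2 - w.2).
rewrite /tent /dtent /pos_sqr.
have m1 : Num.max 0 (S ^+ 2 - sqn (z.1 - w.1, z.2 - w.2)) <= S ^+ 2.
  by rewrite ge_max sqr_ge0 gerBl.
have m0 : 0 <= Num.max 0 (S ^+ 2 - sqn (z.1 - w.1, z.2 - w.2)) by rewrite le_max lexx.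
move: (Num.max _ _) m1 m0 => m m1 m0.
have grad (a : R) : `|a| <= S -> `|2 * m * - (2 * a)| <= 4 * S ^+ 3.
  move=> aS; rewrite normrM normrN !normrM (ger0_norm m0) (@ger0_norm _ 2)//.
  have := ler_pM m0 (normr_ge0 a) m1 aS; rewrite -exprSr; lra.
split.
- exact: sqr_ge0.
- by rewrite (_ : S ^+ 4 = (S ^+ 2) ^+ 2) ?ler_pXn2r ?nnegrE ?sqr_ge0// -exprM.
- by apply: grad; apply: le_trans (pdist_fst z w) h.
- by apply: grad; apply: le_trans (pdist_snd z w) h.
Qed.

(** After integration by parts the weight is replaced by its primitive, which is at most a
    constant times [d^(alpha+1)] on the support of the bump; [18 d] bounds [1 - sqn z] there, since
    [1 - nrm z <= 9 d]. *)
Lemma integral_tent_le (alpha : R) (n : nat) (w : R * R) (d : R) : -1 < alpha ->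
  nrm w < 1 -> d = 1 - nrm w ->
  \int[mu2]_z (dweight alpha n (sqn z) * (sqn z * tent w (8 * d) z)) <=
  (18 * d) `^ (alpha + 1) / (2 * (alpha + 1)) * (24 * (8 * d) ^+ 3) * (2 * (8 * d)) ^+ 2.
Proof.
move=> a1 w1 ed; set S := 8 * d.
have d0 : 0 < d by rewrite ed subr_gt0.
have S0 : 0 <= S by rewrite mulr_ge0// ltW.
have [cw w0 wge] := dweight_weight alpha n.
have [W [om [[dW com] W0 om0 om_ge0 e]]] := weight_primitive (sqr_ge0 (wrho n)) cw w0 wge.
have r0 := @wrho_gt0 R n; have r1 := @wrho_lt1 R n.
rewrite -(eq_weight _ e) (radial_by_parts r0 dW com W0 om0 (C1_tent w S)).
rewrite -[leLHS]mulN1r.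
pose f (z : R * R) := W (sqn z) * (2 * tent w S z + z.1 * (dtent w S z * - (2 * (z.1 - w.1))) +
  z.2 * (dtent w S z * - (2 * (z.2 - w.2)))).
have cW : continuous W by move=> t; exact: (is_derive_continuous (dW t)).
have oT := @openT (R * R)%type.
have [cb cbx cby] : [/\ continuous (tent w S), continuous (fun z => dtent w S z * - (2 * (z.1 - w.1)))
    & continuous (fun z => dtent w S z * - (2 * (z.2 - w.2)))].
  split => z; first exact: (@C1_continuous _ _ _ _ _ z oT (C1_tent w S) I).
    by have [] := C1_tent w S (I : setT z).
  by have [] := C1_tent w S (I : setT z).
have fi : mu2.-integrable setT (EFin \o f).
  apply: (integrable_continuous_box (b := wrho n)).
    apply: (@cutoff_continuous R W _ (wrho n) 1) => // z _.
    apply: cvgD; [apply: cvgD|apply: cvgM; [exact: cvg_snd|exact: cby]].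
      by apply: cvgM; [exact: cvg_cst|exact: cb].
    by apply: cvgM; [exact: cvg_fst|exact: cbx].
  by move=> z /sqn_box; rewrite (ltW r0) => /(_ isT) h; rewrite /f W0// mul0r.
have a10 : 0 < alpha + 1 by lra.
set B := (18 * d) `^ (alpha + 1) / (2 * (alpha + 1)).
have B0 : 0 <= B by rewrite divr_ge0 ?powR_ge0// mulr_ge0// ltW.
have fb z : `|f (shift2 w z)| <= B * (24 * S ^+ 3).
  move: (shift2 w z) => {}z; rewrite /f.
  have B1 : 0 <= B * (24 * S ^+ 3) by rewrite mulr_ge0// mulr_ge0// exprn_ge0.
  have [far|near] := leP S (pdist z w).
    have [-> ->] := tent_out S0 far.
    by rewrite !mul0r !mulr0 !addr0 mulr0 normr0.
  have [zr|zr] := leP (wrho n ^+ 2) (sqn z); first by rewrite W0// mul0r normr0.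
  have z1 : sqn z < 1.
    by apply: lt_trans zr _; rewrite wrho_sqr gtrBl wgap_gt0.
  have nz1 : nrm z < 1 by rewrite nrm_lt// expr1n.
  have [b0 b1 b2 b3] := tent_bounds S0 (ltW near).
  rewrite normrM; apply: ler_pM => //.
    apply: le_trans (primitive_bound a1 dW W0 om_ge0 e (sqn_ge0 z) z1) _.
    rewrite /B ler_pM2r ?invr_gt0 ?mulr_gt0//.
    apply: ge0_ler_powR; rewrite ?nnegrE ?(ltW a10) ?subr_ge0 ?(ltW z1)//.
      by rewrite mulr_ge0// ltW.
    have := pdist_triangle w z (0, 0); rewrite !pdist0 pdist_sym => tri.
    have : (1 - nrm z) * (1 + nrm z) <= (1 - nrm z) * 2.
      by rewrite ler_wpM2l//; lra.
    by rewrite /S ed in near tri *; rewrite -nrm_sqr; lra.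
  have S8 : S <= 8 by rewrite /S ed; have := nrm_ge0 w; lra.
  have z11 : `|z.1| <= 1 by apply: le_trans (nrm_fst z) (ltW nz1).
  have z21 : `|z.2| <= 1 by apply: le_trans (nrm_snd z) (ltW nz1).
  apply: le_trans (ler_normD _ _) _; apply: le_trans (lerD (ler_normD _ _) (lexx _)) _.
  have t1 : `|2 * tent w S z| <= 16 * S ^+ 3.
    rewrite normrM !ger0_norm//; have : S ^+ 4 <= 8 * S ^+ 3.
      by rewrite (exprS S 3) ler_wpM2r// exprn_ge0.
    lra.
  have t2 (a b : R) : `|a| <= 1 -> `|b| <= 4 * S ^+ 3 -> `|a * b| <= 4 * S ^+ 3.
    by move=> ha hb; rewrite normrM -[leRHS]mul1r; exact: ler_pM.
  have := t2 _ _ z11 b2; have := t2 _ _ z21 b3; lra.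
have f0 z : ~ box S z -> f (shift2 w z) = 0.
  move=> /sqn_box; rewrite S0 => /(_ isT) h; rewrite /f.
  have -> : shift2 w z = line w 1 z by rewrite /line !mul1r.
  have [-> ->] : tent w S (line w 1 z) = 0 /\ dtent w S (line w 1 z) = 0.
    by apply: tent_out => //; rewrite pdist_shift leNgt nrm_lt// -leNgt.
  by rewrite !mul0r !mulr0 !addr0 mulr0.
have := le_Rintegral_box S0 (integrable_shift w fi) fb f0.
rewrite Rintegral_shift// => h; apply: le_trans h; rewrite mulN1r -normrN.
exact: ler_norm.
Qed.

Lemma powR_le_endpoints (a b x alpha : R) : 0 < a -> a <= x -> x <= b ->
  x `^ alpha <= a `^ alpha + b `^ alpha.
Proof.
move=> a0 ax xb; have x0 := lt_le_trans a0 ax.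
have [al|al] := leP 0 alpha.
  apply: le_trans (_ : b `^ alpha <= _); last by rewrite lerDr powR_ge0.
  by apply: ge0_ler_powR; rewrite ?nnegrE// ?(ltW x0)// (le_trans _ xb)// ltW.
apply: le_trans (_ : a `^ alpha <= _); last by rewrite lerDl powR_ge0.
rewrite -[alpha]opprK !(powRN _ (- alpha)) lef_pV2 ?posrE ?powR_gt0//.
by apply: ge0_ler_powR; rewrite ?nnegrE ?oppr_ge0// ltW.
Qed.

(** The tent of radius [8 d] is bounded below on the disc of radius [6 d], so away from the origin
    [integral_tent_le] applies, the factor [sqn z] of the integration by parts being at least 1/4.
    Points with [sqn z < 1/4] occur only if [d] is not small, and there the weight is bounded.
    For [-1 < alpha < 0] the weight is unbounded on these discs, which is why the bound does
    not reduce to their area. *)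
Lemma carleson (alpha : R) : -1 < alpha -> exists2 C : R, 0 < C &
  forall (w : R * R) (d : R), nrm w < 1 -> d = 1 - nrm w ->
  (\int[mu2]_(z in D) ((1 - sqn z) `^ alpha * \1_(odisc w (6 * d)) z)%:E <=
   (C * d `^ (alpha + 2))%:E)%E.
Proof.
move=> a1; have a10 : 0 < alpha + 1 by lra.
pose c1 : R := (3 / 4) `^ alpha + 1 `^ alpha.
have c10 : 0 < c1 by rewrite addr_gt0 ?powR_gt0//; lra.
have [k k0 ek] : exists2 k : R, 0 < k & k = 4 / 28 ^+ 2 * (24 * 8 ^+ 3) * 16 ^+ 2.
  by exists (4 / 28 ^+ 2 * (24 * 8 ^+ 3) * 16 ^+ 2); [lra|].
exists (k * 18 `^ (alpha + 1) / (2 * (alpha + 1)) + 4 * c1 * 14 `^ (alpha + 2)).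
  rewrite addr_gt0// ?mulr_gt0 ?powR_gt0//; try lra.
  by rewrite invr_gt0; lra.
move=> w d w1 ed; have d0 : 0 < d by rewrite ed subr_gt0.
have d1 : d <= 1 by rewrite ed; have := nrm_ge0 w; lra.
apply: exhaust_le.
- apply: measurable_funTS; exact: measurable_indic (open_odisc_measurable _ _).
- by move=> z; rewrite indicE.
move=> n; have [cw w0 wge] := dweight_weight alpha n.
pose c3 : R := 4 / (28 * d ^+ 2) ^+ 2.
have c30 : 0 < c3 by rewrite divr_gt0// exprn_gt0// mulr_gt0// exprn_gt0.
pose c4 : R := c1 * (14 * d) `^ (alpha + 2).
have c40 : 0 <= c4 by rewrite mulr_ge0 ?powR_ge0 ?(ltW c10).
have S0 : 0 <= 8 * d by rewrite mulr_ge0// ltW.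
pose F (z : R * R) := c3 * (dweight alpha n (sqn z) * (sqn z * tent w (8 * d) z)).
have oT := @openT (R * R)%type.
have cb : continuous (fun z => sqn z * tent w (8 * d) z).
  move=> z; apply: cvgM; first exact: sqn_continuous.
  exact: (@C1_continuous _ _ _ _ _ z oT (C1_tent w (8 * d)) I).
have i0 : mu2.-integrable setT (EFin \o (fun z => dweight alpha n (sqn z) * (sqn z * tent w (8 * d) z))).
  by apply: (weight_integrable (wrho_gt0 n) (wrho_lt1 n) (dweight_weight alpha n)) => z _; exact: cb.
have iF : mu2.-integrable setT (EFin \o F).
  exact: (@integrableZl _ _ _ mu2 setT measurableT c3 _ i0).
have iB := @integrable_box_cst R 1 c4.
have b0 z : 0 <= tent w (8 * d) z by exact: sqr_ge0.
have F0 z : 0 <= F z.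
  by rewrite /F mulr_ge0 ?(ltW c30)// mulr_ge0// mulr_ge0 ?sqn_ge0.
have pt z : D z -> dweight alpha n (sqn z) * \1_(odisc w (6 * d)) z <= F z + c4 * \1_(box 1) z.
  move=> Dz; have z1 := disc_sqn_lt1 Dz; rewrite indicE.
  have B0 : 0 <= c4 * \1_(box 1) z by rewrite mulr_ge0// indicE.
  have [zw|zw] := pselect (odisc w (6 * d) z); last first.
    by rewrite memNset// mulr0 addr_ge0.
  rewrite mem_set// mulr1; rewrite odiscE ?mulr_ge0 ?(ltW d0)// in zw.
  have [q4|q4] := leP (1 / 4) (sqn z).
    apply: le_trans (_ : F z <= _); last by rewrite lerDl.
    rewrite /F mulrCA ler_peMr//.
    have hb : (28 * d ^+ 2) ^+ 2 <= tent w (8 * d) z.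
      rewrite /tent /pos_sqr ler_pXn2r ?nnegrE ?le_max ?lexx//; last first.
        by rewrite mulr_ge0// sqr_ge0.
      apply/orP; right; rewrite -nrm_sqr -/(pdist z w).
      have : pdist z w ^+ 2 <= (6 * d) ^+ 2.
        by rewrite ler_pXn2r ?nnegrE ?pdist_ge0 ?mulr_ge0 ?(ltW d0)// ltW.
      by rewrite !exprMn; have := sqr_ge0 d; lra.
    have p0 : 0 < (28 * d ^+ 2) ^+ 2 by rewrite exprn_gt0// mulr_gt0// exprn_gt0.
    rewrite /c3 mulrAC ler_pdivlMr// mul1r.
    have : 1 / 4 * (28 * d ^+ 2) ^+ 2 <= sqn z * tent w (8 * d) z.
      by apply: ler_pM => //; lra.
    lra.
  apply: le_trans (_ : c4 * \1_(box 1) z <= _); last by rewrite lerDr.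
  have nz : nrm z < 1 / 2 by rewrite nrm_lt//; lra.
  have zb : box 1 z.
    by split => /=; rewrite in_itv/= -ler_norml;
      [apply: le_trans (nrm_fst z) _|apply: le_trans (nrm_snd z) _]; lra.
  rewrite indicE mem_set// mulr1.
  apply: le_trans (dweight_le alpha n z1) _; rewrite /c4 -[leLHS]mulr1.
  apply: ler_pM => //; first exact: powR_ge0.
    by rewrite /c1; have := sqn_ge0 z => ?; apply: powR_le_endpoints; lra.
  have d14 : 1 <= 14 * d.
    have := pdist_triangle w z (0, 0); rewrite !pdist0 pdist_sym; lra.
  by have := @ler_powR R (14 * d) d14 0 (alpha + 2); rewrite powRr0; apply; lra.
rewrite -(integral_weight_disc _ (wrho_gt0 n) (wrho_lt1 n) (dweight_weight alpha n)).
apply: (@le_trans _ _ (\int[mu2]_z (F z + c4 * \1_(box 1) z)%:E)%E).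
  apply: ge0_le_integral => //.
  - by move=> z _; rewrite lee_fin mulr_ge0// indicE.
  - apply/measurable_EFinP; apply: measurable_funM; first exact: measurable_sqn.
    exact: measurable_indic (open_odisc_measurable _ _).
  - by apply/measurable_EFinP; apply: measurable_funD; apply/measurable_EFinP;
      [exact: measurable_int iF|exact: measurable_int iB].
  move=> z _; rewrite lee_fin; have [Dz|Dz] := pselect (D z); first exact: pt.
  rewrite w0; first by rewrite mul0r addr_ge0// mulr_ge0// indicE.
  rewrite odiscE// pdist0 in Dz; move/negP: Dz; rewrite -leNgt => z1.
  rewrite -nrm_sqr ler_pXn2r ?nnegrE ?nrm_ge0 ?(ltW (wrho_gt0 n))//.
  exact: le_trans (ltW (wrho_lt1 n)) z1.
have iFB : mu2.-integrable setT (EFin \o (fun z => F z + c4 * \1_(box 1) z)).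
  exact: (integrableD measurableT iF iB).
rewrite -EFin_Rintegral// lee_fin RintegralD//.
rewrite (@Rintegral_box_cst R 1 c4)// /F RintegralZl//.
have hb := integral_tent_le n a1 w1 ed.
apply: le_trans (lerD (ler_wpM2l (ltW c30) hb) (lexx _)) _.
have e1 : (18 * d) `^ (alpha + 1) = 18 `^ (alpha + 1) * d `^ (alpha + 1) by rewrite powRM// ltW.
have e2 : (14 * d) `^ (alpha + 2) = 14 `^ (alpha + 2) * d `^ (alpha + 2) by rewrite powRM// ltW.
have e3 : d `^ (alpha + 2) = d `^ (alpha + 1) * d.
  rewrite -[X in _ * X](powRr1 (ltW d0)) -powRD ?(gt_eqF d0) ?implybT//.
  by congr (_ `^ _); ring.
rewrite /c3 /c4 e1 e2 e3 ek.
rewrite le_eqVlt; apply/orP; left; apply/eqP; field.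
by rewrite !gt_eqF.
Qed.

End carleson.

(** * Exponents at most 1 *)

Section small_exponents.
Context {R : realType}.
Local Notation mR := (measurableTypeR R).
Local Notation plane := (mR * mR)%type.
Local Notation mu2 := (@lebesgue_measure R \x @lebesgue_measure R)%E.
Local Notation D := (odisc (0, 0) 1 : set (R * R)).

(** The terms above the threshold [c] are dropped, so the sum is comparable to the largest term
    kept, which is at most [c]. *)
Lemma truncated_geometric (x c : R) (n : nat) : 0 < x -> x < 1 -> 0 <= c ->
  \sum_(j < n) (if x ^+ j.+1 <= c then x ^+ j.+1 else 0) <= c / (1 - x).
Proof.
move=> x0 x1; have x10 : 0 < 1 - x by rewrite subr_gt0.
elim: n c => [|n IH] c c0; first by rewrite big_ord0 divr_ge0// ltW.
rewrite big_ord_recl /= expr1.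
have tailE : \sum_(i < n) (if x ^+ (bump 0 i).+1 <= c then x ^+ (bump 0 i).+1 else 0) =
    x * \sum_(i < n) (if x ^+ i.+1 <= c / x then x ^+ i.+1 else 0).
  rewrite mulr_sumr; apply: eq_bigr => i _; rewrite /bump/= add1n (exprS x i.+1) ler_pdivlMr// [x ^+ _ * x]mulrC.
  by case: ifP => _; rewrite ?mulr0.
rewrite tailE; case: ifP => [xc|/negbT]; last first.
  rewrite -ltNge add0r => cx; apply: le_trans (_ : x * (c / x / (1 - x)) <= _).
    by rewrite ler_wpM2l ?(ltW x0)// IH// divr_ge0// ltW.
  by rewrite le_eqVlt; apply/orP; left; apply/eqP; field; rewrite !gt_eqF.
have full : \sum_(i < n) (if x ^+ i.+1 <= c / x then x ^+ i.+1 else 0) <= 1 / (1 - x) * x.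
  apply: le_trans (_ : \sum_(i < n) x ^+ i.+1 <= _).
    by apply: ler_sum => i _; case: ifP => // _; rewrite exprn_ge0// ltW.
  have -> : \sum_(i < n) x ^+ i.+1 = x * \sum_(i < n) x ^+ i.
    by rewrite mulr_sumr; apply: eq_bigr => i _; rewrite exprS.
  rewrite mulrC ler_wpM2r ?(ltW x0)// ler_pdivlMr//.
  have := subrX1 x n; rewrite -[x - 1]opprB mulNr => h.
  by have := exprn_ge0 n (ltW x0); lra.
apply: le_trans (_ : x / (1 - x) <= _); last by rewrite ler_pM2r ?invr_gt0.
have : x * \sum_(i < n) (if x ^+ i.+1 <= c / x then x ^+ i.+1 else 0) <= x * (1 / (1 - x) * x).
  by rewrite ler_wpM2l ?(ltW x0).
have -> : x / (1 - x) = x + x * (1 / (1 - x) * x) by field; rewrite gt_eqF.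
lra.
Qed.

Definition dyad (j : nat) : R := 1 - 2^-1 ^+ j.

Lemma dyad0 : dyad 0 = 0. Proof. by rewrite /dyad expr0 subrr. Qed.
Lemma half_ge0 : 0 <= (2^-1 : R). Proof. by rewrite invr_ge0. Qed.
Lemma half_lt1 : (2^-1 : R) < 1. Proof. by rewrite invf_lt1// ltr1n. Qed.
Lemma dyad_lt1 j : dyad j < 1.
Proof. by rewrite /dyad gtrBl exprn_gt0// invr_gt0. Qed.
Lemma dyad_ge0 j : 0 <= dyad j.
Proof. by rewrite subr_ge0 exprn_ile1// ?half_ge0// ltW// half_lt1. Qed.
Lemma dyadS j : dyad j.+1 - dyad j = 2^-1 ^+ j.+1.
Proof. by rewrite /dyad exprS; field. Qed.
Lemma dyad_ndecr j : dyad j <= dyad j.+1.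
Proof. by rewrite -subr_ge0 dyadS exprn_ge0// half_ge0. Qed.
Lemma dyad_cvg : dyad n @[n --> \oo] --> (1 : R).
Proof.
rewrite -[X in _ --> X]subr0; apply: cvgB; first exact: cvg_cst.
by apply: cvg_expr; rewrite ger0_norm ?half_ge0// half_lt1.
Qed.

Lemma telescope_powR (v : R * R -> R) (z : R * R) (p : R) n : 0 < p -> p <= 1 -> v (0, 0) = 0 ->
  `|v (dyad n * z.1, dyad n * z.2)| `^ p <=
  \sum_(j < n) `|v (dyad j.+1 * z.1, dyad j.+1 * z.2) - v (dyad j * z.1, dyad j * z.2)| `^ p.
Proof.
move=> p0 p1 v0; elim: n => [|n IH].
  by rewrite big_ord0 dyad0 !mul0r v0 normr0 powR0// gt_eqF.
rewrite big_ord_recr /=; apply: le_trans (lerD IH (lexx _)).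
apply: le_trans (powR_subadd p0 p1 (normr_ge0 _) (normr_ge0 _)).
apply: ge0_ler_powR; rewrite ?nnegrE ?addr_ge0 ?(ltW p0)//.
by apply: le_trans (ler_normD _ _); rewrite addrC subrK.
Qed.

Definition step_pairs (t : R) : set (plane * plane) := [set x | step_region t x.1 x.2].

Lemma measurable_step_pairs t : measurable (step_pairs t).
Proof.
have mn1 : measurable_fun setT (fun x : plane * plane => nrm x.1 : mR).
  exact: (measurableT_comp (@measurable_nrm R) measurable_fst).
have mn2 : measurable_fun setT (fun x : plane * plane => nrm x.2 : mR).
  exact: (measurableT_comp (@measurable_nrm R) measurable_snd).
have me : measurable_fun setT (fun x : plane * plane => 1 - t * nrm x.1 : mR).
  apply: measurable_funB; first exact: measurable_cst.
  by apply: measurable_funM => //; exact: measurable_cst.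
have md : measurable_fun setT (fun x : plane * plane => pdist x.2 (t * x.1.1, t * x.1.2) : mR).
  have mc (f g : plane -> mR) : measurable_fun setT f -> measurable_fun setT g ->
      measurable_fun setT (fun x : plane * plane => g x.2 - t * f x.1 : mR).
    move=> mf mg; apply: measurable_funB; first exact: (measurableT_comp mg measurable_snd).
    apply: measurable_funM; first exact: measurable_cst.
    exact: (measurableT_comp mf measurable_fst).
  have mp : measurable_fun setT (fun x : plane * plane => (x.2.1 - t * x.1.1, x.2.2 - t * x.1.2) : plane).
    by apply/measurable_fun_pairP; split;
      [exact: (mc _ _ measurable_fst measurable_fst)|exact: (mc _ _ measurable_snd measurable_snd)].
  exact: (measurableT_comp (@measurable_nrm R) mp).
have m1 : measurable_fun setT (fun x : plane * plane => nrm x.2 <= 1 - (1 - t * nrm x.1) / 2).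
  apply: measurable_fun_ler => //; apply: measurable_funB; first exact: measurable_cst.
  by apply: measurable_funM => //; exact: measurable_cst.
have m2 : measurable_fun setT (fun x : plane * plane => pdist x.2 (t * x.1.1, t * x.1.2) < 2 * (1 - t * nrm x.1)).
  by apply: measurable_fun_ltr => //; apply: measurable_funM => //; exact: measurable_cst.
rewrite (_ : step_pairs t = (setT `&` (fun x : plane * plane => nrm x.2 <= 1 - (1 - t * nrm x.1) / 2) @^-1` [set true])
   `&` (setT `&` (fun x : plane * plane => pdist x.2 (t * x.1.1, t * x.1.2) < 2 * (1 - t * nrm x.1)) @^-1` [set true])).
  by apply: measurableI; [exact: m1|exact: m2].
by rewrite !setTI; apply/seteqP; split => x.
Qed.

(** With [e = 1 - t * nrm z], a position [w] of the region satisfies [e / 2 <= 1 - nrm w <= 3 e],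
    and [z] is at distance at most [e] from [t z]. *)
Lemma step_region_bounds (t d : R) (z w : R * R) : 0 <= t -> t < 1 -> nrm z < 1 -> step_region t z w ->
  d = 1 - nrm w ->
  [/\ 0 < d, d / 3 <= 1 - t * nrm z, 1 - t <= 2 * d & pdist z w < 6 * d].
Proof.
move=> t0 t1 z1 [h1 h2] ed; have n0 := nrm_ge0 z.
have tz : t * nrm z <= t by rewrite ler_piMr// ltW.
set e := 1 - t * nrm z in h1 h2 *.
have e0 : 0 < e by rewrite /e; lra.
have ed2 : e <= 2 * d by lra.
have tri := pdist_triangle (t * z.1, t * z.2) w (0, 0).
rewrite !pdist0 pdist_sym nrm_scale// in tri.
have tri2 := pdist_triangle z (t * z.1, t * z.2) w.
have zt : pdist z (t * z.1, t * z.2) = (1 - t) * nrm z.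
  rewrite -nrm_scale; last lra.
  by rewrite /pdist/=; congr (nrm (_, _)); ring.
rewrite zt [pdist (_, _) w]pdist_sym in tri2.
have : (1 - t) * nrm z <= 1 - t by rewrite ler_piMr ?(ltW z1)//; lra.
have : 1 - t <= e by rewrite /e; lra.
by move=> ? ?; split; rewrite /e in tri h2 ed2 *; lra.
Qed.

Lemma disc_nrm (z : R * R) : D z = (nrm z < 1) :> Prop.
Proof. by rewrite odiscE// pdist0. Qed.

(** The right-hand side of [radial_step] for the step from [dyad j] to [dyad j.+1], as a function
    of the pair [(z, w)] and without its constant, times the weight at [z]. Cutting it off to the
    disc in both variables makes it measurable on the whole of [plane * plane]. *)
Definition step_kernel (p alpha : R) (u : R * R -> R) (j : nat) (x : plane * plane) : R :=
  ((fun z : plane => (1 - sqn z) `^ alpha) \_ D) x.1 *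
  ((2^-1 ^+ j.+1) `^ p * (1 - dyad j.+1 * nrm x.1) `^ (- (2 + p))) *
  (((fun w : plane => `|u w| `^ p) \_ D) x.2 * \1_(step_pairs (dyad j.+1)) x).

Lemma step_kernel_ge0 p alpha u j x : 0 <= step_kernel p alpha u j x.
Proof.
rewrite /step_kernel !patchE indicE; apply: mulr_ge0.
  by apply: mulr_ge0; [case: ifP => // _; exact: powR_ge0|rewrite mulr_ge0 ?powR_ge0].
by apply: mulr_ge0 => //; case: ifP => // _; exact: powR_ge0.
Qed.

Lemma measurable_step_kernel p alpha u j : (forall w, D w -> {for w, continuous u}) ->
  measurable_fun setT (step_kernel p alpha u j : plane * plane -> mR).
Proof.
move=> cu; have mD := @measurable_disc R 1.
have m1 : measurable_fun setT ((fun z : plane => (1 - sqn z) `^ alpha) \_ D).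
  by apply/(measurable_restrictT _ mD); exact: measurable_full_weight.
have m2 : measurable_fun setT ((fun w : plane => `|u w| `^ p) \_ D).
  by apply/(measurable_restrictT _ mD); exact: measurable_norm_powR.
have mn1 : measurable_fun setT (fun x : plane * plane => nrm x.1 : mR).
  exact: (measurableT_comp (@measurable_nrm R) measurable_fst).
apply: measurable_funM; apply: measurable_funM.
- exact: (measurableT_comp m1 measurable_fst).
- apply: measurable_funM; first exact: measurable_cst.
  apply: (measurableT_comp (measurable_powR _)).
  apply: measurable_funB; first exact: measurable_cst.
  by apply: measurable_funM => //; exact: measurable_cst.
- exact: (measurableT_comp m2 measurable_snd).
- exact: measurable_indic (measurable_step_pairs _).
Qed.

Lemma step_region_disc t z w : t * nrm z < 1 -> step_region t z w -> D w.
Proof. by rewrite disc_nrm => tz [h _]; lra. Qed.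

Lemma dyad_nrm j (z : R * R) : D z -> dyad j * nrm z < 1.
Proof.
rewrite disc_nrm => z1; apply: le_lt_trans (dyad_lt1 j).
by rewrite ler_piMr ?dyad_ge0// ltW.
Qed.

(** [radial_step] applies because the step [2^-1 ^+ j.+1] is exactly the remaining distance
    [1 - dyad j.+1]. *)
Lemma step_kernel_dominates (p alpha : R) : 0 < p -> p <= 1 -> exists2 C : R, 0 < C &
  forall (u ux uy v vx vy : R * R -> R) (j : nat) (z : R * R),
    harmonic_with D u ux uy -> harmonic_with D v vx vy ->
    (forall w, D w -> vx w ^+ 2 + vy w ^+ 2 <= ux w ^+ 2 + uy w ^+ 2) -> D z ->
  (((1 - sqn z) `^ alpha * `|v (dyad j.+1 * z.1, dyad j.+1 * z.2) - v (dyad j * z.1, dyad j * z.2)| `^ p)%:E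
   <= C%:E * \int[mu2]_w (step_kernel p alpha u j (z, w))%:E)%E.
Proof.
move=> p0 p1; have [C C0 hC] := radial_step p0 p1; exists C => //.
move=> u ux uy v vx vy j z hu hv sub Dz; have z1 : nrm z < 1 by rewrite -disc_nrm.
set t := dyad j.+1; set s := dyad j.
have cu w : D w -> {for w, continuous u} by exact: (harmonic_continuous hu).
have tz := dyad_nrm j.+1 Dz; rewrite -/t in tz.
have ts : t - s <= 1 - t by rewrite dyadS /t /dyad opprB addrCA subrr addr0.
have := hC u ux uy v vx vy s t z hu hv sub z1 (dyad_ge0 j) (dyad_ndecr j) (dyad_lt1 j.+1) ts.
rewrite [t - s]dyadS => h.
have om0 : 0 <= (1 - sqn z) `^ alpha by exact: powR_ge0.
apply: le_trans (_ : ((1 - sqn z) `^ alpha)%:E * ((C * (2^-1 ^+ j.+1) `^ p / (1 - t * nrm z) `^ (2 + p))%:E *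
   \int[mu2]_(w in step_region t z) (`|u w| `^ p)%:E) <= _)%E.
  by rewrite EFinM; apply: lee_wpmul2l h; rewrite lee_fin.
rewrite le_eqVlt; apply/orP; left; apply/eqP.
have mreg : measurable (step_region t z : set plane) by apply: measurable_step_region; exact: ltW.
have regD w : step_region t z w -> D w by exact: step_region_disc.
have mU : measurable_fun setT (((fun w : plane => `|u w| `^ p)) \_ D).
  by apply/(measurable_restrictT _ (@measurable_disc R 1)); exact: measurable_norm_powR.
rewrite integral_mkcond.
have -> : (\int[mu2]_w ((fun w => (`|u w| `^ p)%:E) \_ (step_region t z)) w =
   \int[mu2]_w (((fun w : plane => `|u w| `^ p) \_ D) w * \1_(step_region t z) w)%:E)%E.
  apply: eq_integral => w _; rewrite !patchE indicE.
  have [wr|wr] := pselect (step_region t z w).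
    by rewrite !mem_set// ?mulr1//; exact: regD.
  by rewrite memNset// mulr0.
have pos w : (0 <= (((fun w : plane => `|u w| `^ p) \_ D) w * \1_(step_region t z) w)%:E)%E.
  rewrite lee_fin indicE patchE mulr_ge0//; case: ifP => // _; exact: powR_ge0.
have mUr : measurable_fun setT (fun w : plane => (((fun w : plane => `|u w| `^ p) \_ D) w * \1_(step_region t z) w)%:E).
  by apply/measurable_EFinP; apply: measurable_funM => //; exact: measurable_indic mreg.
rewrite muleA -EFinM.
have k0 : 0 <= (1 - sqn z) `^ alpha * ((2^-1 ^+ j.+1) `^ p * (1 - t * nrm z) `^ (- (2 + p))).
  by rewrite !mulr_ge0// ?powR_ge0// mulr_ge0// powR_ge0.
have -> : (\int[mu2]_w (step_kernel p alpha u j (z, w))%:E =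
   ((1 - sqn z) `^ alpha * ((2^-1 ^+ j.+1) `^ p * (1 - t * nrm z) `^ (- (2 + p))))%:E *
   \int[mu2]_w (((fun w : plane => `|u w| `^ p) \_ D) w * \1_(step_region t z) w)%:E)%E.
  rewrite -ge0_integralZl_EFin//; apply: eq_integral => w _.
  rewrite -EFinM /step_kernel /= [X in (X * _ * _)%:E]patchE mem_set//.
rewrite muleA -EFinM; congr (_%:E * _)%E; rewrite powRN; ring.
Qed.

Lemma step_kernel_out p alpha u j z w : ~ D w -> step_kernel p alpha u j (z, w) = 0 :> R.
Proof.
by move=> Dw; rewrite /step_kernel /= [X in _ * (X * _)]patchE memNset// mul0r mulr0.
Qed.

(** For a fixed position [w] the kernel only sees points [z] at distance less than
    [6 (1 - nrm w)], whose weight is estimated by [carleson], and only steps of length at most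
    [2 (1 - nrm w)]. *)
Lemma step_kernel_column (p alpha : R) : 0 < p -> -1 < alpha -> exists2 C : R, 0 < C &
  forall u j w, D w -> (forall w, D w -> {for w, continuous u}) ->
  (\int[mu2]_z (step_kernel p alpha u j (z, w))%:E <=
   (C * (1 - nrm w) `^ (alpha - p) * `|u w| `^ p *
     (if 2^-1 ^+ j.+1 <= 2 * (1 - nrm w) then (2^-1 ^+ j.+1) `^ p else 0))%:E)%E.
Proof.
move=> p0 a1; have [C C0 hC] := carleson a1.
exists (3 `^ (2 + p) * C); first by rewrite mulr_gt0// powR_gt0.
move=> u j w Dw cu; have w1 : nrm w < 1 by rewrite -disc_nrm.
set d := 1 - nrm w; have d0 : 0 < d by rewrite subr_gt0.
set tau := 2^-1 ^+ j.+1; pose t : R := dyad j.+1.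
have et : 1 - t = tau by rewrite /t /dyad opprB addrCA subrr addr0.
pose T : R := if tau <= 2 * d then tau `^ p else 0.
have T0 : 0 <= T by rewrite /T; case: ifP => // _; exact: powR_ge0.
pose k : R := T * (d / 3) `^ (- (2 + p)) * `|u w| `^ p.
have k0 : 0 <= k by rewrite /k !mulr_ge0// powR_ge0.
have mD := @measurable_disc R 1.
have mC : measurable_fun D (fun z : plane => ((1 - sqn z) `^ alpha * \1_(odisc w (6 * d)) z)%:E).
  apply/measurable_EFinP; apply: measurable_funM; first exact: measurable_full_weight.
  by apply: measurable_funTS; exact: measurable_indic (open_odisc_measurable _ _).
have C0' z : D z -> (0 <= ((1 - sqn z) `^ alpha * \1_(odisc w (6 * d)) z)%:E)%E.
  by move=> _; rewrite lee_fin mulr_ge0 ?powR_ge0// indicE.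
have mK := measurable_step_kernel p alpha j cu.
have mKw : measurable_fun setT (fun z : plane => (step_kernel p alpha u j (z, w))%:E).
  by apply/measurable_EFinP; exact: (measurableT_comp mK (pair2_measurable w)).
apply: (@le_trans _ _ (\int[mu2]_(z in D) (k%:E * ((1 - sqn z) `^ alpha * \1_(odisc w (6 * d)) z)%:E))%E).
  rewrite [leRHS]integral_mkcond; apply: ge0_le_integral => //.
  - by move=> z _; rewrite lee_fin step_kernel_ge0.
  - by apply/(measurable_restrictT _ mD); exact: emeasurable_funM.
  move=> z _; rewrite patchE; case: ifPn => [|Dz]; last first.
    by rewrite /step_kernel /= [X in (X * _ * _)%:E]patchE (negbTE Dz) !mul0r.
  rewrite inE => Dz; rewrite -EFinM lee_fin /step_kernel /= !patchE !mem_set//.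
  rewrite [\1_(step_pairs _) _]indicE; have [zw|zw] := pselect (step_pairs t (z, w)); last first.
    rewrite memNset// mulr0 mulr0 mulr_ge0// mulr_ge0 ?powR_ge0// indicE//.
  rewrite mem_set// mulr1.
  have z1 : nrm z < 1 by rewrite -disc_nrm.
  have [_ b2 b3 b4] := step_region_bounds (dyad_ge0 j.+1) (dyad_lt1 j.+1) z1 zw (erefl d).
  rewrite -/t et in b2 b3.
  rewrite indicE mem_set ?mulr1; last by rewrite odiscE// mulr_ge0// ltW.
  rewrite /k /T b3 -/t -/tau.
  have -> : tau `^ p * (d / 3) `^ (- (2 + p)) * `|u w| `^ p * (1 - sqn z) `^ alpha =
     (1 - sqn z) `^ alpha * (tau `^ p * (d / 3) `^ (- (2 + p))) * `|u w| `^ p by ring.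
  apply: ler_wpM2r; first exact: powR_ge0.
  apply: ler_wpM2l; first exact: powR_ge0.
  apply: ler_wpM2l; first exact: powR_ge0.
  have d3 : 0 < d / 3 by rewrite divr_gt0.
  rewrite !powRN lef_pV2 ?posrE ?powR_gt0//; last exact: lt_le_trans b2.
  have y0 := le_trans (ltW d3) b2; have q0 : 0 <= 2 + p by rewrite addr_ge0// ltW.
  by apply: ge0_ler_powR; rewrite ?nnegrE// ltW.
rewrite ge0_integralZl_EFin//.
apply: (le_trans (lee_wpmul2l _ (hC w d w1 erefl))); first by rewrite lee_fin.
rewrite -EFinM lee_fin /k -/tau -/T.
have e1 : (d / 3) `^ (- (2 + p)) * d `^ (alpha + 2) = 3 `^ (2 + p) * d `^ (alpha - p).
  rewrite powRM ?invr_ge0 ?(ltW d0)// -[3^-1]powR_inv1// -powRrM mulN1r opprK.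
  rewrite mulrAC -powRD; last by rewrite (gt_eqF d0) implybT.
  by rewrite mulrC; congr (_ * _ `^ _); ring.
rewrite le_eqVlt; apply/orP; left; apply/eqP.
rewrite [LHS](_ : _ = T * ((d / 3) `^ (- (2 + p)) * d `^ (alpha + 2)) * `|u w| `^ p * C); last by ring.
by rewrite e1; ring.
Qed.

Lemma powR_dist_le (alpha : R) (w : R * R) : D w ->
  (1 - nrm w) `^ alpha <= (1 + 2^-1 `^ alpha) * (1 - sqn w) `^ alpha.
Proof.
rewrite disc_nrm => w1; have n0 := nrm_ge0 w.
have d0 : 0 < 1 - nrm w by rewrite subr_gt0.
have e : 1 - sqn w = (1 - nrm w) * (1 + nrm w) by rewrite -nrm_sqr; ring.
have q0 : 0 < 1 - sqn w by rewrite e mulr_gt0//; lra.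
have h1 : 2^-1 * (1 - sqn w) <= 1 - nrm w.
  have : (1 - nrm w) * (1 + nrm w) <= (1 - nrm w) * 2 by rewrite ler_wpM2l ?(ltW d0)//; lra.
  by rewrite -e; lra.
have h2 : 1 - nrm w <= 1 - sqn w.
  by rewrite e ler_peMr ?(ltW d0)//; lra.
apply: le_trans (powR_le_endpoints alpha _ h1 h2) _; first by rewrite mulr_gt0.
by rewrite powRM ?(ltW q0)//; lra.
Qed.

Lemma cvg_norm_powR (a : nat -> R) (l p : R) : 0 < p ->
  a n @[n --> \oo] --> l -> `|a n| `^ p @[n --> \oo] --> `|l| `^ p.
Proof.
move=> p0 al; have aN : `|a n| @[n --> \oo] --> `|l| by exact: cvg_norm.
have [l0|l0] := eqVneq l 0; last first.
  have l1 : 0 < `|l| by rewrite normr_gt0.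
  exact: (cvg_comp _ _ aN (is_derive_continuous (is_derive1_powR p l1))).
rewrite l0 normr0 powR0 ?(gt_eqF p0)//; apply/cvgr0Pnorm_lt => e e0.
have d0 : 0 < e `^ p^-1 by rewrite powR_gt0.
rewrite l0 in al; have h := cvgr0_norm_lt _ al _ d0 : \forall n \near \oo, `|a n| < e `^ p^-1.
have [N _ hN] := h; exists N => // n /hN /= an; rewrite ger0_norm ?powR_ge0//.
have -> : e = (e `^ p^-1) `^ p by rewrite -powRrM mulVf ?powRr1 ?(ltW e0)// gt_eqF.
by apply: gt0_ltr_powR; rewrite ?nnegrE ?normr_ge0 ?powR_ge0.
Qed.

(** The planar measure once more, as a sigma-finite measure: this is what Tonelli asks for on
    [plane * plane]. *)
Definition plane_measure : set plane -> \bar R := mu2.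
HB.instance Definition _ := Measure.on plane_measure.

Lemma plane_measure_sigma_finite : sigma_finite setT plane_measure.
Proof.
have /sigma_finiteP[F [TF ndF Foo]] := sigma_finiteT (@lebesgue_measure R).
exists (fun n => F n `*` F n).
  rewrite -setXTT TF predeqE => -[x y]; split.
    move=> [/= [n _ Fnx] [k _ Fky]]; exists (maxn n k) => //; split.
    - by move: x Fnx; exact/subsetPset/ndF/leq_maxl.
    - by move: y Fky; exact/subsetPset/ndF/leq_maxr.
  by move=> [n _ []/= ? ?]; split; exists n.
move=> k; have [mF oF] := Foo k; split; first exact: measurableX.
rewrite /plane_measure product_measure1E//; apply: lte_mul_pinfty => //.
by rewrite ge0_fin_numE.
Qed.

HB.instance Definition _ := Measure_isSigmaFinite.Build _ _ _ plane_measure plane_measure_sigma_finite.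

(** [col] is the sum over the steps at a fixed position [w], where the geometric series appears;
    [bound] exchanges sum and integrals to estimate the dilation of [v] by [dyad n]; Fatou's lemma
    then lets [n] tend to infinity. *)
Lemma small_disc (p alpha : R) : 0 < p -> p <= 1 -> -1 < alpha -> exists2 C : R, 0 < C &
  forall u ux uy v vx vy : R * R -> R,
  harmonic_with D u ux uy -> harmonic_with D v vx vy ->
  (forall w, D w -> vx w ^+ 2 + vy w ^+ 2 <= ux w ^+ 2 + uy w ^+ 2) -> v (0, 0) = 0 ->
  (\int[mu2]_(z in D) ((1 - sqn z) `^ alpha * `|v z| `^ p)%:E <=
   C%:E * \int[mu2]_(z in D) ((1 - sqn z) `^ alpha * `|u z| `^ p)%:E)%E.
Proof.
move=> p0 p1 a1.
have [C1 C10 hdom] := step_kernel_dominates alpha p0 p1.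
have [C2 C20 hcol] := step_kernel_column p0 a1.
pose x : R := 2^-1 `^ p.
have x0 : 0 < x by rewrite powR_gt0.
have x1 : x < 1.
  have := gt0_ltr_powR p0 (_ : 2^-1 \in Num.nneg) (_ : (1:R) \in Num.nneg) (half_lt1).
  by rewrite !nnegrE powR1; apply; rewrite ?half_ge0.
pose C3 : R := C2 * (2 `^ p / (1 - x)) * (1 + 2^-1 `^ alpha).
have C30 : 0 < C3.
  have q1 : 0 < 1 - x by rewrite subr_gt0.
  have q2 : 0 < 1 + 2^-1 `^ alpha :> R by rewrite addr_gt0// powR_gt0// invr_gt0.
  by rewrite /C3 !mulr_gt0 ?invr_gt0 ?powR_gt0.
exists (C1 * C3); first exact: mulr_gt0.
move=> u ux uy v vx vy hu hv sub v0.
have mD := @measurable_disc R 1.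
have cu w : D w -> {for w, continuous u} by exact: (harmonic_continuous hu).
have cv w : D w -> {for w, continuous v} by exact: (harmonic_continuous hv).
set I := (\int[mu2]_(z in D) ((1 - sqn z) `^ alpha * `|u z| `^ p)%:E)%E.
pose f n (z : plane) := ((1 - sqn z) `^ alpha * `|v (dyad n * z.1, dyad n * z.2)| `^ p)%:E.
pose g j (z : plane) := ((1 - sqn z) `^ alpha *
  `|v (dyad j.+1 * z.1, dyad j.+1 * z.2) - v (dyad j * z.1, dyad j * z.2)| `^ p)%:E.
have cdil n w : D w -> {for w, continuous (fun z => v (dyad n * z.1, dyad n * z.2))}.
  move=> Dw; apply: (continuous_pair2 (a := fun z : R * R => dyad n * z.1) (b := fun z : R * R => dyad n * z.2)).
  - by apply: cvgM; [exact: cvg_cst|exact: cvg_fst].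
  - by apply: cvgM; [exact: cvg_cst|exact: cvg_snd].
  - by apply: cv; rewrite disc_nrm nrm_scale ?dyad_ge0// dyad_nrm.
have mf n : measurable_fun D (f n).
  apply/measurable_EFinP; apply: measurable_funM; first exact: measurable_full_weight.
  exact: measurable_norm_powR (cdil n).
have mg j : measurable_fun D (g j).
  apply/measurable_EFinP; apply: measurable_funM; first exact: measurable_full_weight.
  apply: (measurable_norm_powR (v := fun z => v (dyad j.+1 * z.1, dyad j.+1 * z.2) - v (dyad j * z.1, dyad j * z.2))).
  by move=> w Dw; apply: cvgB; exact: cdil.
have f0 n z : D z -> (0 <= f n z)%E by move=> _; rewrite lee_fin mulr_ge0// powR_ge0.
have g0 n z : D z -> (0 <= g n z)%E by move=> _; rewrite lee_fin mulr_ge0// powR_ge0.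
pose K j (y : plane * plane) := (step_kernel p alpha u j y)%:E.
have mK j : measurable_fun setT (K j).
  by apply/measurable_EFinP; exact: measurable_step_kernel.
have K0 j y : (0 <= K j y)%E by rewrite lee_fin step_kernel_ge0.
pose H j (w : plane) := (\int[mu2]_z K j (z, w))%E.
have mH j : measurable_fun setT (H j) by exact: (measurable_fun_fubini_tonelli_G (m1 := plane_measure) (K j) (mK j) (K0 j)).
have H0 j w : (0 <= H j w)%E by apply: integral_ge0 => z _.
have col n w : (\sum_(j < n) H j w <=
    ((fun w => (C3 * ((1 - sqn w) `^ alpha * `|u w| `^ p))%:E) \_ D) w)%E.
  rewrite patchE; case: ifPn => [|Dw]; last first.
    rewrite big1// => j _; rewrite /H integral0_eq// => z _.
    by rewrite /K step_kernel_out//; move/mem_set; exact/negP.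
  rewrite inE => Dw; set d := 1 - nrm w.
  have d0 : 0 < d by rewrite subr_gt0 -disc_nrm.
  apply: (@le_trans _ _ (\sum_(j < n) (C2 * d `^ (alpha - p) * `|u w| `^ p *
      (if 2^-1 ^+ j.+1 <= 2 * d then (2^-1 ^+ j.+1) `^ p else 0))%:E)%E).
    by apply: lee_sum => j _; exact: (hcol).
  rewrite sumEFin lee_fin -mulr_sumr.
  have c0 : 0 <= (2 * d) `^ p by exact: powR_ge0.
  have geom : \sum_(j < n) (if 2^-1 ^+ j.+1 <= 2 * d then ((2^-1 : R) ^+ j.+1) `^ p else 0) <= (2 * d) `^ p / (1 - x).
    apply: le_trans (truncated_geometric n x0 x1 c0); apply: ler_sum => j _.
    have ej : ((2^-1 : R) ^+ j.+1) `^ p = x ^+ j.+1.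
      by rewrite /x -(powR_mulrn _ half_ge0) -powRrM mulrC powRrM powR_mulrn ?powR_ge0.
    case: ifP => h; last by case: ifP => // _; rewrite exprn_ge0// ltW.
    rewrite ifT ?ej// -ej; apply: ge0_ler_powR; rewrite ?nnegrE ?(ltW p0)//.
    - by rewrite mulr_ge0// ltW.
  have k0 : 0 <= C2 * d `^ (alpha - p) * `|u w| `^ p by rewrite !mulr_ge0 ?powR_ge0 ?(ltW C20).
  apply: le_trans (ler_wpM2l k0 geom) _.
  have e1 : d `^ (alpha - p) * (2 * d) `^ p = 2 `^ p * d `^ alpha.
    rewrite powRM ?(ltW d0)// mulrCA -powRD ?subrK//.
    by rewrite (gt_eqF d0) implybT.
  rewrite [leLHS](_ : _ = C2 * (2 `^ p / (1 - x)) * d `^ alpha * `|u w| `^ p); last first.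
    transitivity (C2 * (d `^ (alpha - p) * (2 * d) `^ p) / (1 - x) * `|u w| `^ p); first by ring.
    by rewrite e1; ring.
  rewrite [leRHS]mulrA; apply: ler_wpM2r; first exact: powR_ge0.
  rewrite /C3 -[leRHS]mulrA; apply: ler_wpM2l; last exact: powR_dist_le.
  by rewrite mulr_ge0 ?(ltW C20)// divr_ge0 ?powR_ge0// subr_ge0 ltW.
have bound n : (\int[mu2]_(z in D) f n z <= (C1 * C3)%:E * I)%E.
  apply: (@le_trans _ _ (\sum_(j < n) \int[mu2]_(z in D) g j z)%E).
    rewrite -(ge0_integral_sum mu2 mD (fun j : 'I_n => mg j) (fun j => @g0 j)); apply: ge0_le_integral => //.
    - exact: (f0).
    - exact: (mf).
    - by apply: emeasurable_sum => j; exact: (mg).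
    move=> z Dz; rewrite sumEFin lee_fin -mulr_sumr ler_wpM2l ?powR_ge0//.
    exact: telescope_powR.
  apply: (@le_trans _ _ (\sum_(j < n) C1%:E * \int[mu2]_w H j w)%E).
    apply: lee_sum => j _.
    have -> : (\int[mu2]_w H j w = \int[mu2]_z \int[mu2]_w K j (z, w))%E.
      by rewrite /H -(fubini_tonelli (m1 := plane_measure) (m2 := plane_measure) (K j) (mK j) (K0 j)).
    have mF : measurable_fun setT (fun z : plane => \int[mu2]_w K j (z, w))%E.
      exact: (measurable_fun_fubini_tonelli_F (m2 := plane_measure) (K j) (mK j) (K0 j)).
    have F0 z : (0 <= \int[mu2]_w K j (z, w))%E by exact: integral_ge0.
    rewrite -ge0_integralZl_EFin ?(ltW C10)//.
    apply: (@le_trans _ _ (\int[mu2]_(z in D) (C1%:E * \int[mu2]_w K j (z, w)))%E).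
      apply: ge0_le_integral => //.
      - by move=> z Dz; exact: (g0).
      - exact: (mg).
      - by apply: measurable_funTS; exact: emeasurable_funM.
      by move=> z Dz; exact: (hdom u ux uy v vx vy).
    apply: ge0_subset_integral => //; first exact: emeasurable_funM.
    by move=> z _; rewrite mule_ge0// lee_fin ltW.
  rewrite -ge0_sume_distrr; last by move=> j _; exact: integral_ge0.
  rewrite EFinM -muleA lee_pmul2l// -(ge0_integral_sum mu2 measurableT (fun j : 'I_n => mH j) (fun j w _ => H0 j w)) /I -ge0_integralZl_EFin ?(ltW C30)//; last first.
  - apply/measurable_EFinP; apply: measurable_funM; first exact: measurable_full_weight.
    exact: measurable_norm_powR cu.
  - by move=> z _; rewrite lee_fin mulr_ge0 ?powR_ge0.
  rewrite [leRHS]integral_mkcond; apply: ge0_le_integral => //.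
  - by move=> w _; apply: sume_ge0.
  - exact: emeasurable_sum.
  - apply/(measurable_restrictT _ mD); apply/measurable_EFinP; apply: measurable_funM => //.
    apply: measurable_funM; first exact: measurable_full_weight.
    exact: measurable_norm_powR cu.
  by move=> w _; apply: le_trans (col n w) _; rewrite !patchE; case: ifP.
apply: (@le_trans _ _ (\int[mu2]_(z in D) limn_einf (f^~ z))%E).
  rewrite le_eqVlt; apply/orP; left; apply/eqP; apply: eq_integral => z; rewrite inE => Dz.
  have lim : f n z @[n --> \oo] --> ((1 - sqn z) `^ alpha * `|v z| `^ p)%:E.
    apply: cvg_EFin; first exact: nearW.
    apply: cvgM; first exact: cvg_cst.
    apply: cvg_norm_powR => //.
    have hz : (dyad n * z.1, dyad n * z.2) @[n --> \oo] --> (z.1, z.2).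
      have h1 : dyad n * z.1 @[n --> \oo] --> z.1.
        by rewrite -[X in _ --> X]mul1r; apply: cvgM; [exact: dyad_cvg|exact: cvg_cst].
      have h2 : dyad n * z.2 @[n --> \oo] --> z.2.
        by rewrite -[X in _ --> X]mul1r; apply: cvgM; [exact: dyad_cvg|exact: cvg_cst].
      exact: (@cvg_pair _ _ _ (nbhs \oo) (nbhs z.1) (nbhs z.2) _ _ _ _ _ h1 h2).
    by move: hz; rewrite -surjective_pairing => hz; exact: (cvg_comp _ _ hz (cv z Dz)).
  by rewrite is_cvg_limn_einfE ?(cvg_lim _ lim)//; apply/cvg_ex; eexists; exact: lim.
apply: le_trans (fatou mu2 mD mf f0) _; rewrite limn_einf_lim.
apply: lime_le; first exact: is_cvg_einfs.
by apply: nearW => n; apply: le_trans (bound n); apply: ereal_inf_lbound; exists n => /=.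
Qed.

End small_exponents.

(** * Gradients of the parts of a quasiregular function *)

Section complex_part.
Context {R : realType}.
Local Open Scope complex_scope.
Local Notation D := (odisc (0, 0) 1 : set (R * R)).
Local Notation Re := (@complex.Re R).
Local Notation Im := (@complex.Im R).

Lemma cabsE (z : R[i]) : cabs z = Num.sqrt (Re z ^+ 2 + Im z ^+ 2).
Proof. by rewrite /cabs normc_def. Qed.

Lemma cabs_norm (z : R[i]) : (cabs z)%:C = `|z|.
Proof. by rewrite /cabs normc_def. Qed.

Lemma cabsM (z w : R[i]) : cabs (z * w) = cabs z * cabs w.
Proof. by apply: complexI; rewrite rmorphM /= !cabs_norm normrM. Qed.

Lemma cabsD (z w : R[i]) : cabs (z + w) <= cabs z + cabs w.
Proof. by rewrite -lecR rmorphD /= !cabs_norm ler_normD. Qed.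

Lemma cabsN (z : R[i]) : cabs (- z) = cabs z.
Proof. by apply: complexI; rewrite !cabs_norm normrN. Qed.

Lemma cabs_real (x : R) : cabs x%:C = `|x|.
Proof. by rewrite cabsE /= expr0n addr0 sqrtr_sqr. Qed.

Lemma cabs_of_plane (w : R * R) : cabs (of_plane w) = nrm w.
Proof. by rewrite cabsE. Qed.

Lemma Re_le_cabs (z : R[i]) : `|Re z| <= cabs z.
Proof. by rewrite -lecR cabs_norm normc_ge_Re. Qed.

Lemma Im_le_cabs (z : R[i]) : `|Im z| <= cabs z.
Proof. by rewrite cabsE -sqrtr_sqr; apply: ler_wsqrtr; rewrite lerDr sqr_ge0. Qed.

Lemma unit_disk_planeE : @unit_disk_plane R = D.
Proof.
apply/funext => w; apply/propext; rewrite disc_nrm -cabs_of_plane; split => //.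
Qed.

Lemma complex_quotient (h : R[i] -> R[i]) (z : R[i]) (e : R) :
  derivable (h : R[i]^o -> R[i]^o) z 1 -> 0 < e -> exists2 d : R, 0 < d &
  forall k, k != 0 -> cabs k < d -> cabs (k^-1 * (h (k + z) - h z) - cderiv h z) < e.
Proof.
move=> dh e0; have ec : 0 < e%:C by rewrite ltcR.
have /cvgrPdist_lt/(_ _ ec)/nbhs_ballP[d /= d0 hd] := dh.
have de : d = (complex.Re d)%:C.
  by move: d0; rewrite ltcE /= => /andP[/eqP]; case: (d) => a b /= ->.
exists (Re d); first by move: d0; rewrite ltcE => /andP[].
move=> k k0 kd; have := hd k; rewrite /ball/= sub0r normrN => /(_ _ k0).
rewrite -cabs_norm {1}de ltcR => /(_ kd).
by rewrite -cabs_norm ltcR -cabsN opprB [k *: 1]mulr1.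
Qed.

(** Restricting a complex derivative to a real line with unit direction [c] multiplies it by
    [c]. *)
Lemma is_derive_complex (h : R[i] -> R[i]) (g : R -> R[i]) (c : R[i]) (t a b : R) : cabs c = 1 ->
  (forall s, g s = (s - t)%:C * c + g t) -> derivable (h : R[i]^o -> R[i]^o) (g t) 1 ->
  c * cderiv h (g t) = a +i* b ->
  is_derive t 1 (fun s => Re (h (g s))) a /\ is_derive t 1 (fun s => Im (h (g s))) b.
Proof.
move=> c1 gE dh ab.
have c0 : c != 0 by apply/negP => /eqP cz; move: c1; rewrite cz cabs_real normr0 => /esym/eqP; rewrite oner_eq0.
have key (e : R) : 0 < e -> exists2 d : R, 0 < d & forall s, s != 0 -> `|s| < d ->
    cabs ((s^-1)%:C * (h (g (s *: 1 + t)) - h (g t)) - c * cderiv h (g t)) < e.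
  move=> e0; have [d d0 hd] := complex_quotient dh e0; exists d => // s s0 sd.
  pose k := s%:C * c.
  have k0 : k != 0 by rewrite mulf_neq0// fmorph_eq0.
  have := hd k k0; rewrite cabsM c1 mulr1 cabs_real => /(_ sd).
  rewrite (gE (s *: 1 + t)) addrK [s *: 1]mulr1 -/k; apply: le_lt_trans.
  have -> : (s^-1)%:C = c * k^-1 :> R[i].
    by rewrite /k invfM mulrC mulfVK// fmorphV.
  by rewrite -mulrA -mulrBr cabsM c1 mul1r.
have lim (P : R[i] -> R) : (forall z, `|P z| <= cabs z) -> {morph P : x y / x - y} ->
    (forall (s : R) z, P (s%:C * z) = s * P z) ->
    is_derive t 1 (fun s => P (h (g s))) (P (c * cderiv h (g t))).
  move=> Ple PB PZ.
  have lim : s^-1 *: (P (h (g (s *: 1 + t))) - P (h (g t))) @[s --> 0^'] --> P (c * cderiv h (g t)).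
    apply/cvgrPdist_lt => e e0; have [d d0 hd] := key e e0.
    apply/nbhs_ballP; exists d => //= s; rewrite /ball/= sub0r normrN => sd s0.
    rewrite distrC; apply: le_lt_trans (hd s s0 sd).
    by apply: le_trans (Ple _); rewrite PB PZ PB.
  apply: DeriveDef; first by apply/cvg_ex; eexists; exact: lim.
  exact: (cvg_lim _ lim).
have -> : a = Re (c * cderiv h (g t)) by rewrite ab.
have -> : b = Im (c * cderiv h (g t)) by rewrite ab.
split; apply: lim; [exact: Re_le_cabs|by move=> [? ?] [? ?]| |exact: Im_le_cabs|by move=> [? ?] [? ?]|].
- by move=> s [? ?] /=; rewrite mul0r subr0.
- by move=> s [? ?] /=; rewrite mul0r addr0.
Qed.

(** A directional derivative along a coordinate axis is the derivative of the restriction to a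
    line, which is the form recorded by [C1]. *)
Lemma real_harmonic_with (u : R * R -> R) : real_harmonic_on D u ->
  harmonic_with D u (partial_x u) (partial_y u).
Proof.
have toC1 (w : R * R -> R) : C1_on D w -> C1 D w (partial_x w) (partial_y w).
  move=> cw z Dz; have [dx dy cx cy] := cw z Dz; split; [| |exact: cx|exact: cy].
  - have e : (fun h : R => h^-1 *: (w (h *: (1 : R) + z.1, z.2) - w (z.1, z.2))) =
        (fun h : R => h^-1 *: (w (h *: ((1, 0) : R * R) + z) - w z)).
      apply/funext => h; rewrite -surjective_pairing; congr (_ *: (w _ - _)).
      by case: (z) => a b; congr pair; rewrite /= scaler0 add0r.
    by apply: DeriveDef; rewrite /derivable /partial_x /derive e.
  - have e : (fun h : R => h^-1 *: (w (z.1, h *: (1 : R) + z.2) - w (z.1, z.2))) =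
        (fun h : R => h^-1 *: (w (h *: ((0, 1) : R * R) + z) - w z)).
      apply/funext => h; rewrite -surjective_pairing; congr (_ *: (w _ - _)).
      by case: (z) => a b; congr pair; rewrite /= scaler0 add0r.
    by apply: DeriveDef; rewrite /derivable /partial_y /derive e.
move=> [[cu cx cy] lap].
exists (partial_x (partial_x u)), (partial_y (partial_x u)), (partial_x (partial_y u)), (partial_y (partial_y u)).
split; [exact: (toC1 _ cu)|exact: (toC1 _ cx)|exact: (toC1 _ cy)|exact: lap].
Qed.

Lemma derive_real_comb (f F G : R -> R) (t s a b c : R) :
  (\forall x \near t, f x = F x + s * G x) ->
  is_derive t 1 f a -> is_derive t 1 F b -> is_derive t 1 G c -> a = b + s * c.
Proof.
move=> e fa Fb Gc.
have d : is_derive t 1 (F + s *: G) (b + s *: c) by exact: is_deriveD Fb (is_deriveZ s Gc).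
have e' : \forall x \near t, f x = (F + s *: G) x by exact: e.
have [_ <-] := near_eq_is_derive e' fa.
by case: d.
Qed.

(** Along the line [x |-> x + iy] the analytic parts of [f = h + conj g] have complex slope
    [h'] and [g'], and along [y |-> x + iy] slope [ih'] and [ig']; comparing real and imaginary
    parts gives the gradients of [Re f] and [Im f]. *)
Lemma gradient_decomposition (f h g : R[i] -> R[i]) (w : R * R) :
  let u w := Re (f (of_plane w)) in let v w := Im (f (of_plane w)) in
  let H := cderiv h (of_plane w) in let G := cderiv g (of_plane w) in
  canonical_decomposition f h g ->
  C1 D u (partial_x u) (partial_y u) -> C1 D v (partial_x v) (partial_y v) -> D w ->
  [/\ partial_x u w = Re H + Re G, partial_y u w = - Im H - Im G,
      partial_x v w = Im H - Im G & partial_y v w = Re H - Re G].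
Proof.
case: w => x y u v H G [ah ag _ fE] Cu Cv Dw.
have [/= ux uy _ _] := Cu _ Dw; have [/= vx vy _ _] := Cv _ Dw.
have Ddisk z : D z -> unit_disk (of_plane z) by rewrite -unit_disk_planeE.
have dh := ah _ (Ddisk _ Dw); have dg := ag _ (Ddisk _ Dw).
have gx (s : R) : of_plane (s, y) = (s - x)%:C * 1 + of_plane (x, y) :> R[i].
  by apply/eqP; rewrite eq_complex /=; apply/andP; split; apply/eqP; ring.
have gy (s : R) : of_plane (x, s) = (s - y)%:C * 'i%C + of_plane (x, y) :> R[i].
  by apply/eqP; rewrite eq_complex /=; apply/andP; split; apply/eqP; ring.
have ci : cabs ('i%C : R[i]) = 1 by rewrite cabsE /= expr0n add0r expr1n sqrtr1.
have c1 : cabs (1 : R[i]) = 1 by rewrite (cabs_real 1) normr1.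
have i1 (z : R[i]) : 1 * z = Re z +i* Im z by rewrite mul1r; case: z.
have ii (z : R[i]) : 'i%C * z = - Im z +i* Re z.
  by case: z => a b; apply/eqP; rewrite eq_complex /=; apply/andP; split; apply/eqP; ring.
have [hxr hxi] := is_derive_complex (g := fun s => of_plane (s, y)) c1 gx dh (i1 H).
have [gxr gxi] := is_derive_complex (g := fun s => of_plane (s, y)) c1 gx dg (i1 G).
have [hyr hyi] := is_derive_complex (g := fun s => of_plane (x, s)) ci gy dh (ii H).
have [gyr gyi] := is_derive_complex (g := fun s => of_plane (x, s)) ci gy dg (ii G).
clearbody H G.
have /near_box[r r0 nD] := open_nbhs_nbhs (conj (@open_odisc R (0, 0) 1) Dw).
have nx : \forall s \near x, D (s, y).
  apply/nbhs_ballP; exists r => //= s; rewrite /ball/= distrC => sr.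
  by apply: nD => //=; rewrite subrr normr0.
have ny : \forall s \near y, D (x, s).
  apply/nbhs_ballP; exists r => //= s; rewrite /ball/= distrC => sr.
  by apply: nD => //=; rewrite subrr normr0.
have uE z : D z -> u z = Re (h (of_plane z)) + 1 * Re (g (of_plane z)).
  by move=> /Ddisk /fE; rewrite /u => ->; rewrite mul1r; case: (h _) (g _) => a b [c d].
have vE z : D z -> v z = Im (h (of_plane z)) + -1 * Im (g (of_plane z)).
  by move=> /Ddisk /fE; rewrite /v => ->; rewrite mulN1r; case: (h _) (g _) => a b [c d].
split.
- rewrite -[Re G]mul1r; apply: (derive_real_comb _ ux hxr gxr).
  by apply: filterS nx => s Ds; exact: uE.
- rewrite -[- Im G]mul1r; apply: (derive_real_comb _ uy hyr gyr).
  by apply: filterS ny => s Ds; exact: uE.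
- rewrite -[- Im G]mulN1r; apply: (derive_real_comb _ vx hxi gxi).
  by apply: filterS nx => s Ds; exact: vE.
- rewrite -[- Re G]mulN1r; apply: (derive_real_comb _ vy hyi gyi).
  by apply: filterS ny => s Ds; exact: vE.
Qed.

(** [|h' - g'| <= |h'| + |g'| <= K (|h'| - |g'|) <= K |h' + g'|]. *)
Lemma quasiregular_gradient (K : R) (f : R[i] -> R[i]) (w : R * R) :
  let u w := Re (f (of_plane w)) in let v w := Im (f (of_plane w)) in
  0 <= K -> harmonic_quasiregular K f -> D w ->
  partial_x v w ^+ 2 + partial_y v w ^+ 2 <=
  (K * partial_x u w) ^+ 2 + (K * partial_y u w) ^+ 2.
Proof.
move=> u v K0 [[hu hv] [h [g [dec sp qr]]]] Dw.
have Dz : unit_disk (of_plane w) by move: (Dw); rewrite -unit_disk_planeE.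
rewrite unit_disk_planeE in hu hv.
have [_ [_ [_ [_ [Cu _ _ _]]]]] := real_harmonic_with hu.
have [_ [_ [_ [_ [Cv _ _ _]]]]] := real_harmonic_with hv.
have [-> -> -> ->] := gradient_decomposition dec Cu Cv Dw.
set H := cderiv h _; set G := cderiv g _.
have sqrE (z : R[i]) : Re z ^+ 2 + Im z ^+ 2 = cabs z ^+ 2.
  by rewrite cabsE sqr_sqrtr// addr_ge0 ?sqr_ge0.
have -> : (Im H - Im G) ^+ 2 + (Re H - Re G) ^+ 2 = cabs (H - G) ^+ 2.
  by rewrite -sqrE addrC; case: (H) (G) => a b [c d].
have -> : (K * (Re H + Re G)) ^+ 2 + (K * (- Im H - Im G)) ^+ 2 = (K * cabs (H + G)) ^+ 2.
  by rewrite !exprMn -mulrDr -sqrE -opprD sqrrN; case: (H) (G) => a b [c d].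
have ge0 (z : R[i]) : 0 <= cabs z by rewrite cabsE sqrtr_ge0.
have lt : cabs G < cabs H by have := sp _ Dz; rewrite subr_gt0 ltr_pXn2r ?nnegrE.
have := qr _ Dz; rewrite -/H -/G ler_pdivrMr ?subr_gt0// => qrz.
clearbody H G.
rewrite ler_pXn2r ?nnegrE ?mulr_ge0//.
apply: le_trans (_ : cabs H + cabs G <= _); first by rewrite -(cabsN G) cabsD.
apply: le_trans qrz _; apply: ler_wpM2l => //.
by rewrite lerBlDr -{1}(addrK G H) -(cabsN G) cabsD.
Qed.

End complex_part.

(** * Bergman norms *)

Section bergman.
Context {R : realType}.
Local Open Scope complex_scope.
Local Notation mR := (measurableTypeR R).
Local Notation plane := (mR * mR)%type.
Local Notation mu2 := (@lebesgue_measure R \x @lebesgue_measure R)%E.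
Local Notation D := (odisc (0, 0) 1 : set (R * R)).
Local Notation Re := (@complex.Re R).
Local Notation Im := (@complex.Im R).

Definition disc_energy (p alpha : R) (u : R * R -> R) : \bar R :=
  (\int[mu2]_(z in D) ((1 - sqn z) `^ alpha * `|u z| `^ p)%:E)%E.

Lemma measurable_energy (p alpha : R) (u : R * R -> R) :
  (forall w, D w -> {for w, continuous u}) ->
  measurable_fun D (fun z : plane => ((1 - sqn z) `^ alpha * `|u z| `^ p)%:E).
Proof.
move=> cu; apply/measurable_EFinP; apply: measurable_funM; first exact: measurable_full_weight.
exact: measurable_norm_powR cu.
Qed.

Lemma disc_energy_ge0 p alpha u : (0 <= disc_energy p alpha u)%E.
Proof. by apply: integral_ge0 => z _; rewrite lee_fin mulr_ge0// powR_ge0. Qed.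

Lemma C1_affine (A : set (R * R)) (c d : R) f fx fy : open A -> C1 A f fx fy ->
  C1 A (fun w => c * f w + d) (fun w => c * fx w) (fun w => c * fy w).
Proof.
move=> oA hf; have h := C1_add (C1_mul oA (@C1_cst R A c) hf) (@C1_cst R A d).
by apply: C1_eq h => // w /=; rewrite mul0r add0r addr0.
Qed.

Lemma harmonic_affine (c d : R) u ux uy : harmonic_with D u ux uy ->
  harmonic_with D (fun w => c * u w + d) (fun w => c * ux w) (fun w => c * uy w).
Proof.
move=> [uxx [uxy [uyx [uyy [h1 h2 h3 h4]]]]]; have oD := @open_odisc R (0, 0) 1.
exists (fun w => c * uxx w), (fun w => c * uxy w), (fun w => c * uyx w), (fun w => c * uyy w); split.
- exact: C1_affine.
- by apply: C1_eq (C1_affine c 0 oD h2) => // w; rewrite addr0.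
- by apply: C1_eq (C1_affine c 0 oD h3) => // w; rewrite addr0.
- by move=> w Dw; rewrite -mulrDr h4// mulr0.
Qed.

Lemma disc_energy_scale (p alpha c : R) u : 0 <= c ->
  (forall w, D w -> {for w, continuous u}) ->
  (disc_energy p alpha (fun w => c * u w)%R = (c `^ p)%:E * disc_energy p alpha u)%E.
Proof.
move=> c0 cu; rewrite /disc_energy -ge0_integralZl_EFin ?powR_ge0//; last 3 first.
- exact: measurable_disc.
- by move=> z _; rewrite lee_fin mulr_ge0// powR_ge0.
- exact: measurable_energy.
apply: eq_integral => z _; rewrite -EFinM; congr EFin.
by rewrite normrM (ger0_norm c0) powRM// mulrCA.
Qed.

(** The disc of radius 6 around the origin contains [D], so this is [carleson] at [w = 0]. *)
Lemma disc_weight_finite (alpha : R) : -1 < alpha ->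
  (\int[mu2]_(z in D) ((1 - sqn z) `^ alpha)%:E < +oo)%E.
Proof.
move=> a1; have [C _ hC] := carleson a1.
have n0 : nrm (0 : R, 0 : R) = 0 by rewrite /nrm /sqn /= expr0n addr0 sqrtr0.
have := hC (0, 0) 1; rewrite n0 subr0 => /(_ ltr01 erefl) h.
apply: le_lt_trans (ltry (C * 1 `^ (alpha + 2))); apply: le_trans h.
rewrite le_eqVlt; apply/orP; left; apply/eqP; apply: eq_integral => z; rewrite inE => Dz.
rewrite indicE mem_set ?mulr1//.
have z1 : nrm z < 1 by rewrite -disc_nrm.
rewrite odiscE ?pdist0; last by lra.
by apply: (lt_trans z1); lra.
Qed.

(** The two real-variable inequalities in one form; only for [p <= 1] does the constant
    involve [alpha]. *)
Lemma conjugate_inequality : exists c : R -> R -> R,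
  (forall p alpha, 0 < p -> -1 < alpha -> 0 < c p alpha /\
    forall u ux uy v vx vy,
    harmonic_with D u ux uy -> harmonic_with D v vx vy ->
    (forall w, D w -> vx w ^+ 2 + vy w ^+ 2 <= ux w ^+ 2 + uy w ^+ 2) -> v (0, 0) = 0 ->
    (disc_energy p alpha v <= (c p alpha)%:E * disc_energy p alpha u)%E) /\
  (forall p alpha beta, 1 < p -> c p alpha = c p beta).
Proof.
pose Q p alpha c := 0 < c /\ forall u ux uy v vx vy,
    harmonic_with D u ux uy -> harmonic_with D v vx vy ->
    (forall w, D w -> vx w ^+ 2 + vy w ^+ 2 <= ux w ^+ 2 + uy w ^+ 2) -> v (0, 0) = 0 ->
    (disc_energy p alpha v <= c%:E * disc_energy p alpha u)%E.
have large p : exists c, 1 < p -> forall alpha, Q p alpha c.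
  have [p1|] := boolP (1 < p); last by exists 0.
  by have [c c0 hc] := riesz_disc p1; exists c => _ alpha; split => //; exact: hc.
have small (x : R * R) : exists c, 0 < x.1 -> x.1 <= 1 -> -1 < x.2 -> Q x.1 x.2 c.
  have [p0|] := boolP (0 < x.1); last by exists 0.
  have [p1|] := boolP (x.1 <= 1); last by exists 0.
  have [a1|] := boolP (-1 < x.2); last by exists 0.
  by have [c c0 hc] := small_disc p0 p1 a1; exists c => _ _ _; split.
have [c1 hc1] := choice large; have [c2 hc2] := choice small.
exists (fun p alpha => if 1 < p then c1 p else c2 (p, alpha)); split.
  move=> p alpha p0 a1; case: ifPn => [p1|]; first exact: (hc1 p p1 alpha).
  by rewrite -leNgt => p1; exact: (hc2 (p, alpha)).
by move=> p alpha beta ->.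
Qed.

Lemma bergman_normE (p alpha : R) (F : R[i] -> R) : -1 < alpha ->
  (forall w, D w -> {for w, continuous (fun w => F (of_plane w))}) ->
  (bergman_norm p alpha (fun z => (F z)%:C) =
   poweR (((alpha + 1) / pi)%:E * disc_energy p alpha (fun w => F (of_plane w))) p^-1)%E.
Proof.
move=> a1 cF; rewrite /bergman_norm /disc_energy unit_disk_planeE; congr poweR.
rewrite -ge0_integralZl_EFin; last 4 first.
- exact: measurable_disc.
- by move=> z _; rewrite lee_fin mulr_ge0// powR_ge0.
- exact: measurable_energy.
- by rewrite divr_ge0 ?pi_ge0//; lra.
apply: eq_integral => w _; rewrite -EFinM; congr EFin.
rewrite cabs_real /dA_density cabs_of_plane nrm_sqr; ring.
Qed.

Lemma real_harmonic0 : real_harmonic_on D (fun=> 0 : R).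
Proof.
have px : partial_x (fun=> 0 : R) = (fun=> 0) :> (R * R -> R).
  by apply/funext => w; rewrite /partial_x derive_cst.
have py : partial_y (fun=> 0 : R) = (fun=> 0) :> (R * R -> R).
  by apply/funext => w; rewrite /partial_y derive_cst.
have c : C1_on D (fun=> 0 : R).
  by move=> w _; rewrite px py; split; [exact: derivable_cst|exact: derivable_cst|exact: cvg_cst|exact: cvg_cst].
by split; [split; rewrite ?px ?py|move=> w _; rewrite px py px py addr0].
Qed.

Lemma harmonic_re_im (f : R[i] -> R[i]) : harmonic_disk f ->
  harmonic_disk (re_part f) /\ harmonic_disk (im_part f).
Proof.
move=> [hu hv]; have h0 := real_harmonic0; rewrite -unit_disk_planeE in h0.
by split; split; [exact: hu|exact: h0|exact: hv|exact: h0].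
Qed.

(** Only finiteness is at stake, so the constant [v (0, 0)] costs a factor and a multiple of the
    total mass of the weight. *)
Lemma disc_energy_finite_shift (p alpha c : R) (v : R * R -> R) : 0 < p -> -1 < alpha ->
  (forall w, D w -> {for w, continuous v}) ->
  (disc_energy p alpha (fun w => v w - c)%R < +oo -> disc_energy p alpha v < +oo)%E.
Proof.
move=> p0 a1 cv fin; have mD := @measurable_disc R 1.
have cvc w : D w -> {for w, continuous (fun w => v w - c)}.
  by move=> Dw; apply: cvgB; [exact: cv|exact: cvg_cst].
have mW : measurable_fun D (fun z : plane => ((1 - sqn z) `^ alpha)%:E).
  by apply/measurable_EFinP; exact: measurable_full_weight.
have mE := measurable_energy p alpha cvc.
pose k1 : R := 2 `^ p; pose k2 : R := 2 `^ p * `|c| `^ p.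
have k10 : 0 <= k1 by exact: powR_ge0.
have k20 : 0 <= k2 by rewrite mulr_ge0 ?powR_ge0.
apply: (@le_lt_trans _ _ (k1%:E * disc_energy p alpha (fun w => v w - c)%R +
    k2%:E * \int[mu2]_(z in D) ((1 - sqn z) `^ alpha)%:E)%E); last first.
  apply: lte_add_pinfty; apply: lte_mul_pinfty => //.
  - exact: disc_weight_finite.
rewrite /disc_energy -!ge0_integralZl_EFin//; last 2 first.
- by move=> z _; rewrite lee_fin powR_ge0.
- by move=> z _; rewrite lee_fin mulr_ge0 ?powR_ge0.
rewrite -ge0_integralD//; last 4 first.
- by move=> z _; rewrite mule_ge0 ?lee_fin ?mulr_ge0 ?powR_ge0.
- exact: emeasurable_funM.
- by move=> z _; rewrite mule_ge0 ?lee_fin ?powR_ge0.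
- exact: emeasurable_funM.
apply: ge0_le_integral => //.
- by move=> z _; rewrite lee_fin mulr_ge0 ?powR_ge0.
- exact: measurable_energy.
- by apply: emeasurable_funD; exact: emeasurable_funM.
move=> z _; rewrite -!EFinM -EFinD lee_fin.
have h : `|v z| `^ p <= k1 * `|v z - c| `^ p + k2.
  apply: le_trans (_ : (`|v z - c| + `|c|) `^ p <= _).
    apply: ge0_ler_powR; rewrite ?nnegrE ?(ltW p0) ?addr_ge0//.
    by apply: le_trans (ler_normD _ _); rewrite subrK.
  by apply: le_trans (powR_add_le (ltW p0) (normr_ge0 _) (normr_ge0 _)) _; rewrite mulrDr.
apply: le_trans (ler_wpM2l (powR_ge0 _ _) h) _.
by rewrite le_eqVlt; apply/orP; left; apply/eqP; ring.
Qed.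

End bergman.

Local Close Scope classical_set_scope.

Theorem theorem1p1 (R : realType) :
  exists C : R -> R -> R -> R,
    (forall p K alpha : R, 0 < p -> 1 <= K -> -1 < alpha ->
      0 < C p K alpha /\
      forall f : R[i]%C -> R[i]%C,
        harmonic_quasiregular K f ->
        in_bergman p alpha (re_part f) ->
        in_bergman p alpha (im_part f) /\
        (im_part f 0 = 0 ->
         (bergman_norm p alpha (im_part f) <=
          (C p K alpha)%:E * bergman_norm p alpha (re_part f))%E)) /\
    (forall p K alpha beta : R, 1 < p -> 1 <= K -> -1 < alpha -> -1 < beta ->
      C p K alpha = C p K beta).
Proof.
have [c [hc ca]] := @conjugate_inequality R.
(* [K^p] from passing to [K u], then the root of order [p] *)
exists (fun p K alpha => K * (c p alpha) `^ p^-1); split; last first.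
  by move=> p K alpha beta p1 _ _ _; rewrite (ca p alpha beta).
move=> p K alpha p0 K1 a1; have K0 : 0 < K by exact: lt_le_trans K1.
have [c0 ineq] := hc p alpha p0 a1.
split; first by rewrite mulr_gt0// powR_gt0.
move=> f qf [_ nfin]; have [hf _] := qf; have [hu hv] := hf.
rewrite unit_disk_planeE in hu hv.
pose u w := complex.Re (f (of_plane w)); pose v w := complex.Im (f (of_plane w)).
have hu' := real_harmonic_with hu; have hv' := real_harmonic_with hv.
have cu w : odisc (0, 0) 1 w -> {for w, continuous u} by exact: (harmonic_continuous hu').
have cv w : odisc (0, 0) 1 w -> {for w, continuous v} by exact: (harmonic_continuous hv').
have k0 : 0 < (alpha + 1) / pi :> R by rewrite divr_gt0 ?pi_gt0//; lra.
set k := (alpha + 1) / pi in k0.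
have nu : bergman_norm p alpha (re_part f) = poweR (k%:E * disc_energy p alpha u)%E p^-1.
  exact: (bergman_normE p (F := fun z => complex.Re (f z)) a1 cu).
have nv : bergman_norm p alpha (im_part f) = poweR (k%:E * disc_energy p alpha v)%E p^-1.
  exact: (bergman_normE p (F := fun z => complex.Im (f z)) a1 cv).
have bound b : v (0, 0) - b = 0 ->
    (disc_energy p alpha (fun w => v w - b)%R <= (c p alpha * K `^ p)%:E * disc_energy p alpha u)%E.
  move=> vb; rewrite EFinM -muleA -(disc_energy_scale p alpha (ltW K0) cu).
  have hKu := harmonic_affine K 0 hu'; have hvb := harmonic_affine 1 (- b) hv'.
  have -> : (fun w => v w - b) = (fun w => 1 * v w - b) by apply/funext => w; rewrite mul1r.
  have -> : (fun w => K * u w) = (fun w => K * u w + 0) by apply/funext => w; rewrite addr0.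
  apply: (ineq _ _ _ _ _ _ hKu hvb); last by rewrite mul1r.
  by move=> w Dw; rewrite !mul1r; exact: (quasiregular_gradient (ltW K0) qf Dw).
have ufin : (disc_energy p alpha u < +oo)%E.
  move: nfin; rewrite nu => /(lty_poweRy (invr_neq0 (lt0r_neq0 p0))).
  by rewrite !ltey; apply: contraNN => /eqP ->; rewrite gt0_muley ?lte_fin.
split.
  split; first by have [] := harmonic_re_im hf.
  rewrite nv; apply: poweR_lty; apply: lte_mul_pinfty; [exact: (ltW k0)|by []|].
  apply: (disc_energy_finite_shift (c := v (0, 0)) p0 a1 cv).
  apply: le_lt_trans (bound _ (subrr _)) _.
  by apply: lte_mul_pinfty; rewrite ?lee_fin ?mulr_ge0 ?powR_ge0 ?(ltW c0).
move=> f0; have v0 : v (0, 0) = 0.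
  have := f0; rewrite /im_part => /(congr1 (@complex.Re R)) /=.
  by [].
have := bound 0; rewrite v0 subr0 => /(_ erefl).
have -> : (fun w => v w - 0) = v by apply/funext => w; rewrite subr0.
move=> h; rewrite nu nv.
have -> : ((K * c p alpha `^ p^-1)%:E = poweR (c p alpha * K `^ p)%:E p^-1)%E.
  rewrite poweR_EFin powRM ?powR_ge0 ?(ltW c0)// -powRrM mulfV ?gt_eqF// powRr1 ?(ltW K0)//.
  by rewrite mulrC.
have E0 w := disc_energy_ge0 p alpha w.
have q1 : (0 <= (c p alpha * K `^ p)%:E)%E.
  by rewrite lee_fin; apply: mulr_ge0; [exact: ltW|exact: powR_ge0].
have q2 w : (0 <= k%:E * disc_energy p alpha w)%E by apply: mule_ge0 => //; exact: (ltW k0).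
rewrite -poweRM//; apply: gt0_ler_poweR; first by rewrite invr_ge0 ltW.
- by rewrite in_itv/= leey andbT.
- by rewrite in_itv/= leey andbT; exact: mule_ge0.
by rewrite muleCA; apply: lee_wpmul2l => //; exact: (ltW k0).
Qed.
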